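(* Let $f:M\to M$ be $H_1$-expanding, with action $A$ on $H_1(M;\mathbb{Z})\cong\mathbb{Z}^b$, and fix a lift $\tilde f:\tilde M_a\to\tilde M_a$ of $f$ to the universal Abelian cover. Let $\tilde\alpha:\tilde M_a\to\mathbb{R}^b$ be the map sending $\tilde x$ to the unique point $\tilde y\in\mathbb{R}^b$ such that the orbit of $\tilde x$ under $\tilde f$ shadows the orbit of $\tilde y$ under $A$. Then $\tilde\alpha$ is continuous, is equivariant, i.e. $\tilde\alpha(\delta_{\vec n}\tilde x)=\tilde\alpha(\tilde x)+\vec n$ for all $\tilde x\in\tilde M_a$ and $\vec n\in\mathbb{Z}^b$, and satisfies $\tilde\alpha\circ\tilde f=A\circ\tilde\alpha$. It thus descends to a continuous map $\alpha:M\to\mathbb{T}^b$ which is a semiconjugacy of $f$ acting on $M$ to $\Phi_A$ acting on the compact, invariant set $\alpha(M)\subset\mathbb{T}^b$ (that is, $\alpha\circ f=\Phi_A\circ\alpha$). Further, $\alpha$ is homotopic to $\iota:M\to\mathbb{T}^b$, and thus if $M=\mathbb{T}^b$ then $\alpha$ is onto.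
   Context: Setting: $M$ is a smooth, connected, orientable, compact (Riemannian) manifold with $H_1(M;\mathbb{Z})\cong\mathbb{Z}^b$ torsion-free, $b>0$, and $f:M\to M$ is continuous, onto and orientation preserving. $A=f_*:H_1(M;\mathbb{Z})\to H_1(M;\mathbb{Z})$ is the induced map, viewed as a $b\times b$ integer matrix, and $\Phi_A:\mathbb{T}^b\to\mathbb{T}^b$ is the induced endomorphism of $\mathbb{T}^b=\mathbb{R}^b/\mathbb{Z}^b$. The universal Abelian cover $\pi:\tilde M_a\to M$ is the quotient of the universal cover by the commutator subgroup of $\pi_1(M)$; its deck group is $\mathbb{Z}^b=H_1(M;\mathbb{Z})$, with $\delta_{\vec n}$ the deck transformation of $\vec n$. Every $f$ lifts to $\tilde f:\tilde M_a\to\tilde M_a$, and $\tilde f\circ\delta_{\vec n}=\delta_{A\vec n}\circ\tilde f$. The map $\tilde\iota$: choose a basis $\Gamma_1,\dots,\Gamma_b$ of $H_1(M;\mathbb{Z})$ and a dual basis $\omega_1,\dots,\omega_b$ of harmonic one-forms for $H^1_{DR}(M;\mathbb{R})$, $\omega_i(\Gamma_j)=\delta_{ij}$; lift them to $\tilde\omega_i$ on $\tilde M_a$, fix $\tilde x_0\in\tilde M_a$, and set $\tilde\iota(\tilde x)=\left(\int_\gamma\tilde\omega_1,\dots,\int_\gamma\tilde\omega_b\right)\in\mathbb{R}^b$ for any smooth path $\gamma$ from $\tilde x_0$ to $\tilde x$. Then $\tilde\iota\circ\delta_{\vec n}=\tilde\iota+\vec n$, so $\tilde\iota$ descends to $\iota:M\to\mathbb{T}^b$.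 $f$ is $H_1$-expanding if all eigenvalues of $A$ lie outside the closed unit disk. The orbit of $\tilde x$ under $\tilde f$ shadows the orbit of $\tilde y\in\mathbb{R}^b$ under $A$ if there is a constant $K$ with $\|\tilde\iota(\tilde f^n(\tilde x))-A^n\tilde y\|\le K$ for all $n\ge 0$. For $H_1$-expanding $f$, for each $\tilde x$ exactly one such $\tilde y$ exists. *)

(* Defs.v *)
From HB Require Import structures.
From mathcomp Require Import all_boot all_order all_algebra.
From mathcomp Require Import all_classical all_reals all_analysis.
From mathcomp Require Import complex freeg.

Set Implicit Arguments.
Unset Strict Implicit.
Unset Printing Implicit Defensive.

Import Order.TTheory GRing.Theory Num.Theory numFieldNormedType.Exports.

Local Open Scope classical_set_scope.
Local Open Scope ring_scope.
Local Open Scope quotient_scope.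

Section Topology.
Context {R : realType}.
Implicit Types X Y : topologicalType.

Definition homeo_between X Y (A : set X) (B : set Y)
    (f : X -> Y) (g : Y -> X) : Prop :=
  [/\ f @` A `<=` B, g @` B `<=` A,
      forall x, A x -> g (f x) = x & forall y, B y -> f (g y) = y] /\
  ({within A, continuous f} /\ {within B, continuous g}).

Definition homeomorphic X Y : Prop :=
  exists (f : X -> Y) (g : Y -> X), homeo_between setT setT f g.

Definition homotopic X Y (f g : X -> Y) : Prop :=
  exists H : R * X -> Y,
    [/\ {within `[0, 1] `*` setT, continuous H},
        forall x, H (0, x) = f x & forall x, H (1, x) = g x].

Definition path_connected X : Prop :=
  forall x y : X, exists gamma : R -> X,
    [/\ {within `[0, 1], continuous gamma}, gamma 0 = x & gamma 1 = y].

Definition simply_connected X : Prop :=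
  path_connected X /\
  forall gamma : R -> X, {within `[0, 1], continuous gamma} ->
    gamma 0 = gamma 1 ->
    exists H : R * R -> X,
      [/\ {within `[0, 1] `*` `[0, 1], continuous H},
          forall t, t \in `[0, 1] -> H (0, t) = gamma t,
          forall t, t \in `[0, 1] -> H (1, t) = gamma 0,
          forall s, s \in `[0, 1] -> H (s, 0) = gamma 0 &
          forall s, s \in `[0, 1] -> H (s, 1) = gamma 0].

Definition quotient_map X Y (q : X -> Y) : Prop :=
  set_surj setT setT q /\ forall V : set Y, open V <-> open (q @^-1` V).

End Topology.

Section Coverings.
Implicit Types E B X : topologicalType.

Definition evenly_covered E B (p : E -> B) (U : set B) : Prop :=
  exists (I : Type) (V : I -> set E),
    [/\ forall i, open (V i), trivIset setT V, p @^-1` U = \bigcup_i V i &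
        forall i, exists s : B -> E, homeo_between (V i) U p s].

Definition is_covering E B (p : E -> B) : Prop :=
  [/\ continuous p, set_surj setT setT p &
      forall x : B, exists U : set B, [/\ open U, U x & evenly_covered p U]].

Definition is_deck E B (p : E -> B) (d : E -> E) : Prop :=
  [/\ continuous d,
      exists d' : E -> E, [/\ continuous d', cancel d d' & cancel d' d] &
      p \o d = p].

(* The commutator subgroup of a group D of bijections: the products of
   commutators a b a^-1 b^-1 (the inverse of a commutator is one). *)
Inductive commutator_subgroup X (D : (X -> X) -> Prop) : (X -> X) -> Prop :=
| commutator_id : commutator_subgroup D id
| commutator_cons (a a' b b' d : X -> X) :
    D a -> D a' -> cancel a a' -> cancel a' a ->
    D b -> D b' -> cancel b b' -> cancel b' b ->
    commutator_subgroup D d ->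
    commutator_subgroup D (a \o b \o a' \o b' \o d).

(* pi : Ma -> M is the quotient of the universal cover U of M by the commutator
   subgroup of pi_1(M), where pi_1(M) acts on U as the deck group of U -> M. *)
Definition universal_abelian_cover (R : realType) (Ma M : topologicalType)
    (pi : Ma -> M) : Prop :=
  exists (U : topologicalType) (p : U -> M) (q : U -> Ma),
    [/\ is_covering p, simply_connected (R := R) U, quotient_map q,
        pi \o q = p &
        forall u v, q u = q v <->
          exists2 d, commutator_subgroup (is_deck p) d & v = d u].

End Coverings.

Section StandardSimplex.
Variable R : realType.

Definition std_simplex (n : nat) : set 'rV[R]_n.+1 :=
  [set x | (forall i, 0 <= x 0 i) /\ \sum_i x 0 i = 1].

Arguments std_simplex n _ : clear implicits.

Definition face_fun (n : nat) (i : 'I_n.+2) (x : 'rV[R]_n.+1) : 'rV[R]_n.+2 :=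
  \row_j oapp (fun k => x 0 k) 0 (unlift i j).

Lemma face_fun_simplex n (i : 'I_n.+2) (x : std_simplex n) :
  face_fun i (val x) \in std_simplex n.+1.
Proof.
case: x => x /= /set_mem [x0 x1]; apply/mem_set; split=> [j|].
  by rewrite mxE; case: unliftP => //= k _; exact: x0.
rewrite (bigD1_ord i) //= mxE unlift_none add0r -[RHS]x1.
by apply: eq_bigr => k _; rewrite mxE liftK.
Qed.

Definition face (n : nat) (i : 'I_n.+2) (x : std_simplex n) :
    std_simplex n.+1 :=
  exist _ (face_fun i (val x)) (face_fun_simplex i x).

Fact face_continuous n (i : 'I_n.+2) : continuous (@face n i).
Proof.
apply: (@continuous_comp_initial _ _ _ (@set_val _ (std_simplex n.+1))) => x A.
move=> [P nP PA] /=.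
suff: \forall y \near x, forall j, P 0 j ((face_fun i (val y)) 0 j).
  by apply: filterS => y Py; apply: PA => /= a j; rewrite ord1; exact: Py.
have FF : Filter (nbhs x) by exact: nbhs_filter.
apply: (@filter_forall _ _ _ (nbhs x)) => j.
have := nP 0 j; rewrite /= !mxE.
case E: (unlift i j) => [k|] /= nPj; last first.
  by apply: filterE => y /=; rewrite mxE E; exact: nbhs_singleton nPj.
have cx : (fun y : std_simplex n => (val y : 'rV[R]_n.+1) 0 k) @ x --> val x 0 k.
  apply: (@continuous_comp _ _ _ (@set_val _ (std_simplex n))
    (fun M : 'rV[R]_n.+1 => M 0 k)); first exact: initial_continuous.
  exact: coord_continuous.
apply: (@filterS _ (nbhs x) FF _ _ _ (cx _ nPj)) => y /=.
by rewrite mxE E.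
Qed.

HB.instance Definition _ n (i : 'I_n.+2) :=
  isContinuous.Build (std_simplex n) (std_simplex n.+1) (@face n i)
    (@face_continuous n i).

Fact vertex_subproof n (i : 'I_n.+1) :
  (delta_mx 0 i : 'rV[R]_n.+1) \in std_simplex n.
Proof.
apply/mem_set; split=> [j|]; first by rewrite mxE ler0n.
rewrite (bigD1 i) //= mxE !eqxx big1 ?addr0 // => j /negPf ji.
by rewrite mxE ji andbF.
Qed.

Definition vertex n (i : 'I_n.+1) : std_simplex n :=
  exist _ (delta_mx 0 i) (vertex_subproof i).

End StandardSimplex.

Arguments std_simplex R n _ : clear implicits.
Arguments vertex R n i : clear implicits.

Definition simplex (R : realType) (n : nat) (X : topologicalType) :=
  continuousType (std_simplex R n) X.

Section Homology.
Context {R : realType}.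
Implicit Types X Y : topologicalType.

Definition chain (n : nat) X := {freeg (simplex R n X) / int}.

Definition boundary n X : chain n.+1 X -> chain n X :=
  fglift (fun s : simplex R n.+1 X =>
    \sum_(i < n.+2) << (-1) ^+ i *g (s \o face i : simplex R n X) >>).

Definition is_cycle n X : chain n X -> Prop :=
  if n is m.+1 then fun c => boundary c = 0 else fun=> True.

Definition homologous n X (c c' : chain n X) : Prop :=
  exists e : chain n.+1 X, c - c' = boundary e.

Definition push n X Y (f : continuousType X Y) : chain n X -> chain n Y :=
  fglift (fun s : simplex R n X => << (f \o s : simplex R n Y) >>).

Definition int_comb b n X (G : 'I_b -> chain n X) (v : 'cV[int]_b) :
    chain n X :=
  \sum_i G i *~ v i 0.

(* The classes of the cycles G 0, ..., G (b - 1) form a Z-basis of H_n(X; Z),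
   so that H_n(X; Z) is free of rank b. *)
Definition homology_basis b n X (G : 'I_b -> chain n X) : Prop :=
  (forall i, is_cycle (G i)) /\
  forall c, is_cycle c -> exists! v : 'cV[int]_b, homologous c (int_comb G v).

(* A is the matrix of f_* in the basis G: its columns are the coordinates of
   the images of the basis elements. *)
Definition induced_matrix b n X (f : continuousType X X)
    (G : 'I_b -> chain n X) (A : 'M[int]_b) : Prop :=
  forall j, homologous (push f (G j)) (int_comb G (col j A)).

(* The degree of f : X -> X, where X is a closed connected orientable
   n-manifold, is positive; mu is either of the two generators of
   H_n(X; Z) = Z, and the degree does not depend on which one. *)
Definition orientation_preserving n X (f : continuousType X X) : Prop :=
  exists mu : chain n X,
    [/\ is_cycle mu,
        forall c, is_cycle c -> exists! k : int, homologous c (mu *~ k) &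
        exists2 d : int, 0 < d & homologous (push f mu) (mu *~ d)].

(* delta v is the deck transformation corresponding to the class v in
   H_1(M; Z): paths from x to delta v x project to loops of class v. *)
Definition deck_action b (Ma M : topologicalType) (pi : continuousType Ma M)
    (G : 'I_b -> chain 1 M) (delta : 'cV[int]_b -> Ma -> Ma) : Prop :=
  forall v, is_deck pi (delta v) /\
    forall s : simplex R 1 Ma,
      s (vertex R 1 1) = delta v (s (vertex R 1 0)) ->
      homologous << (pi \o s : simplex R 1 M) >> (int_comb G v).

End Homology.

Section Smooth.
Context {R : realType}.

Definition partial n (i : 'I_n) (f : 'rV[R]_n -> R) : 'rV[R]_n -> R :=
  'D_(delta_mx 0 i) f.

Fixpoint Ck (k : nat) n (U : set 'rV[R]_n) (f : 'rV[R]_n -> R) : Prop :=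
  (forall x, U x -> {for x, continuous f}) /\
  if k is k'.+1 then
    forall i : 'I_n, (forall x, U x -> derivable f x (delta_mx 0 i)) /\
                     Ck k' U (partial i f)
  else True.

(* Meaningful for open U only: 'D and derivable see f near the points of U. *)
Definition smooth_on n (U : set 'rV[R]_n) (f : 'rV[R]_n -> R) : Prop :=
  forall k, Ck k U f.

Record smooth_atlas (n : nat) (M : topologicalType) := SmoothAtlas {
  chart_index : Type;
  chart_dom : chart_index -> set M;
  chart_im : chart_index -> set 'rV[R]_n;
  chart : chart_index -> M -> 'rV[R]_n;
  chart_inv : chart_index -> 'rV[R]_n -> M;
  chart_at : M -> chart_index;
  chart_dom_open : forall c, open (chart_dom c);
  chart_im_open : forall c, open (chart_im c);
  chart_homeo : forall c,
    homeo_between (chart_dom c) (chart_im c) (chart c) (chart_inv c);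
  chart_at_dom : forall p, chart_dom (chart_at p) p;
  chart_smooth : forall c c' (j : 'I_n),
    smooth_on (chart c @` (chart_dom c `&` chart_dom c'))
              (fun x => chart c' (chart_inv c x) 0 j)
}.

Section Atlas.
Context {n : nat} {M : topologicalType}.
Implicit Types S T : smooth_atlas n M.

Definition transition S T (c : chart_index S) (c' : chart_index T)
    (x : 'rV[R]_n) : 'rV[R]_n :=
  chart c' (chart_inv c x).

Definition overlap S T (c : chart_index S) (c' : chart_index T) :
    set 'rV[R]_n :=
  chart c @` (chart_dom c `&` chart_dom c').

Definition compatible S T : Prop :=
  forall (c : chart_index S) (c' : chart_index T) (j : 'I_n),
    smooth_on (overlap c c') (fun x => transition c c' x 0 j) /\
    smooth_on (overlap c' c) (fun x => transition c' c x 0 j).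

Definition oriented S : Prop :=
  forall (c c' : chart_index S) x, overlap c c' x ->
    0 < \det ('J (transition c c') x).

Definition orientable S : Prop :=
  exists T : smooth_atlas n M, compatible S T /\ oriented T.

(* Tangent vectors are row vectors v, transforming as v *m 'J tau x; a covector
   w is a column vector, with value v *m w on v. *)
Record riemannian_metric S := RiemannianMetric {
  metric :> chart_index S -> 'rV[R]_n -> 'M[R]_n;
  metric_smooth : forall c i j, smooth_on (chart_im c) (fun x => metric c x i j);
  metric_sym : forall c x, chart_im c x -> (metric c x)^T = metric c x;
  metric_pos : forall c x (v : 'rV[R]_n), chart_im c x -> v != 0 ->
    0 < (v *m metric c x *m v^T) 0 0;
  metric_transition : forall c c' x, overlap c c' x ->
    metric c x = 'J (transition c c') x *m metric c' (transition c c' x)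
                 *m ('J (transition c c') x)^T
}.

Record one_form S := OneForm {
  form :> chart_index S -> 'rV[R]_n -> 'cV[R]_n;
  form_smooth : forall c i, smooth_on (chart_im c) (fun x => form c x i 0);
  form_transition : forall c c' x, overlap c c' x ->
    form c x = 'J (transition c c') x *m form c' (transition c c' x)
}.

Definition closed_form S (w : one_form S) : Prop :=
  forall c x i j, chart_im c x ->
    partial i (fun y => w c y j 0) x = partial j (fun y => w c y i 0) x.

(* The codifferential of w in the chart c:
   - det(g)^(-1/2) sum_i d_i (det(g)^(1/2) sum_j g^ij w_j). *)
Definition codifferential S (g : riemannian_metric S) (w : one_form S)
    (c : chart_index S) (x : 'rV[R]_n) : R :=
  - (Num.sqrt (\det (g c x)))^-1 *
  \sum_i partial i (fun y => Num.sqrt (\det (g c y)) *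
                             (invmx (g c y) *m w c y) i 0) x.

Definition harmonic_form S (g : riemannian_metric S) (w : one_form S) : Prop :=
  closed_form w /\
  forall c x, chart_im c x -> codifferential g w c x = 0.

Definition smooth_fun S (h : M -> R) : Prop :=
  forall c : chart_index S, smooth_on (chart_im c) (h \o chart_inv c).

(* The classes of the closed forms w i form a basis of H^1_DR(M; R). *)
Definition deRham_basis b S (w : 'I_b -> one_form S) : Prop :=
  (forall i, closed_form (w i)) /\
  forall u : one_form S, closed_form u ->
    exists! a : 'cV[R]_b, exists2 h : M -> R, smooth_fun S h &
      forall c x, chart_im c x ->
        u c x = \sum_i a i 0 *: w i c x
                + \col_j partial j (h \o chart_inv c) x.

(* A singular 1-simplex s as a path parametrized by [0, 1]; the values at
   t outside [0, 1] are irrelevant. *)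
Definition path_of X (s : simplex R 1 X) (t : R) : X :=
  s (insubd (vertex R 1 0) (\row_j (if j == 0 then 1 - t else t))).

Definition smooth_path S (s : simplex R 1 M) : Prop :=
  exists (gamma : R -> M) (e : R),
    [/\ 0 < e, forall t, t \in `[0, 1] -> gamma t = path_of s t &
        forall t, t \in `]-e, 1 + e[ -> {for t, continuous gamma} /\
          forall (c : chart_index S) (k : nat), chart_dom c (gamma t) ->
            derivable (derive1n k (chart c \o gamma)) t 1].

Definition line_integral S (w : one_form S) (s : simplex R 1 M) : R :=
  \int[@lebesgue_measure R]_(t in `[0, 1])
    let c := chart_at S (path_of s t) in
    (derive1 (chart c \o path_of s) t *m w c (chart c (path_of s t))) 0 0.

(* The integral of the closed form w over the homology class of the cycle z is
   r; it is computed on smooth cycles homologous to z. *)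
Definition deRham_pairing S (w : one_form S) (z : chain 1 M) (r : R) : Prop :=
  forall c : chain 1 M, {in dom c, forall s, smooth_path S s} ->
    homologous c z ->
    \sum_(s <- dom c) (coeff s c)%:~R * line_integral w s = r.

(* iotat x = (int_gamma pi^* w_i)_i for every smooth path gamma from x0 to x
   in the cover Ma. Smoothness of gamma is that of pi \o gamma, since pi is a
   local diffeomorphism, and int_gamma pi^* w_i = int_(pi \o gamma) w_i. *)
Definition integration_map b S (Ma : topologicalType)
    (pi : continuousType Ma M) (w : 'I_b -> one_form S) (x0 : Ma)
    (iotat : Ma -> 'cV[R]_b) : Prop :=
  forall (x : Ma) (s : simplex R 1 Ma),
    smooth_path S (pi \o s : simplex R 1 M) ->
    s (vertex R 1 0) = x0 -> s (vertex R 1 1) = x ->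
    iotat x = \col_i line_integral (w i) (pi \o s : simplex R 1 M).

End Atlas.
End Smooth.

Arguments smooth_atlas R n M : clear implicits.

Section Torus.
Variables (R : realType) (b : nat).

Definition int_equiv : rel 'cV[R]_b :=
  fun x y => [forall i, (x i 0 - y i 0) \is a Num.int].

Fact int_equiv_refl : reflexive int_equiv.
Proof. by move=> x; apply/forallP => i; rewrite subrr rpred0. Qed.

Fact int_equiv_sym : symmetric int_equiv.
Proof. by move=> x y; apply: eq_forallb => i; rewrite -opprB rpredN. Qed.

Fact int_equiv_trans : transitive int_equiv.
Proof.
move=> y x z /forallP xy /forallP yz; apply/forallP => i.
by rewrite -(subrKA (y i 0)) rpredD.
Qed.

Canonical int_equiv_equiv :=
  EquivRel int_equiv int_equiv_refl int_equiv_sym int_equiv_trans.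

Definition torus : Type := quotient_topology {eq_quot int_equiv}.

Definition torus_proj : 'cV[R]_b -> torus := \pi_torus.

Definition real_mx (A : 'M[int]_b) : 'M[R]_b := map_mx intr A.

Definition torus_endo (A : 'M[int]_b) (t : torus) : torus :=
  torus_proj (real_mx A *m repr t).

Definition H1_expanding (A : 'M[int]_b) : Prop :=
  forall z : R[i], eigenvalue (map_mx intr A : 'M[R[i]]_b) z -> 1 < `|z|.

(* The norm on R^b is the maximum norm. *)
Definition shadows (Ma : Type) (ft : Ma -> Ma) (iotat : Ma -> 'cV[R]_b)
    (A : 'M[int]_b) (x : Ma) (y : 'cV[R]_b) : Prop :=
  exists K : R, forall n : nat,
    `|iotat (iter n ft x) - iter n (mulmx (real_mx A)) y| <= K.

End Torus.

(* Main.v *)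
(** The powers of B = A^-1 decay geometrically.  Since iota~ f~ - A iota~ is
    constant on the fibres of pi and M is compact, it is bounded; hence
    B^N iota~ f~^N converges uniformly, to the unique shadowing point alpha~.

    Equivariance and the homotopy to iota only need the behaviour of iota~ on a
    fibre of pi: points x, y of a fibre are joined by a path whose projection is
    a cycle z ~ sum v_i Gamma_i, so iota~ y - iota~ x = v, and f~ changes v to
    A v.  No lifting along the covering is needed: any two paths with the same ends
    in the abelian cover have homologous projections, because appending one path
    from y to a deck translate of x turns both into paths from x to this
    translate, whose class [deck_action] prescribes.

    Integrals have to be computed on smooth paths.  Any two points of the cover
    are joined by smooth paths that are constant near their ends, built from
    axis-parallel moves in charts; the integral over such a move is bounded by
    its length, which makes iota~ continuous.

    If M is a torus, alpha becomes a self-map of the torus; let a : R^b -> R^b be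
    a lift of it and L its matrix on the fundamental group.  By equivariance the
    images of the standard generators are attained, so L has a right inverse and
    x |-> L^-1 a(x) is at bounded distance from the identity; the
    Poincare-Miranda theorem, deduced from Sperner's lemma on the Kuhn
    triangulation of a cube, makes it onto. *)

Require Import Defs.
From HB Require Import structures.
From mathcomp Require Import all_boot all_order all_algebra.
From mathcomp Require Import fingroup perm generic_quotient.
From mathcomp Require Import all_classical all_reals all_analysis.
From mathcomp Require Import complex freeg.
From mathcomp Require Import measurable_realfun.
From mathcomp Require Import ring lra zify.

Set Implicit Arguments.
Unset Strict Implicit.
Unset Printing Implicit Defensive.

Import Order.TTheory GRing.Theory Num.Theory numFieldNormedType.Exports.

Local Open Scope classical_set_scope.
Local Open Scope ring_scope.

(** * Decay of the powers of the inverse of an expanding matrix *)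

(** The hypothesis on [pi] presents [Ma] as a quotient of the universal cover U by a map [q], so the
    map given as a covering is [pi \o q]. Local sections, lifted coordinate boxes and smooth paths
    are built in U and pushed to [Ma] by [q]; continuity on [Ma] is tested on U, and descent to M
    uses sections into U.

    [integration_map] and [deRham_pairing] fix integrals over smooth paths from [x0] and over smooth
    chains in the classes [Gamma j]. Vanishing on smooth null-homologous chains, additivity under
    concatenation and independence of the starting point are therefore deduced from homology, and
    each class first gets a smooth representative: the projection of a smooth path between deck
    translates.

    The decay of A^-k comes from Cayley-Hamilton, one eigenvalue at a time. Lifts to R^b of maps
    into the torus are obtained by adding up increments modulo Z along rays. *)

Section MatrixDecay.
Context {R : realType}.
Local Notation normc := (@ComplexField.Normc.normc R).

Lemma normc_ge0 (x : R[i]) : 0 <= normc x.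
Proof. by case: x => a b; exact: sqrtr_ge0. Qed.

(** Solved as u (n+1) = (u n - e (n+1)) / z. With r = |z|^-1 the constant D satisfies r D + r C rho
    = D rho, so the induction reproduces it; such a D exists because r < rho strictly. *)
Lemma geometric_recurrence (z : R[i]) (C rho : R) (u e : nat -> R[i]) :
  0 <= C -> (normc z)^-1 < rho -> 0 < rho -> z != 0 ->
  (forall n, normc (e n) <= C * rho ^+ n) ->
  (forall n, u n = z * u n.+1 + e n.+1) ->
  forall n, normc (u n) <=
    (normc (u 0%N) + (normc z)^-1 * C * rho / (rho - (normc z)^-1)) * rho ^+ n.
Proof.
move=> C0 zr r0 z0 eC uE.
set r := (normc z)^-1 in zr *; set D := _ * C * rho / _.
have rge : 0 <= r by rewrite invr_ge0; exact: normc_ge0.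
have D0 : 0 <= D by rewrite /D !mulr_ge0// ?invr_ge0 ?subr_ge0 ltW.
have n0 := normc_ge0.
elim=> [|n IH]; first by rewrite expr0 mulr1 lerDl.
have uS : u n.+1 = z^-1 * (u n - e n.+1) by rewrite (uE n) addrK mulKf.
rewrite uS ComplexField.Normc.normcM ComplexField.Normc.normcV -/r.
apply: (@le_trans _ _ (r * (normc (u n) + normc (e n.+1)))).
  by rewrite ler_wpM2l// (le_trans (le_normcD _ _))// normcN.
apply: (@le_trans _ _ (r * ((normc (u 0%N) + D) * rho ^+ n + C * rho ^+ n.+1))).
  by rewrite ler_wpM2l// lerD.
have -> : r * ((normc (u 0%N) + D) * rho ^+ n + C * rho ^+ n.+1) =
   (r * (normc (u 0%N)) + (r * D + r * C * rho)) * rho ^+ n by rewrite exprS; ring.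
rewrite exprS [leRHS]mulrA ler_wpM2r ?exprn_ge0 ?(ltW r0)//.
have -> : r * C * rho = D * (rho - r) by rewrite /D divfK// subr_eq0 gt_eqF.
have -> : r * normc (u 0%N) + (r * D + D * (rho - r)) = r * normc (u 0%N) + D * rho by ring.
by rewrite mulrDl lerD2r mulrC ler_wpM2l// ltW.
Qed.

(** Induction on the roots. With W' = (A - z) W, the relation B^m W = z B^(m+1) W + B^(m+1) W' turns
    each entry into a solution of [geometric_recurrence] whose error decays by the induction
    hypothesis. A multiple root only costs a slightly larger rate. *)
Lemma power_decay_of_annihilator n (A B : 'M[R[i]]_n.+1) (rs : seq R[i])
    (W : 'M[R[i]]_n.+1) :
  B * A = 1 -> (forall z, z \in rs -> 1 < normc z) ->
  \prod_(z <- rs) (A - z%:M) * W = 0 ->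
  exists C rho : R, [/\ 0 <= C, 0 < rho, rho < 1 &
    forall k i j, normc ((B ^+ k * W) i j) <= C * rho ^+ k].
Proof.
move=> BA; elim/last_ind: rs W => [|rs z IH] W rs1.
  rewrite big_nil mul1r => ->; exists 0, 2^-1; split; rewrite ?invr_gt0 ?invf_lt1 ?ltr0n ?ltr1n//.
  by move=> k i j; rewrite mulr0 mxE mul0r ComplexField.Normc.normc0.
rewrite -cats1 big_cat/= big_seq1 -mulrA => H.
have z1 : 1 < normc z by apply: rs1; rewrite mem_rcons inE eqxx.
have [|C [rho [C0 r0 r1 BC]]] := IH _ _ H.
  by move=> y yr; apply: rs1; rewrite mem_rcons inE yr orbT.
have z0 : z != 0.
  by apply/eqP => z0; move: z1; rewrite z0 ComplexField.Normc.normc0 ltr10.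
have zV1 : (normc z)^-1 < 1 by rewrite invf_lt1// (lt_trans ltr01).
set r := Num.max (normc z)^-1 rho.
have r1' : r < 1 by rewrite gt_max zV1.
have zVr : (normc z)^-1 <= r by rewrite le_max lexx.
have rhor : rho <= r by rewrite le_max lexx orbT.
(* Strictly above both rates: at the rate |z|^-1 itself a repeated root would bring in a polynomial
   factor. *)
have [rho' [rr' r'1]] : exists x : R, r < x /\ x < 1 by exists ((r + 1) / 2); rewrite !midf_lt.
set u := fun i j k => (B ^+ k * W) i j.
have dec i j := @geometric_recurrence z C rho' (u i j)
  (fun k => (B ^+ k * ((A - z%:M) * W)) i j) C0.
exists (\sum_i \sum_j (normc (u i j 0%N) + (normc z)^-1 * C * rho' / (rho' - (normc z)^-1))), rho'.
have n0 := normc_ge0.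
have r'0 : 0 < rho' by rewrite (lt_trans _ rr')// (lt_le_trans r0).
have D0 i j : 0 <= normc (u i j 0%N) + (normc z)^-1 * C * rho' / (rho' - (normc z)^-1).
  rewrite addr_ge0// !mulr_ge0// ?invr_ge0//; first exact: ltW.
  by rewrite subr_ge0 (le_trans zVr)// ltW.
split=> //; first by apply: sumr_ge0 => i _; exact: sumr_ge0.
move=> k i j; apply: le_trans (dec i j _ r'0 z0 _ _ k) _ => //.
- exact: le_lt_trans rr'.
- move=> m; apply: le_trans (BC m i j) _.
  rewrite ler_wpM2l// lerXn2r ?nnegrE ?(ltW r0) ?(ltW r'0)//.
  by rewrite (le_trans rhor)// ltW.
- move=> m; rewrite /u.
  have -> : B ^+ m * W = z *: (B ^+ m.+1 * W) + B ^+ m.+1 * ((A - z%:M) * W).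
    rewrite mulrBl mulrBr -!mulmxE mul_scalar_mx -scalemxAr !mulmxE.
    by rewrite addrC subrK exprSr mulrA -[_ * B * A]mulrA BA mulr1.
  by rewrite mxE [in LHS]mxE.
- rewrite ler_wpM2r ?exprn_ge0 ?(ltW r'0)//.
  rewrite (bigD1 i)//= (bigD1 j)//= -addrA lerDl addr_ge0//; first exact: sumr_ge0.
  by apply: sumr_ge0 => i' _; exact: sumr_ge0.
Qed.

Lemma mx_norm_coord m n (M : 'M[R]_(m, n)) i j : `|M i j| <= `|M|.
Proof.
rewrite [leRHS]/Num.norm/= mx_normrE; apply/bigmax_geP; right => /=.
by exists (i, j).
Qed.

Lemma mx_norm_le m n (M : 'M[R]_(m, n)) (c : R) :
  0 <= c -> (forall i j, `|M i j| <= c) -> `|M| <= c.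
Proof.
move=> c0 Mc; rewrite [leLHS]/Num.norm/= mx_normrE.
by apply/bigmax_leP; split=> // -[i j] _; exact: Mc.
Qed.

Lemma mulmx_norm_le m n p (M : 'M[R]_(m, n)) (N : 'M[R]_(n, p)) (c : R) :
  0 <= c -> (forall i j, `|M i j| <= c) -> `|M *m N| <= n%:R * c * `|N|.
Proof.
move=> c0 Mc; apply: mx_norm_le => [|i j]; first by rewrite !mulr_ge0.
rewrite mxE (le_trans (ler_norm_sum _ _ _))//.
rewrite (@le_trans _ _ (\sum_(k < n) c * `|N|))//.
  by apply: ler_sum => k _; rewrite normrM ler_pM// mx_norm_coord.
by rewrite sumr_const card_ord -[leLHS]mulr_natl mulrA.
Qed.

(** Over the complex numbers the characteristic polynomial splits and annihilates A by
    Cayley-Hamilton, so the decay applies with W = 1. Expansion excludes the root 0, hence A is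
    invertible over R, though in general not over Z. The factor b in the constant passes from
    entries to the maximum norm. *)
Lemma H1_expanding_inverse b (A : 'M[int]_b) : (0 < b)%N ->
  H1_expanding R A ->
  exists (B : 'M[R]_b) (C rho : R),
    [/\ real_mx R A *m B = 1%:M, B *m real_mx R A = 1%:M,
        [/\ 0 <= C, 0 < rho & rho < 1] &
        forall k (v : 'cV[R]_b), `|iter k (mulmx B) v| <= C * rho ^+ k * `|v|].
Proof.
case: b A => [//|b] A _ expA.
set AR := real_mx R A; pose AC : 'M[R[i]]_b.+1 := map_mx intr A.
have expC z : root (char_poly AC) z -> 1 < normc z.
  by rewrite -eigenvalue_root_char => /expA; rewrite normc_def ltcR; case: z.
have ACE : AC = map_mx (real_complex R) AR.
  by apply/matrixP => i j; rewrite !mxE rmorph_int.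
have Aunit : AR \in unitmx.
  rewrite unitmxE unitfE; apply/negP => /eqP detA.
  suff /expC : root (char_poly AC) 0 by rewrite ComplexField.Normc.normc0 ltr10.
  by rewrite rootE horner_coef0 char_poly_det ACE det_map_mx detA rmorph0 mulr0.
set B := invmx AR; pose BC := map_mx (real_complex R) B.
have BA : BC * AC = 1 by rewrite ACE -mulmxE -map_mxM mulVmx// map_mx1.
have [rs rsE] := closed_field_poly_normal (char_poly AC).
rewrite (monicP (char_poly_monic AC)) scale1r in rsE.
have [||C [rho [C0 r0 r1 BCle]]] := @power_decay_of_annihilator _ AC BC rs 1 BA.
- by move=> z zrs; apply: expC; rewrite rsE root_prod_XsubC.
- have := Cayley_Hamilton AC; rewrite rsE rmorph_prod/= mulr1 => <-.
  by apply: eq_bigr => z _; rewrite rmorphB/= horner_mx_X horner_mx_C.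
exists B, (b.+1%:R * C), rho; split=> //; [exact: mulmxV|exact: mulVmx| |].
  by split=> //; rewrite mulr_ge0.
move=> k v.
have -> : iter k (mulmx B) v = B ^+ k *m v.
  elim: k => [|k IH]; first by rewrite expr0 mul1mx.
  by rewrite iterS IH mulmxA exprS mulmxE.
rewrite -mulrA mulrA -[in leRHS]mulrA mulrA.
have -> : b.+1%:R * C * rho ^+ k = b.+1%:R * (C * rho ^+ k) by rewrite mulrA.
apply: mulmx_norm_le => [|i j]; first by rewrite mulr_ge0// exprn_ge0// ltW.
have := BCle k i j; rewrite mulr1.
have -> : BC ^+ k = map_mx (real_complex R) (B ^+ k) by rewrite rmorphXn.
by rewrite mxE /ComplexField.Normc.normc/= expr0n/= addr0 sqrtr_sqr.
Qed.
End MatrixDecay.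

(** * Sperner's lemma and the Poincare-Miranda theorem *)

Section Combinatorics.
Local Open Scope set_scope.

Lemma involution_card_even (T : finType) (G : {set T}) (h : T -> T) :
  (forall x, x \in G -> [/\ h x \in G, h (h x) = x & h x != x]) -> ~~ odd #|G|.
Proof.
have [n] := ubnP #|G|; elim: n G => // n IH G Gn hG.
have [->|[x xG]] := set_0Vmem G; first by rewrite cards0.
have [hxG hhx hxx] := hG _ xG.
have hxG' : h x \in G :\ x by rewrite !inE hxx.
have cG : #|G| = (#|(G :\ x) :\ h x|).+2.
  by rewrite (cardsD1 x) xG (cardsD1 (h x)) hxG'.
rewrite cG /= negbK; apply: IH => [|y].
  by move: Gn; rewrite cG ltnS => /ltnW.
rewrite !inE => /and3P[yhx yx yG]; have [hyG hhy hyy] := hG _ yG.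
split=> //; rewrite hyG andbT; apply/andP; split.
  by apply: contraNneq yx => e; rewrite -hhy e hhx.
by apply: contraNneq yhx => e; rewrite -hhy e.
Qed.

(** [L] labels the vertices of a simplex; the set collects the facets, named by the omitted vertex,
    that carry every label but the last. For a bijection this is the facet omitting the last label.
    Otherwise such a facet either does not exist or comes with exactly one other, which omits the
    other vertex carrying the repeated label. *)
Lemma almost_onto_parity m (L : 'I_m.+1 -> 'I_m.+1) :
  odd #|[set j | [set~ ord_max] \subset L @: [set~ j]]| = injectiveb L.
Proof.
set D := [set j | _].
have [/injectiveP Linj|/injectiveP Linj] := boolP (injectiveb L).
  have [g gL Lg] := injF_bij Linj.
  suff -> : D = [set g ord_max] by rewrite cards1.
  apply/setP => j; rewrite !inE; apply/fintype.subsetP/eqP => [H|-> c].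
    apply: (canRL gL); apply/eqP/negPn/negP => Lj.
    have /H/imsetP[l] : L j \in [set~ ord_max] by rewrite !inE.
    by rewrite !inE => lj /Linj /esym/eqP; apply/negP.
  rewrite !inE => cm; apply/imsetP; exists (g c); rewrite ?Lg// !inE.
  by apply: contraNneq cm => /(can_inj Lg) ->.
have [->|[j0 j0D]] := set_0Vmem D; first by rewrite cards0.
have subj : [set~ ord_max] \subset L @: [set~ j0] by move: j0D; rewrite inE.
have cardC (j : 'I_m.+1) : #|[set~ j]| = m by rewrite cardsC1 card_ord.
(* The m vertices other than j0 carry at least m labels, so these labels are distinct. *)
have /imset_injP Linj0 : #|L @: [set~ j0]| == #|[set~ j0]|.
  rewrite eqn_leq leq_imset_card/= (cardC j0) -[leqLHS](cardC ord_max).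
  exact: subset_leq_card.
have Lmax l : l != j0 -> L l != ord_max.
  move=> lj; have /eqP imE : [set~ ord_max] == L @: [set~ j0].
    by rewrite eqEcard subj card_in_imset// !cardC leqnn.
  have : L l \in L @: [set~ j0] by rewrite imset_f// !inE.
  by rewrite -imE !inE.
have Lj0 : L j0 != ord_max.
  apply/eqP => Lj0; apply: Linj => x y Lxy.
  have [xj|xj] := eqVneq x j0; have [yj|yj] := eqVneq y j0.
  - by rewrite xj yj.
  - by have := Lmax _ yj; rewrite -Lxy xj Lj0 eqxx.
  - by have := Lmax _ xj; rewrite Lxy yj Lj0 eqxx.
  - by apply: Linj0; rewrite ?inE.
have /imsetP[l1] : L j0 \in L @: [set~ j0].
  by apply: (fintype.subsetP subj); rewrite !inE.
rewrite !inE => l1j0 Lj0E.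
suff -> : D = [set j0; l1] by rewrite cards2 eq_sym l1j0.
apply/setP => j; rewrite finset.in_setU !finset.in_set1.
apply/idP/idP => [jD|/orP[/eqP->//|/eqP->]].
  apply/negPn/negP; rewrite negb_or => /andP[jj0 jl1].
  move: jD; rewrite inE => /fintype.subsetP/(_ (L j)).
  rewrite !inE Lmax// => /(_ isT)/imsetP[l]; rewrite !inE => lj LjE.
  have [lj0|lj0] := eqVneq l j0.
    by move/eqP: jl1; apply; apply: Linj0; rewrite ?inE// LjE lj0.
  by move/eqP: lj; apply; apply: Linj0; rewrite ?inE.
rewrite inE; apply/fintype.subsetP => c /(fintype.subsetP subj)/imsetP[l].
rewrite !inE => lj0 ->; have [->|ll1] := eqVneq l l1.
  by rewrite -Lj0E imset_f// !inE eq_sym.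
by rewrite imset_f// !inE.
Qed.

Section Sperner.
Variable k : nat.

Definition kuhn_cell m := ({ffun 'I_m -> 'I_k.+1} * {perm 'I_m})%type.

(* The Kuhn simplex of (z, tau) has the vertices z + \sum_(tau i < j) e_i for
   j <= m: tau i is the rank at which the i-th coordinate is incremented. *)
Definition kuhn_vertex m (s : kuhn_cell m) (j : nat) (i : 'I_m) : nat :=
  s.1 i + (s.2 i < j)%N.

Definition rainbow m (lam : ('I_m -> nat) -> nat) (s : kuhn_cell m) : bool :=
  [forall c : 'I_m.+1, exists l : 'I_m.+1, lam (kuhn_vertex s l) == c].

(** Facets, named by the opposite vertex j, with all the labels below m: on the bottom face of the
    cube they are the rainbow cells of dimension m - 1. *)
Definition full_facet m (lam : ('I_m -> nat) -> nat)
    (s : kuhn_cell m) (j : 'I_m.+1) : bool :=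
  [forall c : 'I_m, exists l : 'I_m.+1, (l != j) && (lam (kuhn_vertex s l) == c)].

(** Boundary conditions on the grid {0, ..., k+1}^m, modelled on labelling x by the first i with F i
    x < 0, and by m if there is none, where F i is negative on the face x i = 0 and positive on the
    opposite one. They restrict to the face where the last coordinate is 0. *)
Definition sperner_labelling m (lam : ('I_m -> nat) -> nat) : Prop :=
  forall x : 'I_m -> nat, (forall i, (x i <= k.+1)%N) ->
  (lam x <= m)%N /\
  forall i, (x i = k.+1 -> lam x <> i) /\ (x i = 0%N -> (lam x <= i)%N).

Lemma kuhn_vertex_le m (s : kuhn_cell m) j i : (kuhn_vertex s j i <= k.+1)%N.
Proof. by rewrite /kuhn_vertex -[leqRHS]addn1 leq_add ?leq_b1// -ltnS. Qed.

Lemma full_facets_parity m lam (s : kuhn_cell m) : sperner_labelling lam ->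
  odd #|[set j | full_facet lam s j]| = rainbow lam s.
Proof.
move=> lamP.
have lamm l : (lam (kuhn_vertex s l) < m.+1)%N.
  by rewrite ltnS; have [] := lamP (kuhn_vertex s l) (kuhn_vertex_le s l).
pose L (l : 'I_m.+1) : 'I_m.+1 := Ordinal (lamm l).
rewrite -[RHS](_ : injectiveb L = _); last first.
  apply/injectiveP/forallP => [Linj c|H].
    have [g _ gL] := injF_bij Linj; apply/existsP; exists (g c).
    by rewrite -[X in _ == X](congr1 val (gL c)).
  have Lonto : L @: [set: 'I_m.+1] = [set: 'I_m.+1].
    apply/setP => c; rewrite !inE; apply/imsetP; have /existsP[l /eqP lc] := H c.
    by exists l => //; apply/val_inj; rewrite /= lc.
  have /imset_injP Linj : #|L @: [set: 'I_m.+1]| == #|[set: 'I_m.+1]| by rewrite Lonto.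
  by move=> x y; apply: Linj; rewrite inE.
rewrite -almost_onto_parity; congr (odd _); apply: eq_card => j; rewrite !inE.
apply/forallP/fintype.subsetP => [H c|H c].
  rewrite !inE => cm.
  have cm' : (c < m)%N by rewrite ltn_neqAle -ltnS ltn_ord andbT -val_eqE in cm *.
  have /existsP[l /andP[lj /eqP lc]] := H (Ordinal cm').
  by apply/imsetP; exists l; [rewrite !inE|apply/val_inj; rewrite /= lc].
have := H (widen_ord (leqnSn m) c); rewrite !inE -val_eqE/= neq_ltn ltn_ord => /(_ isT).
move=> /imsetP[l]; rewrite !inE => lj /(congr1 val)/= cE.
by apply/existsP; exists l; rewrite lj cE/=.
Qed.

Lemma ord_neq_max m (x : 'I_m.+1) : (x != ord_max) = (x < m)%N.
Proof. by rewrite -val_eqE/= neq_ltn orbC ltnNge -ltnS ltn_ord. Qed.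

Lemma ord_neq0 m (x : 'I_m.+1) : (x != ord0) = (0 < x)%N.
Proof. by rewrite -val_eqE lt0n. Qed.

Lemma ord_predE m (x : 'I_m.+1) :
  ord_pred x = (if x == ord0 then m else x.-1) :> nat.
Proof.
have [->|] := eqVneq x ord0; first by rewrite /= modn_small.
rewrite ord_neq0 => x0; rewrite /= -{1}(prednK x0) addSn/= modnDr modn_small//.
by rewrite (leq_ltn_trans (leq_pred _)).
Qed.

Lemma ordSE m (x : 'I_m.+1) : ordS x = (if x == ord_max then 0%N else x.+1) :> nat.
Proof.
have [->|] := eqVneq x ord_max; first by rewrite /= modnn.
by rewrite ord_neq_max => xm; rewrite /= modn_small.
Qed.

Lemma ord_pred_eq_max m (x : 'I_m.+1) : (ord_pred x == ord_max) = (x == ord0).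
Proof.
rewrite (can2_eq (@ord_predK _) (@ordSK _)); congr (_ == _).
by apply/val_inj; rewrite /= modnn.
Qed.

Lemma ordS_eq0 m (x : 'I_m.+1) : (ordS x == ord0) = (x == ord_max).
Proof.
rewrite (can2_eq (@ordSK _) (@ord_predK _)); congr (_ == _).
by apply/val_inj; rewrite /= modn_small.
Qed.

(** The other cell with the facet opposite to the vertex j. Without the first vertex, the chain of
    vertices is extended at its end: the coordinate incremented first is now incremented last, one
    unit further on, and the ranks shift cyclically. Without the last vertex the reverse happens;
    for an inner vertex two consecutive increments are exchanged. On a facet in the boundary of the
    cube the value is meaningless. *)
Definition kuhn_neighbour m (x : kuhn_cell m.+1 * 'I_m.+2) :
    kuhn_cell m.+1 * 'I_m.+2 :=
  let: ((z, t), j) := x in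
  if j == ord0 then
    ([ffun i => if t i == ord0 then inord (z i).+1 else z i],
     (t * perm (bij_inj (@ord_pred_bij m.+1)))%g, ord_max)
  else if j == ord_max then
    ([ffun i => if t i == ord_max then inord (z i).-1 else z i],
     (t * perm (bij_inj (@ordS_bij m.+1)))%g, ord0)
  else (z, (t * tperm (inord j.-1) (inord j))%g, j).

Definition inner_facet m (x : kuhn_cell m.+1 * 'I_m.+2) : bool :=
  [forall i, ((x.2 == ord0) && (x.1.2 i == ord0) ==> (x.1.1 i != ord_max)) &&
             ((x.2 == ord_max) && (x.1.2 i == ord_max) ==> (x.1.1 i != ord0))].

Lemma kuhn_neighbour_inner m (x : kuhn_cell m.+1 * 'I_m.+2) :
  inner_facet x -> inner_facet (kuhn_neighbour x).
Proof.
case: x => -[z t] j /forallP /= inx; apply/forallP => i; have := inx i.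
have [->|j0] := eqVneq j ord0 => /=.
  rewrite ffunE permM permE ord_pred_eq_max.
  have [ti|ti] := eqVneq (t i) ord0 => /= [/andP[zi _]|_]; last by rewrite andbF.
  by rewrite eqxx/= ord_neq0 inordK// ltnS -ord_neq_max.
have [jm|jm] := eqVneq j ord_max => /=.
  rewrite ffunE permM permE ordS_eq0.
  have [ti|ti] := eqVneq (t i) ord_max => /= [zi|_//].
  rewrite ord_neq0 in zi.
  rewrite andbT ord_neq_max inordK.
    by rewrite prednK// -ltnS ltn_ord.
  by rewrite (leq_ltn_trans (leq_pred _)).
by rewrite (negPf j0) (negPf jm).
Qed.

Lemma kuhn_neighbourK m (x : kuhn_cell m.+1 * 'I_m.+2) :
  inner_facet x -> kuhn_neighbour (kuhn_neighbour x) = x.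
Proof.
case: x => -[z t] j /forallP /= inx.
have [j0|j0] := eqVneq j ord0.
  rewrite j0 /kuhn_neighbour/= eqxx.
  apply: (f_equal2 pair _ erefl); apply: (f_equal2 pair).
    apply/ffunP => i; rewrite !ffunE permM permE ord_pred_eq_max.
    case: eqP => // ti; have := inx i; rewrite j0 ti eqxx/= => /andP[zi _].
    rewrite ord_neq_max in zi; by rewrite inordK//= inord_val.
  by apply/permP => i; rewrite !permM !permE ord_predK.
have [jm|jm] := eqVneq j ord_max.
  rewrite jm /kuhn_neighbour/=.
  apply: (f_equal2 pair _ erefl); apply: (f_equal2 pair).
    apply/ffunP => i; rewrite !ffunE permM permE ordS_eq0.
    case: eqP => // ti; have := inx i; rewrite jm ti !eqxx/= => zi.
    rewrite ord_neq0 in zi.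
    have zi' : ((z i).-1 < k.+1)%N by rewrite (leq_ltn_trans (leq_pred _)).
    by rewrite (inordK zi') prednK// inord_val.
  by apply/permP => i; rewrite !permM !permE ordSK.
rewrite /kuhn_neighbour (negPf j0) (negPf jm).
by apply: (f_equal2 pair _ erefl); apply: (f_equal2 pair) => //; rewrite -mulgA tperm2 mulg1.
Qed.

Lemma kuhn_neighbour_neq m (x : kuhn_cell m.+1 * 'I_m.+2) : kuhn_neighbour x != x.
Proof.
case: x => -[z t] j; rewrite /kuhn_neighbour.
have [->|j0] := eqVneq j ord0; first by apply/eqP => -[].
have [->|jm] := eqVneq j ord_max; first by apply/eqP => -[].
rewrite ord_neq0 in j0; rewrite ord_neq_max in jm.
apply/eqP => -[/(congr1 (fun s => t^-1 * s)%g)]; rewrite mulKg mulVg.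
move=> /permP/(_ (inord j)); rewrite tpermR perm1 => /(congr1 val)/=.
rewrite !inordK// ?(leq_ltn_trans (leq_pred _))// => e.
by have := ltnn j; rewrite -{1}e prednK// leqnn.
Qed.

(** Both cells have the same vertices on the common facet, at indices shifted cyclically when j is
    the first or the last. *)
Lemma kuhn_neighbour_full m lam (x : kuhn_cell m.+1 * 'I_m.+2) :
  inner_facet x -> full_facet lam x.1 x.2 ->
  full_facet lam (kuhn_neighbour x).1 (kuhn_neighbour x).2.
Proof.
case: x => -[z t] j /forallP/= inx /forallP/= ff; apply/forallP => c.
have /existsP[l /andP[lj lc]] := ff c.
suff [l' l'j vE] : exists2 l' : 'I_m.+2, l' != (kuhn_neighbour (z, t, j)).2 &
    kuhn_vertex (kuhn_neighbour (z, t, j)).1 l' = kuhn_vertex (z, t) l.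
  by apply/existsP; exists l'; rewrite l'j vE.
rewrite /kuhn_neighbour; have [j0|j0] := eqVneq j ord0.
  rewrite j0 in lj; exists (ord_pred l); first by rewrite ord_pred_eq_max.
  apply/funext => i; rewrite /kuhn_vertex; cbn [fst snd]; rewrite ffunE permM permE !ord_predE (negPf lj).
  rewrite ord_neq0 in lj; have := inx i; rewrite j0 eqxx/=.
  have [ti|] := eqVneq (t i) ord0 => /= [/andP[zi _]|ti _].
    rewrite ord_neq_max in zi; rewrite inordK// ti lj addn1 ltnNge -ltnS prednK//.
    by rewrite -ltnS ltn_ord addn0.
  by rewrite ord_neq0 in ti; congr (_ + _); rewrite -ltnS !prednK.
have [jm|jm] := eqVneq j ord_max.
  rewrite jm in lj; exists (ordS l); first by rewrite ordS_eq0.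
  apply/funext => i; rewrite /kuhn_vertex; cbn [fst snd]; rewrite ffunE permM permE !ordSE (negPf lj).
  rewrite ord_neq_max in lj; have := inx i; rewrite jm eqxx/=.
  have [ti|] := eqVneq (t i) ord_max => /= [zi|ti _].
    rewrite ord_neq0 in zi.
    have zi' : ((z i).-1 < k.+1)%N by rewrite (leq_ltn_trans (leq_pred _)).
    by rewrite (inordK zi') ti addn1 prednK//= [(m < l)%N]ltnNge -ltnS lj addn0.
  by rewrite ltnS.
exists l => //; apply/funext => i; rewrite /kuhn_vertex/= permM; congr (_ + _).
rewrite ord_neq0 in j0; rewrite ord_neq_max in jm.
have jK : (inord j.-1 : 'I_m.+1) = j.-1 :> nat.
  by rewrite inordK// (leq_ltn_trans (leq_pred _)).
have j'K : (inord j : 'I_m.+1) = j :> nat by rewrite inordK.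
case: tpermP => [ti|ti|//]; rewrite ti ?jK ?j'K; congr nat_of_bool.
  apply/idP/idP => [|h]; first exact: leq_ltn_trans (leq_pred _).
  rewrite ltn_neqAle eq_sym -[_ == _]val_eqE/= in lj *.
  by rewrite lj/= -(prednK j0).
apply/idP/idP => [h|]; last exact: leq_ltn_trans (leq_pred _).
by rewrite ltn_neqAle eq_sym val_eqE lj/= -(prednK j0).
Qed.

Definition extend_last (T : Type) m (a : T) (x : 'I_m -> T) (i : 'I_m.+1) : T :=
  oapp x a (unlift ord_max i).

Lemma extend_lastE T m (a : T) (x : 'I_m -> T) i :
  extend_last a x (fintype.lift ord_max i) = x i.
Proof. by rewrite /extend_last liftK. Qed.

Lemma extend_last_max T m (a : T) (x : 'I_m -> T) :
  extend_last a x ord_max = a.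
Proof. by rewrite /extend_last unlift_none. Qed.

(** The new coordinate starts at 0 and is incremented last, so the given cell is the facet opposite
    to the last vertex, inside the face where the last coordinate is 0. *)
Definition extend_cell m (s : kuhn_cell m) : kuhn_cell m.+1 :=
  (finfun (extend_last ord0 s.1), lift_perm ord_max ord_max s.2).

Lemma extend_cell_inj m : injective (@extend_cell m).
Proof.
move=> [z t] [z' t'] [/ffunP zz tt]; apply: (f_equal2 pair).
  by apply/ffunP => i; have := zz (fintype.lift ord_max i); rewrite !ffunE !extend_lastE.
apply/permP => i; have /permP/(_ (fintype.lift ord_max i)) := tt.
by rewrite !lift_perm_lift => /lift_inj.
Qed.

Lemma kuhn_vertex_extend m (s : kuhn_cell m) l : (l <= m)%N ->
  kuhn_vertex (extend_cell s) l = extend_last 0%N (kuhn_vertex s l).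
Proof.
move=> lm; apply/funext => i; rewrite /kuhn_vertex; cbn [fst snd extend_cell].
rewrite ffunE; case: (unliftP ord_max i) => [i' ->|->].
  by rewrite !extend_lastE lift_perm_lift lift_max.
by rewrite !extend_last_max lift_perm_id/= ltnNge lm.
Qed.

Lemma extend_cell_onto m (s : kuhn_cell m.+1) :
  s.1 ord_max = ord0 -> s.2 ord_max = ord_max -> exists s', s = extend_cell s'.
Proof.
case: s => z t /= z0 tm.
pose f (i : 'I_m) := odflt i (unlift ord_max (t (fintype.lift ord_max i))).
have fE i : fintype.lift ord_max (f i) = t (fintype.lift ord_max i).
  rewrite /f; case: unliftP => [j ->//|/esym/eqP].
  by rewrite -{1}tm (inj_eq perm_inj) (negPf (neq_lift _ _)).
have f_inj : injective f.
  by move=> i j /(congr1 (fintype.lift ord_max)); rewrite !fE => /perm_inj/lift_inj.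
exists ([ffun i => z (fintype.lift ord_max i)], perm f_inj); apply: (f_equal2 pair).
  apply/ffunP => i; rewrite ffunE.
  by case: (unliftP ord_max i) => [i' ->|->]; rewrite ?extend_lastE ?extend_last_max//= ffunE.
apply/permP => i; case: (unliftP ord_max i) => [i' ->|->]; last by rewrite lift_perm_id.
by rewrite lift_perm_lift/= permE fE.
Qed.

Definition face_labelling m (lam : ('I_m.+1 -> nat) -> nat) (x : 'I_m -> nat) :=
  lam (extend_last 0%N x).

(** Where the last coordinate vanishes, the label is at most the index of that coordinate, which is
    the bound one dimension lower. *)
Lemma face_sperner_labelling m lam : sperner_labelling lam ->
  sperner_labelling (@face_labelling m lam).
Proof.
move=> lamP x xk; have [|lm lami] := lamP (extend_last 0%N x).
  by move=> i; case: (unliftP ord_max i) => [i' ->|->]; rewrite ?extend_lastE ?extend_last_max.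
split; first by have [_ ->] := lami ord_max; rewrite ?extend_last_max.
move=> i; have := lami (fintype.lift ord_max i).
by rewrite extend_lastE lift_max.
Qed.

Lemma rainbow_face m lam (s : kuhn_cell m) :
  full_facet lam (extend_cell s) ord_max = rainbow (face_labelling lam) s.
Proof.
apply/forallP/forallP => H c; have /existsP[l] := H c.
  move=> /andP[]; rewrite ord_neq_max => lm lamc.
  apply/existsP; exists (Ordinal lm); rewrite /face_labelling/=.
  by rewrite -kuhn_vertex_extend.
move=> lc; apply/existsP; exists (widen_ord (leqnSn _) l).
by rewrite ord_neq_max/= ltn_ord kuhn_vertex_extend// -ltnS.
Qed.

(** A facet inside x i = k + 1 misses the label i. A facet inside x i = 0 has labels at most i, and
    carrying the label m forces i to be the last coordinate. Only the bottom face remains. *)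
Lemma outer_full_facets m (lam : ('I_m.+1 -> nat) -> nat) : sperner_labelling lam ->
  [set x : kuhn_cell m.+1 * 'I_m.+2 | full_facet lam x.1 x.2 & ~~ inner_facet x] =
  [set (extend_cell s, ord_max) |
     s in [set s : kuhn_cell m | rainbow (face_labelling lam) s]].
Proof.
move=> lamP; apply/setP => -[s j]; rewrite !inE/=; apply/idP/imsetP.
  move=> /andP[ff nin].
  have [i iP] : exists i, ~~
    (((j == ord0) && (s.2 i == ord0) ==> (s.1 i != ord_max)) &&
     ((j == ord_max) && (s.2 i == ord_max) ==> (s.1 i != ord0))).
    by apply/existsP; rewrite -negb_forall.
  move: iP; rewrite negb_and !negb_imply/= !andbT.
  have vP l := lamP _ (kuhn_vertex_le s l).
  case/orP => /andP[/andP[/eqP jE /eqP ti] /eqP zi].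
    have /existsP[l /andP[lj /eqP lc]] := forallP ff i.
    have [_ /(_ i)[+ _]] := vP l; rewrite lc => /(_ _)/wrap[]//.
    by rewrite /kuhn_vertex zi ti/= -ord_neq0 -jE lj addn1.
  have /existsP[l /andP[lj /eqP lc]] := forallP ff ord_max.
  have [_ /(_ i)[_]] := vP l; rewrite lc => /(_ _)/wrap[].
    rewrite /kuhn_vertex zi ti/= ltnNge -ltnS -ord_neq_max.
    by rewrite -jE lj.
  move=> mi; have im : i = ord_max.
    by apply/val_inj/eqP; rewrite eqn_leq mi -ltnS ltn_ord.
  rewrite im in ti zi; have [s' sE] := extend_cell_onto zi ti.
  exists s'; last by rewrite sE jE.
  by rewrite inE -rainbow_face -sE -jE.
move=> [s' s'r [-> ->]]; rewrite inE -rainbow_face in s'r; rewrite s'r/=.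
apply/negP => /forallP/(_ ord_max)/andP[_].
by rewrite ffunE extend_last_max lift_perm_id !eqxx.
Qed.

(** Pairs of a cell and a full facet are counted modulo 2. By cells, the count has the parity of the
    rainbow cells; by facets, the inner ones are paired off by [kuhn_neighbour], and the outer ones
    are the rainbow cells of the bottom face. *)
Lemma sperner m (lam : ('I_m -> nat) -> nat) : sperner_labelling lam ->
  odd #|[set s : kuhn_cell m | rainbow lam s]|.
Proof.
elim: m lam => [|m IH] lam lamP.
  pose s0 : kuhn_cell 0 := ([ffun=> ord0], 1%g).
  suff -> : [set s : kuhn_cell 0 | rainbow lam s] = [set s0] by rewrite cards1.
  apply/setP => s; rewrite !inE.
  have -> : s = s0.
    by case: s => z t; apply: (f_equal2 pair); [apply/ffunP|apply/permP] => -[].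
  rewrite eqxx; apply/forallP => c; apply/existsP; exists ord0.
  by have [+ _] := lamP _ (kuhn_vertex_le s0 0); rewrite leqn0 (ord1 c).
pose P := [set x : kuhn_cell m.+1 * 'I_m.+2 | full_facet lam x.1 x.2].
have -> : odd #|[set s : kuhn_cell m.+1 | rainbow lam s]| = odd #|P|.
  have -> : #|P| = (\sum_(s : kuhn_cell m.+1) #|[set j | full_facet lam s j]|)%N.
    rewrite -sum1_card (eq_bigl (fun x => xpredT x.1 && full_facet lam x.1 x.2)).
      rewrite -(pair_big_dep xpredT (full_facet lam) (fun _ _ => 1%N))/=.
      by apply: eq_bigr => s _; rewrite -sum1_card; apply: eq_bigl => j; rewrite inE.
    by move=> x; rewrite inE.
  rewrite -sum1_card big_mkcond/= !(big_morph odd oddD (erefl _)).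
  apply: eq_bigr => s _; rewrite full_facets_parity// inE.
  by case: rainbow.
rewrite -(cardsID [set x | inner_facet x] P) oddD.
have /negbTE -> : ~~ odd #|P :&: [set x | inner_facet x]|.
  apply: (@involution_card_even _ _ (@kuhn_neighbour m)) => x; rewrite !inE => /andP[fx ix].
  by rewrite kuhn_neighbour_full// kuhn_neighbour_inner// kuhn_neighbourK// kuhn_neighbour_neq.
have -> : P :\: [set x | inner_facet x] =
    [set x | full_facet lam x.1 x.2 & ~~ inner_facet x].
  by apply/setP => x; rewrite !inE andbC.
rewrite (outer_full_facets lamP) card_imset.
  exact/IH/face_sperner_labelling.
by move=> x y /(congr1 fst)/extend_cell_inj.
Qed.
End Sperner.
End Combinatorics.

(** * From rainbow cells to zeros of continuous maps on a cube *)

Section PoincareMiranda.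
Context {R : realType}.

(** A grid point is labelled by the first i with F i < 0, or by b if there is none. In a rainbow
    cell the vertex labelled i has F i < 0, and the one labelled b has all F i >= 0. *)
Lemma exists_rainbow_cell b (r : R) (F : 'I_b -> 'rV[R]_b -> R) (N : nat) :
  0 <= r ->
  (forall i (x : 'rV[R]_b), `|x| <= r -> x 0 i = - r -> F i x < 0) ->
  (forall i (x : 'rV[R]_b), `|x| <= r -> x 0 i = r -> 0 < F i x) ->
  exists x : 'rV[R]_b, `|x| <= r /\ forall i, exists y z,
    [/\ `|x - y| <= 2 * r / N.+1%:R, `|x - z| <= 2 * r / N.+1%:R,
        F i y < 0 & 0 <= F i z].
Proof.
move=> r0 Fneg Fpos.
pose pt (a : 'I_b -> nat) : 'rV[R]_b := \row_i (- r + 2 * r / N.+1%:R * (a i)%:R).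
pose lam a := find (fun i => F i (pt a) < 0) (enum 'I_b).
have d0 : 0 <= 2 * r / N.+1%:R by rewrite !mulr_ge0// invr_ge0.
have ptr a : (forall i, (a i <= N.+1)%N) -> `|pt a| <= r.
  move=> aN; apply: mx_norm_le => // i j; rewrite mxE ler_norml lerDl mulr_ge0//=.
  rewrite -lerBrDl opprK -mulr2n -mulr_natl -[leRHS](@divfK _ N.+1%:R)// mulr_natl.
  by rewrite mulr_natl; apply: ler_wpM2l; rewrite ?ler_nat// -mulr_natl.
have lamP : sperner_labelling N lam.
  move=> a aN; split; first by rewrite -[leqRHS](size_enum_ord b) find_size.
  move=> i; split=> ai.
    have Fi : 0 < F i (pt a).
      apply: Fpos; first exact: ptr.
      by rewrite mxE ai divfK// addrC mulr_natl mulr2n addrK.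
    move=> lami; have : has (fun j => F j (pt a) < 0) (enum 'I_b).
      by rewrite has_find -/(lam a) lami size_enum_ord.
    move=> /(nth_find i); rewrite -/(lam a) lami nth_ord_enum.
    by rewrite ltNge (ltW Fi).
  rewrite leqNgt; apply/negP => /(before_find i); rewrite nth_ord_enum.
  by rewrite Fneg// ?ptr// mxE ai mulr0 addr0.
have := sperner lamP; case: (set_0Vmem [set s : kuhn_cell N b | rainbow lam s]%SET) => [->|].
  by rewrite cards0.
move=> [s]; rewrite inE => /forallP sr _.
have close l : `|pt (kuhn_vertex s 0) - pt (kuhn_vertex s l)| <= 2 * r / N.+1%:R.
  apply: mx_norm_le => // i j; rewrite !mxE opprD addrACA subrr add0r -mulrBr normrM ger0_norm//.
  rewrite ler_piMr// /kuhn_vertex ltn0 addn0 natrD opprD addrA subrr add0r normrN.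
  by rewrite normr_nat lern1 leq_b1.
exists (pt (kuhn_vertex s 0)); split; first exact/ptr/kuhn_vertex_le.
move=> i.
have /existsP[l /eqP lami] := sr (widen_ord (leqnSn b) i).
have /existsP[l' /eqP lamb] := sr ord_max.
exists (pt (kuhn_vertex s l)), (pt (kuhn_vertex s l')); split=> //.
  have : has (fun j => F j (pt (kuhn_vertex s l)) < 0) (enum 'I_b).
    by rewrite has_find -/(lam _) lami size_enum_ord/=.
  by move=> /(nth_find i); rewrite -/(lam _) lami/= nth_ord_enum.
rewrite leNgt; apply/negP => Fi.
have : has (fun j => F j (pt (kuhn_vertex s l')) < 0) (enum 'I_b).
  by apply/hasP; exists i => //; rewrite mem_enum.
by rewrite has_find -/(lam _) lamb size_enum_ord/= ltnn.
Qed.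

(** Rainbow cells of finer and finer grids cluster at a point p. If F i had a strict sign at p, it
    would keep that sign on a whole small cell near p, against the sign change there. *)
Lemma poincare_miranda b (r : R) (F : 'I_b -> 'rV[R]_b -> R) :
  0 <= r -> (forall i, continuous (F i)) ->
  (forall i (x : 'rV[R]_b), `|x| <= r -> x 0 i = - r -> F i x < 0) ->
  (forall i (x : 'rV[R]_b), `|x| <= r -> x 0 i = r -> 0 < F i x) ->
  exists x, forall i, F i x = 0.
Proof.
move=> r0 cF Fneg Fpos.
have /choice[xs xsP] N := exists_rainbow_cell N r0 Fneg Fpos.
have cK : compact [set x : 'rV[R]_b | `|x| <= r].
  apply: bounded_closed_compact.
    by exists r; split; [exact: num_real|move=> M rM x /= /le_trans; apply; exact: ltW].
  apply: (@closed_comp _ _ (fun x : 'rV[R]_b => `|x|) [set y | y <= r]) => //.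
    by move=> x _; exact: norm_continuous.
have [|p [_ pc]] := cK (xs @ \oo) _.
  by exists 0%N => // N _; have [] := xsP N.
exists p => i; apply/eqP/negPn/negP => Fp.
have key (P : set R) : open P -> P (F i p) ->
    exists N : nat, forall y, `|xs N - y| <= 2 * r / N.+1%:R -> P (F i y).
  move=> oP Pp; have : \forall y \near p, P (F i y) by exact/cF/open_nbhs_nbhs.
  move=> /nbhs_ballP[e /= e0 eP].
  have : \forall N \near \oo, 2 * r / N.+1%:R < e / 2.
    have [N0 N0P] : exists N0 : nat, 2 * r / (e / 2) < N0%:R.
      by exists (Num.bound (2 * r / (e / 2))); rewrite archi_boundP// !mulr_ge0// invr_ge0 divr_ge0// ltW.
    exists N0 => // N /= N0N; rewrite ltr_pdivrMr// [ltRHS]mulrC -ltr_pdivrMr ?divr_gt0//.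
    by rewrite (lt_trans N0P)// ltr_nat ltnS.
  move=> [N0 _ N0P].
  have FN : (xs @ \oo) [set xs N | N in [set N | (N0 <= N)%N]].
    by exists N0 => // N /= N0N; exists N.
  have e20 : 0 < e / 2 by exact: divr_gt0.
  have [_ [[N /= /N0P Ne <-] xe]] := pc _ _ FN (nbhsx_ballx p _ e20).
  exists N => y xy; apply: eP; rewrite (splitr e).
  apply: ball_triangle xe _; rewrite -ball_normE/=.
  exact: le_lt_trans Ne.
have [F0|F0] := ltP 0 (F i p).
  have [N NP] := key _ (@open_gt _ 0) F0.
  have [_ /(_ i)[y [z [/NP /= Fy _]]]] := xsP N.
  by rewrite ltNge (ltW Fy).
have {}F0 : F i p < 0 by rewrite lt_neqAle Fp.
have [N NP] := key _ (@open_lt _ 0) F0.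
have [_ /(_ i)[y [z [_ /NP /= Fz _]]]] := xsP N.
by rewrite leNgt Fz.
Qed.
End PoincareMiranda.

(** * Lifting maps to the torus *)

Section CentredResidue.
Context {R : realType}.

(** The representative of r modulo Z in [-1/2, 1/2). Its absolute value is the distance from r to
    Z. *)
Definition cres (r : R) : R := r - (Num.floor (r + 2^-1))%:~R.

Lemma cres_int r : cres r - r \is a Num.int.
Proof. by rewrite /cres addrAC subrr add0r rpredN intr_int. Qed.

Lemma cres_id r : `|r| < 2^-1 -> cres r = r.
Proof.
rewrite ltr_norml => /andP[r1 r2]; rewrite /cres.
suff -> : Num.floor (r + 2^-1) = 0 by rewrite subr0.
apply/eqP; rewrite floor_eq; apply/andP; split; lra.
Qed.

Lemma cresD_int r m : m \is a Num.int -> cres (r + m) = cres r.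
Proof.
move=> /intrP[k ->]; rewrite /cres [X in Num.floor X]addrAC floorDrz ?intr_int// intrKfloor intrD.
by rewrite opprD addrACA subrr addr0.
Qed.

Lemma eq_cres r r' : r - r' \is a Num.int -> cres r = cres r'.
Proof. by move=> rr; rewrite -(subrK r' r) addrC cresD_int. Qed.

Lemma cresD r r' : `|cres r| + `|cres r'| < 2^-1 -> cres (r + r') = cres r + cres r'.
Proof.
move=> rr; rewrite -[RHS]cres_id ?(le_lt_trans (ler_normD _ _))//.
apply: eq_cres; rewrite opprD addrACA -opprB -[r' - _]opprB.
by rewrite rpredD ?rpredN ?cres_int.
Qed.

Lemma cresN r : `|cres r| < 2^-1 -> cres (- r) = - cres r.
Proof.
move=> rr; rewrite -[RHS]cres_id ?normrN//.
by apply: eq_cres; rewrite opprK addrC cres_int.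
Qed.

Lemma cres_triangle (a b c e e' : R) : e + e' <= 2^-1 ->
  `|cres (a - c)| < e -> `|cres (b - c)| < e' -> `|cres (a - b)| < e + e'.
Proof.
move=> ee ac bc; have [e0 e'0] : 0 < e /\ 0 < e' by split; [exact: le_lt_trans ac|exact: le_lt_trans bc].
have bc2 : `|cres (b - c)| < 2^-1 by rewrite (lt_le_trans bc)// (le_trans _ ee)// lerDr ltW.
have E : `|cres (a - c)| + `|cres (- (b - c))| < e + e' by rewrite cresN// normrN ltrD.
have -> : a - b = (a - c) + (- (b - c)) by ring.
by rewrite cresD ?(lt_le_trans E ee)// (le_lt_trans (ler_normD _ _) E).
Qed.

(** Between two different integer values the intermediate value theorem would produce a
    half-integer. *)
Lemma continuous_int_const (f : R -> R) :
  {in `[0, 1], continuous f} -> (forall t, t \in `[0, 1] -> f t \is a Num.int) ->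
  f 1 = f 0.
Proof.
move=> cf fint; apply/eqP/negPn/negP => f10.
have cf' : {within `[0, 1], continuous f} by apply: continuous_in_subspaceT => x /set_mem; exact: cf.
have [/intrP[m fm] /intrP[n fn]] : f 0 \is a Num.int /\ f 1 \is a Num.int.
  by split; apply: fint; rewrite in_itv/= lexx ler01.
have [v [vf vi]] : exists v, Num.min (f 0) (f 1) <= v <= Num.max (f 0) (f 1) /\ v \isn't a Num.int.
  have half (k : int) : (k%:~R + 2^-1 : R) \isn't a Num.int.
    rewrite rpredDl ?intr_int//; apply/negP => /intrP[l] /(congr1 (fun x => x * 2)).
    rewrite mulVf// -[2]/(2%:~R) -intrM -[1]/(1%:~R) => /eqP; rewrite eqr_int => /eqP.
    lia.
  have [mn|nm|mn] := ltgtP m n; last by move: f10; rewrite fm fn mn eqxx.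
    exists (m%:~R + 2^-1); split=> //; rewrite fm fn.
    have : (m%:~R + 1 <= n%:~R :> R) by rewrite -[1]/(1%:~R) -intrD ler_int; lia.
    by move=> ?; rewrite min_l ?max_r; lra.
  exists (n%:~R + 2^-1); split=> //; rewrite fm fn.
  have : (n%:~R + 1 <= m%:~R :> R) by rewrite -[1]/(1%:~R) -intrD ler_int; lia.
  by move=> ?; rewrite min_r ?max_l; lra.
have [c cI fc] := IVT ler01 cf' vf.
by move: vi; rewrite -fc fint.
Qed.
End CentredResidue.

(** * Lifting real functions that are continuous modulo Z *)

Section LiftModZ.
Context {R : realType} {V : normedModType R}.
Variable g : V -> R.
Hypothesis g_cont : forall x e, 0 < e -> \forall y \near x, `|cres (g y - g x)| < e.

Let step (s s' : R) (y : V) := cres (g (s' *: y) - g (s *: y)).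
(** The lift at y, computed along the segment from 0 to y cut into N + 1 pieces: the increment of g
    over a piece matters modulo Z, and its centred representative is added. *)
Let G (N : nat) (y : V) :=
  g 0 + \sum_(k < N.+1) step (k%:R / N.+1%:R) (k.+1%:R / N.+1%:R) y.
(** All close pairs s, s' are tested, beyond consecutive nodes: this makes the condition pass from y
    to t *: y. *)
Let good (N : nat) (y : V) := forall s s' : R, s \in `[0, 1] -> s' \in `[0, 1] ->
  `|s' - s| <= N.+1%:R^-1 -> `|step s s' y| < 4^-1.

(** Uniform continuity modulo Z along the segment from 0 to x, kept for nearby y: compactness of
    [0, 1] is used in its near-covering form, the difference s' - s being a parameter near 0 besides
    y. *)
Lemma near_good (x : V) : \forall N \near \oo, \forall y \near x, good N y.
Proof.
have /compact_near_coveringP K01 := @segment_compact R 0 1.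
pose x0 : (V * R)%type := (x, 0).
pose P (yh : V * R) s := `|cres (g ((s + yh.2) *: yh.1) - g (s *: yh.1))| < 4^-1.
have H (s : R) : `[0, 1]%classic s ->
    \forall s' \near s & yh \near x0, P yh s'.
  move=> _; have e8 : 0 < 8^-1 :> R by rewrite invr_gt0.
  have E := g_cont (s *: x) e8.
  have c1 : (fun q : R * (V * R) => q.1 *: q.2.1) @ (s, x0) --> s *: x.
    apply: (@cvgZ _ _ _ (nbhs (s, x0)) _ (fun q => q.1) (fun q => q.2.1)); first exact: cvg_fst.
    by apply: (@cvg_comp _ _ _ snd fst _ (nbhs x0)); [exact: cvg_snd|exact: cvg_fst].
  have c2 : (fun q : R * (V * R) => (q.1 + q.2.2) *: q.2.1) @ (s, x0) --> s *: x.
    rewrite -[X in _ --> X *: _]addr0.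
    apply: (@cvgZ _ _ _ (nbhs (s, x0)) _ (fun q => q.1 + q.2.2) (fun q => q.2.1)).
      apply: cvgD; first exact: cvg_fst.
      by apply: (@cvg_comp _ _ _ snd snd _ (nbhs x0)); [exact: cvg_snd|exact: cvg_snd].
    by apply: (@cvg_comp _ _ _ snd fst _ (nbhs x0)); [exact: cvg_snd|exact: cvg_fst].
  have H2 : nbhs (s, x0) (fun q => `|cres (g ((q.1 + q.2.2) *: q.2.1) - g (s *: x))| < 8^-1) := c2 _ E.
  have H1 : nbhs (s, x0) (fun q => `|cres (g (q.1 *: q.2.1) - g (s *: x))| < 8^-1) := c1 _ E.
  suff : nbhs (s, x0) (fun q => P q.2 q.1) by [].
  apply: filterS (filterI H2 H1) => -[s' yh]/= [h1 h2]; rewrite /P.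
  have := @cres_triangle _ _ _ _ _ _ _ h1 h2.
  by rewrite (_ : 8^-1 + 8^-1 = 4^-1); [apply; lra|lra].
have [[A B] /= [Ax B0] AB] := K01 _ (nbhs x0) P _ H.
move/nbhs_ballP: B0 => [e /= e0 eB].
have : \forall N \near \oo, N.+1%:R^-1 < e by exact: near_infty_natSinv_lt (PosNum e0).
apply: filterS => N Ne; apply: filterS Ax => y Ay s s' s01 s'01 ss'.
have /AB/(_ s s01) : (A `*` B) (y, s' - s).
  by split=> //=; apply: eB; rewrite -ball_normE/= sub0r normrN (le_lt_trans ss').
by rewrite /P/= [s + _]addrC subrK.
Qed.

Lemma lift_approx_int N y : G N y - g y \is a Num.int.
Proof.
have tele (n : nat) : (n <= N.+1)%N ->
    g 0 + \sum_(k < n) step (k%:R / N.+1%:R) (k.+1%:R / N.+1%:R) y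
    - g ((n%:R / N.+1%:R) *: y) \is a Num.int.
  elim: n => [_|n IH nN]; first by rewrite big_ord0 addr0 mul0r scale0r subrr rpred0.
  rewrite big_ord_recr/=; set S := \sum_(_ < _) _ in IH *.
  have -> : g 0 + (S + step (n%:R / N.+1%:R) (n.+1%:R / N.+1%:R) y) -
      g ((n.+1%:R / N.+1%:R) *: y) = (g 0 + S - g ((n%:R / N.+1%:R) *: y)) +
     (step (n%:R / N.+1%:R) (n.+1%:R / N.+1%:R) y -
      (g ((n.+1%:R / N.+1%:R) *: y) - g ((n%:R / N.+1%:R) *: y))) by ring.
  by rewrite rpredD ?IH ?cres_int// ltnW.
by have := tele _ (leqnn _); rewrite divff// scale1r.
Qed.

Lemma lift_approx_continuous N y : good N y -> {for y, continuous (G N)}.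
Proof.
move=> gy; apply: cvgD; first exact: cvg_cst.
apply: cvg_big => [|k _]; first exact: add_continuous.
set s := k%:R / _; set s' := _.+1%:R / _.
have sgood : `|step s s' y| < 4^-1.
  have N0 : 0 < N.+1%:R :> R by rewrite ltr0n.
  have k1 : (k%:R + 1 <= N.+1%:R :> R) by rewrite natr1 ler_nat.
  apply: gy.
  - by rewrite in_itv/= /s divr_ge0//= ler_pdivrMr// mul1r ler_nat ltnW.
  - by rewrite in_itv/= /s' divr_ge0//= ler_pdivrMr// mul1r ler_nat.
  - by rewrite /s /s' -mulrBl -natr1 addrAC subrr add0r mul1r ger0_norm.
apply/cvgrPdist_lt => e e0.
(* Each end of the piece moves by less than d modulo Z. The step is below 1/4 and 2 d <= 1/8, so the
   sum stays below 1/2, where [cres] is additive; moreover 2 d <= e. *)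
pose d : R := Num.min (e / 2) 16^-1.
have d0 : 0 < d by rewrite lt_min divr_gt0//= invr_gt0.
have cs (r : R) : (fun z => r *: z) @ y --> r *: y by apply: cvgZr; exact: cvg_id.
have near_d r : \forall z \near y, `|cres (g (r *: z) - g (r *: y))| < d :=
  cs r _ (g_cont (r *: y) d0).
apply: filterS (filterI (near_d s) (near_d s')) => z /= [h1 h2].
have dd : d + d <= 2^-1.
  have : d <= 16^-1 by rewrite ge_min lexx orbT.
  by move=> ?; lra.
have cN (a b : R) : `|cres (a - b)| < d -> `|cres (b - a)| < d.
  move=> h; rewrite -opprB cresN ?normrN//.
  have : d <= 16^-1 by rewrite ge_min lexx orbT.
  by move=> ?; lra.
have E : `|cres ((g (s' *: z) - g (s' *: y)) - (g (s *: z) - g (s *: y)))| < d + d.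
  apply: (@cres_triangle _ _ _ 0) => //; rewrite subr0//.
have Ee : step s s' z = step s s' y +
    cres ((g (s' *: z) - g (s' *: y)) - (g (s *: z) - g (s *: y))).
  rewrite {1}/step (_ : _ - _ = (g (s' *: y) - g (s *: y)) +
    ((g (s' *: z) - g (s' *: y)) - (g (s *: z) - g (s *: y)))); last by ring.
  rewrite cresD//; move: sgood E; rewrite {1}/step.
  have : d <= 16^-1 by rewrite ge_min lexx orbT.
  by move=> ? ? ?; lra.
rewrite Ee opprD addrA subrr add0r normrN (lt_le_trans E)//.
have : d <= e / 2 by rewrite ge_min lexx.
by move=> ?; lra.
Qed.

Lemma goodZ N y t : t \in `[0, 1] -> good N y -> good N (t *: y).
Proof.
rewrite in_itv/= => /andP[t0 t1] gy s s'.
rewrite !in_itv/= => /andP[s0 s1] /andP[s'0 s'1] ss'.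
rewrite /step !scalerA; apply: gy; rewrite ?in_itv/= ?mulr_ge0 ?mulr_ile1//.
rewrite -mulrBl normrM (ger0_norm t0) (le_trans _ ss')// ler_piMr//.
Qed.

(** Along t *: y the difference of the two lifts is continuous and integral, and it vanishes at t =
    0. *)
Lemma lift_approx_indep N M y : good N y -> good M y -> G N y = G M y.
Proof.
move=> gN gM; pose H (t : R) := G N (t *: y) - G M (t *: y).
have /eqP : H 1 = H 0.
  apply: continuous_int_const => t t01.
    have ct : (fun t : R => t *: y) @ t --> t *: y.
      by apply: cvgZl; exact: cvg_id.
    by apply: cvgB; apply: (@continuous_cvg _ _ _ (nbhs t)) => //;
      apply: lift_approx_continuous; exact: goodZ.
  rewrite /H (_ : _ - _ = (G N (t *: y) - g (t *: y)) - (G M (t *: y) - g (t *: y))).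
    by rewrite rpredB ?lift_approx_int.
  by ring.
have G0 K : G K 0 = g 0.
  rewrite /G big1 ?addr0// => k _; rewrite /step !scaler0 subrr cres_id ?normr0//.
rewrite /H scale0r !G0 subrr scale1r subr_eq0 => /eqP.
by [].
Qed.

(** The number of pieces depends on the point, but around x one number M is good for all nearby
    points, and the value is the same for every good number. *)
Lemma lift_mod_int : exists2 L : V -> R, continuous L &
  forall x, L x - g x \is a Num.int.
Proof.
have near1 (x : V) : exists N, good N x.
  by have [N _ /(_ N)/= /(_ (leqnn N))/nbhs_singleton] := near_good x; exists N.
have [N Ngood] := choice near1.
exists (fun x => G (N x) x) => x; last exact: lift_approx_int.
have [M _ /(_ M)/= /(_ (leqnn M)) Mgood] := near_good x.
have Mx := nbhs_singleton Mgood.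
apply: (@cvg_trans _ (G M @ x)).
  apply: near_eq_cvg; near=> y; apply: lift_approx_indep => //.
  by near: y.
by rewrite (lift_approx_indep (Ngood x) Mx); exact: lift_approx_continuous.
Unshelve. all: by end_near. Qed.
End LiftModZ.

Lemma cvg_mx (R : realType) m n (T : Type) (F : set_system T) {FF : Filter F}
    (f : T -> 'M[R]_(m, n)) (l : 'M[R]_(m, n)) :
  (forall i j, (fun x => f x i j) @ F --> l i j) -> f @ F --> l.
Proof.
move=> fl; apply/cvgrPdist_lt => e e0.
have : \forall x \near F, forall i j, `|l i j - f x i j| < e / 2.
  apply: filter_forall => i; apply: filter_forall => j.
  by have /cvgrPdist_lt := fl i j; apply; rewrite divr_gt0.
apply: filterS => x h; rewrite (@le_lt_trans _ _ (e / 2))//.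
  apply: mx_norm_le => [|i j]; first by rewrite ltW// divr_gt0.
  by rewrite !mxE ltW.
by rewrite ltr_pdivrMr// ltr_pMr// ltr1n.
Qed.

Lemma continuous_mx (R : realType) m n (T : topologicalType) (f : T -> 'M[R]_(m, n)) x :
  (forall i j, (fun y => f y i j) @ x --> f x i j) -> f @ x --> f x.
Proof. by move=> fx; apply: (@cvg_mx _ _ _ _ (nbhs x)). Qed.

(** * The projection of R^b onto the torus *)

Section TorusTopology.
Local Open Scope quotient_scope.
Context {R : realType} {b : nat}.
Local Notation proj := (@torus_proj R b).

Lemma torus_projP (x y : 'cV[R]_b) :
  proj x = proj y <-> forall i, x i 0 - y i 0 \is a Num.int.
Proof.
split=> [/eqquotP/forallP//|xy]; by apply/eqquotP/forallP.
Qed.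

Lemma torus_proj_repr (t : torus R b) : proj (repr t) = t.
Proof. exact: reprK. Qed.

Lemma torus_proj_continuous : continuous proj.
Proof. exact: pi_continuous. Qed.

Lemma torus_proj_shift (x : 'cV[R]_b) (v : 'cV[int]_b) :
  proj (x + map_mx intr v) = proj x.
Proof. by apply/torus_projP => i; rewrite !mxE addrAC subrr add0r intr_int. Qed.

Lemma torus_proj_eqP (x y : 'cV[R]_b) : proj x = proj y ->
  exists v : 'cV[int]_b, x = y + map_mx intr v.
Proof.
move=> /torus_projP xy; exists (\col_i Num.floor (x i 0 - y i 0)).
apply/colP => i; rewrite !mxE; have := xy i.
by rewrite intrEfloor => /eqP ->; rewrite addrC subrK.
Qed.

Lemma torus_proj_open (A : set 'cV[R]_b) : open A -> open (proj @` A).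
Proof.
move=> oA; rewrite /open/= /quotient_open.
suff -> : \pi_(torus R b) @^-1` (proj @` A) =
    \bigcup_(v : 'cV[int]_b) ((fun x => x + map_mx intr v) @^-1` A).
  apply: bigcup_open => v _; apply: open_comp => // x _.
  by apply: (@cvgD _ _ _ (nbhs x)); [exact: cvg_id|exact: cvg_cst].
apply/seteqP; split=> [x [a Aa]|x [v _ Av]]; last first.
  by exists (x + map_mx intr v) => //; exact: torus_proj_shift.
by move=> /torus_proj_eqP[v aE]; exists v => //=; rewrite -aE.
Qed.

(** The coordinates of [repr (f x)] may jump, but they are continuous modulo Z because the
    projection is open; [lift_mod_int] then applies to each of them. *)
Lemma torus_lift (V : normedModType R) (f : V -> torus R b) : continuous f ->
  exists2 F : V -> 'cV[R]_b, continuous F & forall x, proj (F x) = f x.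
Proof.
move=> cf; pose g i x := repr (f x) i 0.
have lifti i : exists Fi : V -> R, continuous Fi /\ forall x, Fi x - g i x \is a Num.int.
  have [|L cL LP] := @lift_mod_int R V (g i); last by exists L.
  move=> x e e0; pose d := Num.min e 2^-1.
  have d0 : 0 < d by rewrite lt_min e0 invr_gt0/=.
  have : open (proj @` ball (repr (f x)) d) by apply: torus_proj_open; exact: ball_open.
  move=> oB; have : \forall y \near x, (proj @` ball (repr (f x)) d) (f y).
    apply: cf; apply: open_nbhs_nbhs; split=> //.
    by exists (repr (f x)); [exact: ballxx|exact: torus_proj_repr].
  apply: filterS => y [z]; rewrite -ball_normE/= => zd.
  rewrite -{1}(torus_proj_repr (f y)) => /torus_projP zy.
  have zi : `|z i 0 - g i x| < d.
    rewrite distrC (le_lt_trans _ zd)//.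
    by have := mx_norm_coord (repr (f x) - z) i 0; rewrite !mxE.
  rewrite (@eq_cres _ _ (z i 0 - g i x)).
    rewrite cres_id; first by rewrite (lt_le_trans zi)// ge_min lexx.
    by rewrite (lt_le_trans zi)// ge_min lexx orbT.
  by rewrite opprB addrA subrK -opprB rpredN; exact: zy.
have [F FP] := choice lifti; exists (fun x => \col_i F i x) => x.
  apply: continuous_mx => i j; rewrite mxE; under eq_fun do rewrite mxE.
  exact: (FP i).1.
rewrite -[RHS]torus_proj_repr; apply/torus_projP => i; rewrite mxE; exact: (FP i).2.
Qed.
End TorusTopology.

Lemma int_additive_mx b (f : 'cV[int]_b -> 'cV[int]_b) :
  (forall x y, f (x + y) = f x + f y) -> exists L : 'M[int]_b, forall v, f v = L *m v.
Proof.
move=> fD.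
have f0 : f 0 = 0 by apply: (addrI (f 0)); rewrite -fD !addr0.
have fN x : f (- x) = - f x by apply: (addrI (f x)); rewrite -fD !subrr.
have fMn x n : f (x *+ n) = f x *+ n.
  by elim: n => [|n IH]; rewrite ?mulr0n ?mulrS ?fD ?IH.
have fZ (k : int) x : f (k *: x) = k *: f x.
  have scE (l : int) (y : 'cV[int]_b) : l *: y = y *~ l.
    by rewrite -[in LHS](intz l) scaler_int.
  by rewrite !scE; case: k => n; rewrite ?NegzE ?mulrNz -?pmulrn ?fN ?fMn.
exists (\matrix_(i, j) f (delta_mx j 0) i 0) => v.
rewrite {1}(matrix_sum_delta v) (eq_bigr (fun i => v i 0 *: delta_mx i 0)); last first.
  by move=> i _; rewrite big_ord1.
rewrite (big_morph f fD f0); apply/colP => i; rewrite summxE mxE.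
by apply: eq_bigr => j _; rewrite fZ !mxE mulrC.
Qed.

(** * Surjectivity of self-maps of the torus *)

Section TorusSelfMaps.
Context {R : realType}.

Lemma trmx_continuous m n : continuous (fun x : 'M[R]_(m, n) => x^T).
Proof.
move=> x; apply: continuous_mx => i j; rewrite mxE; under eq_fun do rewrite mxE.
exact: coord_continuous.
Qed.

Lemma mulmx_continuous m n p (A : 'M[R]_(m, n)) :
  continuous (fun x : 'M[R]_(n, p) => A *m x).
Proof.
move=> x; apply: continuous_mx => i j; rewrite mxE; under eq_fun do rewrite mxE.
have FF := nbhs_filter x.
apply: cvg_big => [|k _]; first exact: add_continuous.
by apply: cvgMr; exact: coord_continuous.
Qed.

(** Every point is congruent modulo Z^b to one of the compact unit ball. *)
Lemma periodic_bounded b (h : 'cV[R]_b -> 'cV[R]_b) : continuous h ->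
  (forall x (v : 'cV[int]_b), h (x + map_mx intr v) = h x) ->
  exists K, forall x, `|h x| <= K.
Proof.
move=> ch hP.
have cK : compact [set x : 'rV[R]_b | `|x| <= 1].
  apply: bounded_closed_compact.
    by exists 1; split; [exact: num_real|move=> M M1 x /= /le_trans; apply; exact: ltW].
  apply: (@closed_comp _ _ (fun x : 'rV[R]_b => `|x|) [set y | y <= 1]) => //.
    by move=> x _; exact: norm_continuous.
have ch' : continuous (fun x : 'rV[R]_b => h x^T).
  by move=> x; apply: (@continuous_comp _ _ _ trmx h); [exact: trmx_continuous|exact: ch].
have /compact_bounded[K [_ KP]] := continuous_compact (continuous_subspaceT ch') cK.
exists (K + 1) => x.
pose v : 'cV[int]_b := \col_i Num.floor (x i 0).
rewrite -(subrK (map_mx intr v) x) hP -[x - _]trmxK; apply: KP; first by rewrite ltrDl.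
exists ((x - map_mx intr v)^T) => //; apply: mx_norm_le => // i j; rewrite !mxE.
have := floor_itv (x j 0); rewrite !ord1 intrD => /andP[h1 h2].
by rewrite ger0_norm; lra.
Qed.

Lemma equivariant_onto b (a : 'cV[R]_b -> 'cV[R]_b) (L M : 'M[int]_b) :
  continuous a -> (forall x (v : 'cV[int]_b), a (x + map_mx intr v) = a x + map_mx intr (L *m v)) ->
  M *m L = 1%:M -> L *m M = 1%:M -> forall y, exists x, a x = y.
Proof.
move=> ca aP ML LM y; set Lr := real_mx R L; set Mr := real_mx R M.
have MLr : Mr *m Lr = 1%:M by rewrite /Mr /Lr /real_mx -map_mxM/= ML map_mx1.
have LMr : Lr *m Mr = 1%:M by rewrite /Mr /Lr /real_mx -map_mxM/= LM map_mx1.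
have [||K KP] := @periodic_bounded b (fun x => Mr *m (a x - Lr *m x)).
- move=> x; apply: (@continuous_comp _ _ _ (fun x => a x - Lr *m x) (mulmx Mr)).
    by apply: (@cvgB _ _ _ (nbhs x)); [exact: ca|exact: mulmx_continuous].
  exact: mulmx_continuous.
- by move=> x v; rewrite aP (mulmxDr Lr) opprD addrACA map_mxM/= subrr addr0.
(* [Mr *m (a x - y)] is within K + |Mr y| of x, so on the faces x i = r and x i = - r its coordinate
   i has the sign of x i. *)
pose r := K + `|Mr *m y| + 1.
have K0 : 0 <= K by rewrite (le_trans _ (KP 0)).
have close (x : 'rV[R]_b) i : `|(Mr *m (a x^T - y)) i 0 - x 0 i| < r.
  set z := Mr *m (a x^T - Lr *m x^T).
  have -> : Mr *m (a x^T - y) = x^T + (z - Mr *m y).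
    by rewrite /z !mulmxBr mulmxA MLr mul1mx addrA [x^T + _]addrC subrK.
  rewrite 2!mxE addrAC subrr add0r (le_lt_trans (mx_norm_coord _ _ _))//.
  by rewrite (le_lt_trans (ler_normB _ _))// /r ltr_pwDr// lerD2r; exact: KP.
have [|i|i x xr xi|i x xr xi|x Fx] := @poincare_miranda R b r (fun i x => (Mr *m (a x^T - y)) i 0).
- by rewrite !addr_ge0.
- move=> x; apply: (@continuous_comp _ _ _ (fun x => Mr *m (a x^T - y)) (fun M => M i 0)); last exact: coord_continuous.
  apply: (@continuous_comp _ _ _ (fun x => a x^T - y) (mulmx Mr)); last exact: mulmx_continuous.
  apply: (@cvgB _ _ _ (nbhs x)); last exact: cvg_cst.
  by apply: (@continuous_comp _ _ _ trmx a); [exact: trmx_continuous|exact: ca].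
- by have := close x i; rewrite xi ltr_norml => /andP[_]; lra.
- by have := close x i; rewrite xi ltr_norml => /andP[+ _]; lra.
exists x^T; have {}Fx : Mr *m (a x^T - y) = 0.
  by apply/colP => i; rewrite Fx mxE.
have := congr1 (mulmx Lr) Fx; rewrite mulmxA LMr mul1mx mulmx0 => /eqP.
by rewrite subr_eq0 => /eqP.
Qed.

(** Two lifts of one path differ by a continuous integral vector, hence by a constant one. *)
Lemma lifts_same_increment b (u v : R -> 'cV[R]_b) : continuous u -> continuous v ->
  (forall t, torus_proj (u t) = torus_proj (v t)) -> u 1 - u 0 = v 1 - v 0.
Proof.
move=> cu cv uv; apply/colP => i; rewrite !mxE.
have : u 1 i 0 - v 1 i 0 = u 0 i 0 - v 0 i 0.
  apply: (@continuous_int_const R (fun t => u t i 0 - v t i 0)) => t _; last by have /torus_projP := uv t.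
  have cc (w : R -> 'cV[R]_b) : continuous w -> (fun s => w s i 0) @ t --> w t i 0.
    move=> cw; apply: (@continuous_comp _ _ _ w (fun M : 'cV[R]_b => M i 0)); [exact: cw|exact: coord_continuous].
  by apply: cvgB; exact: cc.
by lra.
Qed.

(* The columns of the matrix of phi on the fundamental group of the torus
   include the standard basis, by the second hypothesis. *)
Lemma torus_self_map_onto b (phi : torus R b -> torus R b) : continuous phi ->
  (forall j : 'I_b, exists (l : R -> torus R b) (e : R -> 'cV[R]_b),
    [/\ continuous l, continuous e, l 0 = l 1,
        forall t, torus_proj (e t) = phi (l t) & e 1 = e 0 + delta_mx j 0]) ->
  forall t, exists s, phi s = t.
Proof.
move=> cphi loops t.
have cf : continuous (phi \o @torus_proj R b).
  by move=> x; apply: continuous_comp; [exact: torus_proj_continuous|exact: cphi].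
have [a ca aP] := torus_lift cf.
have segc (x y : 'cV[R]_b) : continuous (fun s : R => y + s *: x).
  by move=> s; apply: cvgD; [exact: cvg_cst|apply: cvgZl; exact: cvg_id].
(* Along the segment from y to x, [a] and its translate by v lift the same path in the torus, so
   they have the same increment. *)
have a_shift x y (v : 'cV[int]_b) : a (x + map_mx intr v) - a x = a (y + map_mx intr v) - a y.
  have := @lifts_same_increment b (fun s => a (y + map_mx intr v + s *: (x - y))) (fun s => a (y + s *: (x - y))).
  rewrite !scale1r !scale0r !addr0 addrAC [y + (x - y)]addrC subrK => E.
  have {}E : a (x + map_mx intr v) - a (y + map_mx intr v) = a x - a y.
    apply: E => [s|s|s]; rewrite ?aP/=.
    - by apply: continuous_comp; [exact: segc|exact: ca].
    - by apply: continuous_comp; [exact: segc|exact: ca].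
    - by rewrite addrAC torus_proj_shift.
  move/eqP: E; rewrite subr_eq => /eqP ->.
  by rewrite addrAC [a x - a y - a x]addrAC subrr add0r addrC.
have aint (v : 'cV[int]_b) : exists w : 'cV[int]_b, a (map_mx intr v) - a 0 = map_mx intr w.
  have : torus_proj (a (map_mx intr v)) = torus_proj (a 0).
    by rewrite !aP/= -[in LHS](add0r (map_mx _ _)) torus_proj_shift.
  by move=> /torus_proj_eqP[w ->]; exists w; rewrite addrAC subrr add0r.
have [f fP] := choice aint.
have intr_inj (v w : 'cV[int]_b) : map_mx intr v = map_mx intr w :> 'cV[R]_b -> v = w.
  by move=> /colP vw; apply/colP => i; have := vw i; rewrite !mxE => /eqP; rewrite eqr_int => /eqP.
have a_eq x (v : 'cV[int]_b) : a (x + map_mx intr v) = a x + map_mx intr (f v).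
  by have := a_shift x 0 v; rewrite add0r fP => <-; rewrite [RHS]addrC subrK.
have [L LP] : exists L : 'M[int]_b, forall v, f v = L *m v.
  apply: int_additive_mx => v w; apply: intr_inj.
  rewrite map_mxD/= -!fP map_mxD/= a_eq -!fP. 
  by rewrite addrAC.
have [M MP] : exists M : 'M[int]_b, L *m M = 1%:M.
  have /choice[v vP] : forall j : 'I_b, exists v : 'cV[int]_b, L *m v = delta_mx j 0.
    move=> j; have [l [e [cl ce l01 el e01]]] := loops j.
    have [w cw wP] := torus_lift cl.
    have /torus_proj_eqP[v wv] : torus_proj (w 1) = torus_proj (w 0) by rewrite !wP l01.
    exists v; apply: intr_inj.
    (* [a \o w] and [e] lift the same path [phi \o l]; comparing increments shows that L v is the
       j-th basis vector. *)
    have := @lifts_same_increment b (a \o w) e _ ce _.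
    rewrite /= wv a_eq LP e01 ![_ + _ - _]addrAC !subrr !add0r map_delta_mx => -> //.
      by move=> s; apply: continuous_comp; [exact: cw|exact: ca].
    by move=> s; rewrite aP/= wP el.
  exists (\matrix_(i, j) v j i 0); apply/matrixP => i j.
  have /colP/(_ i) := vP j; rewrite !mxE eqxx andbT => <-.
  by apply: eq_bigr => k _; rewrite mxE.
(* A right inverse of a square matrix is two-sided, so L is invertible over Z. *)
have ML := mulmx1C MP.
have a_L x v : a (x + map_mx intr v) = a x + map_mx intr (L *m v) by rewrite a_eq LP.
have [x ax] := equivariant_onto ca a_L ML MP (repr t).
by exists (torus_proj x); rewrite -[LHS]/((phi \o @torus_proj R b) x) -aP ax torus_proj_repr.
Qed.
End TorusSelfMaps.

(** * Smooth functions *)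

Lemma near_image (T U : topologicalType) (G : T -> U) t (P : U -> Prop) :
  {for t, continuous G} -> (\forall y \near G t, P y) -> \forall s \near t, P (G s).
Proof. by move=> cG; exact: cG. Qed.

Section SmoothCurves.
Context {R : realType}.

Local Lemma near_all (T : topologicalType) (t : T) (P : T -> Prop) :
  (forall s, P s) -> \forall s \near t, P s.
Proof. by move=> Ps; exact: filterS (fun s _ => Ps s) (@filterT _ (nbhs t) _). Qed.

(** k-fold derivability on a neighbourhood of t, in a recursive form that passes to locally equal
    functions, sums, products and composites by induction on k, one differentiation rule at a
    time. *)
Fixpoint near_derivable (V : normedModType R) (k : nat) (F : R -> V) (t : R) : Prop :=
  if k is k'.+1 then
    (\forall s \near t, derivable F s 1) /\ near_derivable k' F^`()%classic t
  else True.

Lemma near_eq_derive1 (V : normedModType R) (F G : R -> V) (t : R) :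
  (\forall s \near t, F s = G s) -> \forall s \near t, F^`()%classic s = G^`()%classic s.
Proof.
move=> /near_join; apply: filterS => s FG.
by rewrite !derive1E; exact: near_eq_derive.
Qed.

Lemma near_derivable_eq (V : normedModType R) k (F G : R -> V) (t : R) :
  (\forall s \near t, F s = G s) -> near_derivable k F t -> near_derivable k G t.
Proof.
elim: k F G => //= k IH F G FG [dF dF']; split; last exact: (IH _ _ (near_eq_derive1 FG)).
apply: filterS2 (near_join FG) dF => s; exact: near_eq_derivable.
Qed.

Lemma near_derivable_derive1n (V : normedModType R) (F : R -> V) t :
  (forall k, near_derivable k F t) -> forall k, derivable (F^`(k)%classic) t 1.
Proof.
move=> Ft k; elim: k F Ft => [|k IH] F Ft.
  by have [/nbhs_singleton] := Ft 1%N.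
by rewrite derive1Sn; apply: IH => l; have [] := Ft l.+1.
Qed.

Lemma near_derivable_cst (V : normedModType R) k (v : V) t :
  near_derivable k (fun=> v) t.
Proof.
elim: k v => //= k IH v; split; first by apply: near_all => s; exact: derivable_cst.
rewrite (_ : derive1 _ = fun=> 0); first exact: IH.
by apply/funext => s; rewrite (derive1_cst v).
Qed.

Lemma near_derivableW (V : normedModType R) k (F : R -> V) t :
  near_derivable k.+1 F t -> near_derivable k F t.
Proof.
elim: k F => //= k IH F [dF [dF' h]]; split=> //; apply: IH; split=> //.
Qed.

Lemma near_derivableD k (F G : R -> R) t :
  near_derivable k F t -> near_derivable k G t -> near_derivable k (fun s => F s + G s) t.
Proof.
elim: k F G => //= k IH F G [dF hF] [dG hG]; split.
  by apply: filterS2 dF dG => s; exact: derivableD.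
apply: (near_derivable_eq _ (IH _ _ hF hG)).
apply: filterS2 dF dG => s Fs Gs; rewrite !derive1E.
by rewrite -(deriveD Fs Gs).
Qed.

Lemma near_derivableM k (F G : R -> R) t :
  near_derivable k F t -> near_derivable k G t -> near_derivable k (fun s => F s * G s) t.
Proof.
elim: k F G => //= k IH F G [dF hF] [dG hG]; split.
  by apply: filterS2 dF dG => s; exact: derivableM.
have FW := near_derivableW (conj dF hF).
have GW := near_derivableW (conj dG hG).
apply: (near_derivable_eq _ (near_derivableD (IH _ _ FW hG) (IH _ _ hF GW))).
apply: filterS2 dF dG => s Fs Gs; rewrite !derive1E.
by rewrite [RHS](deriveM Fs Gs) /GRing.scale/= [G s * _]mulrC.
Qed.

Lemma near_derivable_comp k (F G : R -> R) t :
  near_derivable k F (G t) -> near_derivable k G t -> near_derivable k (F \o G) t.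
Proof.
elim: k F G => //= k IH F G [dF hF] [dG hG].
have cG : {for t, continuous G}.
  by have /derivable1_diffP/differentiable_continuous := nbhs_singleton dG.
have dFG := near_image cG dF.
split.
  by apply: filterS2 dFG dG => s Fs Gs; have [] := is_derive1_comp (derivableP Fs) (derivableP Gs).
have GW := near_derivableW (conj dG hG).
apply: (near_derivable_eq _ (near_derivableM (IH _ _ hF GW) hG)).
by apply: filterS2 dFG dG => s Fs Gs; rewrite [RHS](derive1_comp Gs Fs).
Qed.

Lemma near_derivable_mx m n k (F : R -> 'M[R]_(m, n)) t :
  near_derivable k F t <-> forall i j, near_derivable k (fun s => F s i j) t.
Proof.
elim: k F => [|k IH] F //=; split.
  move=> [dF hF] i j; split; first by apply: filterS dF => s /derivable_mxP.
  apply: (near_derivable_eq _ ((IH _).1 hF i j)).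
  by apply: filterS dF => s Fs; rewrite !derive1E derive_mx// mxE.
move=> H; have dF : \forall s \near t, derivable F s 1.
  have : \forall s \near t, forall i j, derivable (fun s => F s i j) s 1.
    apply: (@filter_forall _ _ _ (nbhs t)) => i; apply: (@filter_forall _ _ _ (nbhs t)) => j.
    by have [] := H i j.
  by apply: filterS => s Fs; exact/derivable_mxP.
split=> //; apply/IH => i j; have [_] := H i j; apply: near_derivable_eq.
by apply: filterS dF => s Fs; rewrite !derive1E derive_mx// mxE.
Qed.

Lemma near_derivable_id k (t : R) : near_derivable k id t.
Proof.
case: k => //= k; split; first by apply: near_all => s; exact: derivable_id.
rewrite (_ : derive1 _ = fun=> 1 : R); first exact: near_derivable_cst.
by apply/funext => s; rewrite derive1_id.
Qed.

Lemma near_derivable_affine k (a c t : R) : near_derivable k (fun s => a * s + c) t.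
Proof.
apply: near_derivableD; last exact: near_derivable_cst.
by apply: near_derivableM; [exact: near_derivable_cst|exact: near_derivable_id].
Qed.

(* t^-j exp(-1/t) for t > 0, extended by 0: these functions are closed under
   derivation up to linear combinations. *)
Definition flat (j : nat) (t : R) : R := if 0 < t then t ^- j * expR (- t^-1) else 0.

(** From exp (1/t) >= t^-(j+1) / (j+1)!. *)
Lemma flat_le j t : 0 < t -> flat j t <= (j.+1)`!%:R * t.
Proof.
move=> t0; rewrite /flat t0 expRN.
rewrite ler_pdivrMr ?expR_gt0//.
have tV0 : 0 <= t^-1 by rewrite invr_ge0 ltW.
have -> : t ^- j = (j.+1)`!%:R * t * (t^-1 ^+ j.+1 / (j.+1)`!%:R).
  have f0 : (j.+1)`!%:R != 0 :> R by rewrite pnatr_eq0 -lt0n fact_gt0.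
  rewrite exprS exprVn; field.
  by rewrite ?f0 ?expf_neq0 ?(gt_eqF t0).
apply: ler_wpM2l; first by rewrite mulr_ge0// ltW.
by rewrite (le_trans _ (expR_ge1Dxn j tV0))// lerDr.
Qed.

Lemma flat_ge0 j t : 0 <= flat j t.
Proof.
rewrite /flat; case: ifPn => // t0.
by rewrite mulr_ge0 ?expR_ge0// invr_ge0 exprn_ge0// ltW.
Qed.

Lemma is_derive_flat j (t : R) : is_derive t 1 (flat j) (flat j.+2 t - j%:R * flat j.+1 t).
Proof.
have [t0|t0|->] := ltgtP t 0.
- have E : \forall s \near t, (fun=> 0 : R) s = flat j s.
    by apply: filterS (lt_nbhsl t0) => s s0; rewrite /flat ltNge ltW.
  apply: (near_eq_is_derive E); rewrite /flat ltNge ltW//= mulr0 subrr.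
  exact: is_derive_cst.
- have E : \forall s \near t, (fun s => s^-1 ^+ j * expR (- s^-1)) s = flat j s.
    by apply: filterS (lt_nbhsr t0) => s s0; rewrite /flat s0 exprVn.
  apply: (near_eq_is_derive E).
  have tn0 : t != 0 by rewrite gt_eqF.
  have dV : is_derive t 1 (fun s : R => s^-1) (- t ^- 2).
    by have := is_deriveV tn0 (is_derive_id t (1 : R)); rewrite [_ *: _]mulr1.
  have dX := is_deriveX j dV.
  have dN := is_deriveN dV.
  have dE := @is_derive1_comp R expR (fun s => - s^-1) t _ _ (is_derive_expR (- t^-1)) dN.
  rewrite (_ : (fun s => s^-1 ^+ j * expR (- s^-1)) =
    (fun s : R => s^-1) ^+ j * (expR \o (fun s => - s^-1))); last first.
    by apply/funext => s; rewrite !fctE.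
  have [dfg dE'] := is_deriveM dX dE; split=> //; rewrite dE'.
  rewrite /flat t0 !fctE/= /GRing.scale/=.
  case: j {E dX dfg dE'} => [|j] /=.
    by rewrite !(expr0, mul0r, mulr0, mul1r, addr0, subr0, opprK) mulrC.
  by rewrite -!exprVn !exprS expr0; ring.
- have F0 k : flat k 0 = 0 by rewrite /flat ltxx.
  rewrite !F0 mulr0 subrr.
  (* At 0 the difference quotient is [flat j.+1 h] for h > 0 and 0 for h < 0, so [flat_le] bounds it
     by a multiple of |h|. *)
  suff C : (fun h => h^-1 *: ((flat j \o shift 0) (h *: 1) - flat j 0)) @ 0^' --> (0 : R).
    by split; [apply/cvg_ex; exists 0|exact/cvg_lim].
  apply/cvgrPdist_le => e e0.
  pose d := e / (j.+2)`!%:R.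
  have f0 : 0 < (j.+2)`!%:R :> R by rewrite ltr0n fact_gt0.
  have d0 : 0 < d by exact: divr_gt0.
  near=> h; rewrite sub0r normrN F0 subr0/= addr0 [h *: 1]mulr1.
  have hd : `|h| < d by near: h; exact: dnbhs0_lt.
  have [h0|h0] := ltP 0 h; last by rewrite /flat ltNge h0/= scaler0 normr0 ltW.
  have -> : h^-1 *: flat j h = flat j.+1 h.
    by rewrite /flat h0 exprS invfM /GRing.scale/= mulrA.
  rewrite ger0_norm ?flat_ge0// (le_trans (flat_le _ h0))//.
  by rewrite -ler_pdivlMl// mulrC -/d ltW// (le_lt_trans _ hd)// ler_norm.
Unshelve. all: by end_near. Qed.

Lemma near_derivable_flat k j t : near_derivable k (flat j) t.
Proof.
elim: k j => //= k IH j; split.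
  by apply: near_all => s; have [] := is_derive_flat j s.
rewrite (_ : derive1 _ = fun s => flat j.+2 s + (- j%:R) * flat j.+1 s).
  apply: near_derivableD => //; apply: near_derivableM => //.
  exact: near_derivable_cst.
apply/funext => s; rewrite derive1E; have [_ ->] := is_derive_flat j s.
by rewrite mulNr.
Qed.

Lemma flat0_le (s t : R) : s <= t -> flat 0 s <= flat 0 t.
Proof.
move=> st; rewrite {1}/flat; case: ifPn => [s0|_]; last exact: flat_ge0.
rewrite /flat (lt_le_trans s0 st) !expr0 !invr1 !mul1r ler_expR lerN2.
by rewrite lef_pV2// posrE// (lt_le_trans s0).
Qed.

(** In psi t = flat 0 (c - flat 0 (t - 1/4)) with c = flat 0 (1/2), the inner [flat] vanishes up to
    1/4, and from 3/4 on it is at least c, so that the outer one vanishes. The step is 1 - psi /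
    flat 0 c. *)
Lemma smooth_step : exists phi : R -> R,
  [/\ forall k t, near_derivable k phi t,
      forall t, 0 <= phi t <= 1,
      forall t, t <= 4^-1 -> phi t = 0 &
      forall t, 3 / 4 <= t -> phi t = 1].
Proof.
pose c := flat 0 2^-1; pose psi t := flat 0 (c - flat 0 (t - 4^-1)).
have c0 : 0 < c by rewrite /c /flat invr_gt0 ltr0n expr0 invr1 mul1r expR_gt0.
have p0 : 0 < flat 0 c by rewrite /flat c0 expr0 invr1 mul1r expR_gt0.
have psi_le t : psi t <= flat 0 c by apply: flat0_le; rewrite gerBl flat_ge0.
have psi_ge t : 0 <= psi t by exact: flat_ge0.
exists (fun t => 1 + (- (flat 0 c)^-1) * psi t); split.
- move=> k t; apply: near_derivableD; first exact: near_derivable_cst.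
  apply: near_derivableM; first exact: near_derivable_cst.
  apply: (near_derivable_comp (G := fun t => c - flat 0 (t - 4^-1))).
    exact: near_derivable_flat.
  apply: near_derivableD; first exact: near_derivable_cst.
  rewrite (_ : (fun s => - flat 0 (s - 4^-1)) = (fun s => (-1) * (flat 0 \o (fun s => 1 * s + - 4^-1)) s)); last first.
    by apply/funext => s; rewrite mulN1r/= mul1r.
  apply: near_derivableM; first exact: near_derivable_cst.
  apply: near_derivable_comp; first exact: near_derivable_flat.
  exact: near_derivable_affine.
- move=> t; rewrite mulNr mulrC subr_ge0 gerBl divr_ge0 ?(ltW p0)//.
  by rewrite ler_pdivrMr// mul1r psi_le.
- move=> t t4; rewrite /psi.
  have -> : flat 0 (t - 4^-1) = 0 by rewrite /flat subr_gt0 ltNge t4.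
  rewrite subr0 mulNr mulVf ?subrr//.
  by rewrite gt_eqF.
- move=> t t34; have ct : c <= flat 0 (t - 4^-1) by apply: flat0_le; lra.
  have -> : psi t = 0 by rewrite /psi {1}/flat ltNge subr_le0 ct.
  by rewrite mulr0 addr0.
Qed.

(** The reason for axis-parallel moves: along a coordinate axis the derivatives of every order are
    iterated partial derivatives, which is what [Ck] controls. *)
Lemma near_derivable_partial n k (U : set 'rV[R]_n) (h : 'rV[R]_n -> R) (i : 'I_n)
    (z : 'rV[R]_n) (r : R) : open U -> Ck k U h -> U (z + r *: delta_mx 0 i) ->
  near_derivable k (fun s => h (z + s *: delta_mx 0 i)) r.
Proof.
move=> oU; elim: k h => // k IH h /= [_ /(_ i)[dh Ch]] Ur.
have lineE (s : R) : (fun u : R => u^-1 *: (((fun s => h (z + s *: delta_mx 0 i)) \o shift s) (u *: 1) - h (z + s *: delta_mx 0 i))) =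
    (fun u : R => u^-1 *: ((h \o shift (z + s *: delta_mx 0 i)) (u *: delta_mx 0 i) - h (z + s *: delta_mx 0 i))).
  apply/funext => u /=; congr (_ *: (h _ - _)).
  by rewrite [u *: 1]mulr1 scalerDl addrCA.
have cl : continuous (fun s : R => z + s *: (delta_mx 0 i : 'rV[R]_n)).
  by move=> s; apply: cvgD; [exact: cvg_cst|apply: cvgZl; exact: cvg_id].
have nU : \forall s \near r, U (z + s *: delta_mx 0 i) by apply: cl; exact: open_nbhs_nbhs.
split.
  by apply: filterS nU => s Us; rewrite /derivable lineE; exact: dh.
rewrite (_ : derive1 _ = fun s => partial i h (z + s *: delta_mx 0 i)); first exact: IH.
by apply/funext => s; rewrite derive1E /derive lineE.
Qed.

End SmoothCurves.

(** * Differentiability from continuous partial derivatives *)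

Section Differentiability.
Context {R : realType}.

Definition row_form n (c : 'I_n -> R) (v : 'rV[R]_n) : R^o := \sum_i v 0 i * c i.

Fact row_form_linear n (c : 'I_n -> R) : linear (row_form c).
Proof.
move=> a u v; rewrite /row_form scaler_sumr -big_split/=.
by apply: eq_bigr => i _; rewrite !mxE mulrDl /GRing.scale/= mulrA.
Qed.

HB.instance Definition _ n (c : 'I_n -> R) :=
  GRing.isLinear.Build R 'rV[R]_n R^o _ (row_form c) (row_form_linear c).

Lemma row_form_continuous n (c : 'I_n -> R) : continuous (row_form c).
Proof.
move=> x; have FF := nbhs_filter x.
apply: cvg_big => [|k _]; first exact: add_continuous.
by apply: cvgMl; exact: coord_continuous.
Qed.

Lemma differentiable_row_form n (c : 'I_n -> R) (h : 'rV[R]_n -> R^o) x :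
  (forall e, 0 < e -> \forall y \near x, `|h y - h x - row_form c (y - x)| <= e * `|y - x|) ->
  differentiable h x.
Proof.
move=> hx; apply/diffP => /=.
apply: (@getPex _ (fun (df : {linear 'rV[R]_n -> R^o}) => continuous df /\
  forall y, h y = h (lim (nbhs x)) + df (y - lim (nbhs x))
                  +o_(y \near x) (y - lim (nbhs x)))).
exists (row_form c : {linear 'rV[R]_n -> R^o}).
split; first exact: row_form_continuous.
rewrite lim_id//.
have E : h = (fun y => h x + row_form c (y - x)) +o_ x (fun y => y - x).
  apply/eqaddoP => e e0; apply: filterS (hx e e0) => y.
  by rewrite !fctE opprD addrA.
by move=> y; rewrite {1}E.
Qed.

Lemma MVT_ball (g : R -> R) (w e : R) :
  (forall s, `|s| <= `|w| -> derivable g s 1 /\ `|'D_1 g s| <= e) ->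
  `|g w - g 0| <= e * `|w|.
Proof.
move=> gw; have mvt a b : a <= b -> (forall s, a <= s <= b -> `|s| <= `|w|) ->
    exists2 s, `|s| <= `|w| & g b - g a = 'D_1 g s * (b - a).
  move=> ab sw; have [s'|s'|s' + ->] := @MVT_segment R g ('D_1 g) a b ab.
  - rewrite in_itv/= => /andP[a_s sb]; apply/derivableP.
    by apply: (gw s' _).1; apply: sw; rewrite !ltW.
  - apply: derivable_within_continuous => s1; rewrite in_itv/= => sab.
    exact: (gw s1 (sw _ sab)).1.
  - by rewrite in_itv/= => sab; exists s' => //; exact: sw.
have [w0|w0] := leP 0 w.
  have [|s sw ->] := mvt 0 w w0.
    by move=> s /andP[s0 sw]; rewrite !ger0_norm.
  by rewrite subr0 normrM ler_wpM2r//; exact: (gw s sw).2.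
have [|s sw] := mvt w 0 (ltW w0).
  by move=> s /andP[ws s0]; rewrite !ler0_norm ?lerN2// ltW.
rewrite sub0r => E; rewrite distrC E normrM normrN ler_wpM2r//; exact: (gw s sw).2.
Qed.

(** From x to y one coordinate at a time: on each segment the mean value theorem applies to h minus
    its linear part at x, whose derivative is small because the partial derivatives are continuous
    at x. *)
Lemma Ck1_differentiable n (U : set 'rV[R]_n) (h : 'rV[R]_n -> R) x :
  open U -> Ck 1 U h -> U x -> differentiable (h : 'rV[R]_n -> R^o) x.
Proof.
move=> oU [_ Ch] Ux; pose c i := partial i h x.
apply: (@differentiable_row_form _ c) => e e0.
(* Each of the n coordinate moves costs at most e' times the norm; n.+1 keeps the denominator
   positive when n = 0. *)
pose e' := e / n.+1%:R.
have e'0 : 0 < e' by exact: divr_gt0.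
have : \forall y \near x, forall i, U y /\ `|partial i h y - c i| <= e'.
  apply: (@filter_forall _ _ _ (nbhs x)) => i; have [dh [ch _]] := Ch i.
  apply: filterI; first exact: open_nbhs_nbhs.
  have /cvgrPdist_le/(_ e' e'0) := ch x Ux.
  by apply: filterS => y; rewrite distrC.
move=> /nbhs_ballP[d /= d0 dP].
apply/nbhs_ballP; exists d => //= y; rewrite -ball_normE/= distrC => xyd.
move: xyd; move vE: (y - x) => v xyd; pose vk (k : nat) : 'rV[R]_n := \row_j (if (j < k)%N then v 0 j else 0).
have vk_le k : `|vk k| <= `|v|.
  apply: mx_norm_le => // i j; rewrite mxE; case: ifP => _; rewrite ?normr0//.
  exact: mx_norm_coord.
have tele (k : nat) : (k <= n)%N ->
    `|h (x + vk k) - h x - \sum_(j < n | (j < k)%N) v 0 j * c j| <= k%:R * e' * `|v|.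
  elim: k => [_|k IH kn].
    rewrite (_ : vk 0%N = 0); last by apply/rowP => j; rewrite !mxE.
    by rewrite addr0 subrr big_pred0// subrr normr0 !mul0r.
  pose i := Ordinal kn; pose p := x + vk k.
  have pE : x + vk k.+1 = p + v 0 i *: delta_mx 0 i.
    rewrite -addrA; congr (_ + _); apply/rowP => j; rewrite !mxE/= ltnS leq_eqVlt.
    have [->|ji] := eqVneq j i; first by rewrite eqxx ltnn/= mulr1 add0r.
    rewrite mulr0 addr0 (_ : (nat_of_ord j == k) = false)//.
    by apply/negbTE; apply: contra ji => /eqP jk; apply/eqP/val_inj.
  rewrite (bigD1 i)/= ?ltnS//.
  rewrite (eq_bigl (fun j : 'I_n => (j < k)%N)); last first.
    move=> j; rewrite ltnS leq_eqVlt -val_eqE/=.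
    by case: (ltngtP j k) => //=.
  have -> : h (x + vk k.+1) - h x - (v 0 i * c i + \sum_(j < n | (j < k)%N) v 0 j * c j) =
     (h (p + v 0 i *: delta_mx 0 i) - h p - v 0 i * c i) +
     (h (x + vk k) - h x - \sum_(j < n | (j < k)%N) v 0 j * c j).
    by rewrite pE /p; ring.
  apply: le_trans (ler_normD _ _) _.
  rewrite -[k.+1%:R]natr1 !mulrDl mul1r [leRHS]addrC.
  apply: lerD; last exact: IH (ltnW kn).
  rewrite (@le_trans _ _ (e' * `|v 0 i|))//; last first.
    by apply: ler_wpM2l; [exact: ltW|exact: mx_norm_coord].
  pose gg (s : R) : R := h (p + s *: delta_mx 0 i) - s * c i.
  have : `|gg (v 0 i) - gg 0| <= e' * `|v 0 i|.
    apply: MVT_ball => s sv.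
    have pU : U (p + s *: delta_mx 0 i) /\ `|partial i h (p + s *: delta_mx 0 i) - c i| <= e'.
      apply: dP; rewrite -ball_normE/= distrC /p -[x + _ + _]addrA [x + _]addrC addrK.
      rewrite (le_lt_trans _ xyd)//; apply: mx_norm_le => // i' j; rewrite !mxE ord1/=.
      have [->|ji] := eqVneq j i; first by rewrite ltnn/= mulr1 add0r (le_trans sv)// mx_norm_coord.
      by rewrite mulr0 addr0; case: ifP => _; rewrite ?normr0// mx_norm_coord.
    have lineE : (fun u : R => u^-1 *: (((fun s => h (p + s *: delta_mx 0 i)) \o shift s) (u *: 1) - h (p + s *: delta_mx 0 i))) =
    (fun u : R => u^-1 *: ((h \o shift (p + s *: delta_mx 0 i)) (u *: delta_mx 0 i) - h (p + s *: delta_mx 0 i))).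
      apply/funext => u /=; congr (_ *: (h _ - _)).
      by rewrite [u *: 1]mulr1 scalerDl addrCA.
    have d1 : derivable (fun s : R => h (p + s *: delta_mx 0 i)) s 1.
      by rewrite /derivable lineE; have [+ _] := Ch i; apply; exact: pU.1.
    have d2 : derivable (fun s : R => s * c i) s 1.
      by apply: derivableM; [exact: derivable_id|exact: derivable_cst].
    split; first exact: (derivableB d1 d2).
    rewrite (deriveB d1 d2) {1}/derive lineE -/(derive h _ _).
    by rewrite (deriveMr (f := id) _ (@derivable_id _ _ _ _)) derive_id mulr1; exact: pU.2.
  rewrite /gg scale0r mul0r addr0 subr0; congr (`|_| <= _).
  by ring.
have := tele n (leqnn n).
rewrite (_ : x + vk n = y); last first.
  rewrite (_ : vk n = v); last by apply/rowP => j; rewrite mxE ltn_ord.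
  by rewrite -vE addrC subrK.
rewrite (eq_bigl xpredT); last by move=> j; rewrite ltn_ord.
move=> /le_trans; apply; rewrite ler_wpM2r// /e' mulrA ler_pdivrMr// mulrC.
by apply: ler_wpM2l; [exact: ltW|rewrite ler_nat].
Qed.
End Differentiability.

(** * Singular chains *)

Section AffineSimplices.
Context {R : realType}.
Implicit Types X Y : topologicalType.

Definition affine_map n (c : 'I_n.+1 -> R) (x : std_simplex R n) : R :=
  \sum_i c i * (val x : 'rV[R]_n.+1) 0 i.

Lemma affine_map_continuous n (c : 'I_n.+1 -> R) : continuous (affine_map c).
Proof.
move=> x; apply: (@cvg_big _ _ _ _ _ add_continuous _ (nbhs x)) => i _.
apply: cvgMr.
apply: (@continuous_comp _ _ _ (@set_val _ (std_simplex R n))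
    (fun M : 'rV[R]_n.+1 => M 0 i)); first exact: initial_continuous.
exact: coord_continuous.
Qed.

HB.instance Definition _ n (c : 'I_n.+1 -> R) :=
  isContinuous.Build (std_simplex R n) R (affine_map c) (@affine_map_continuous n c).

Lemma affine_map_face n (c : 'I_n.+2 -> R) (i : 'I_n.+2) (x : std_simplex R n) :
  affine_map c (face i x) = affine_map (c \o fintype.lift i) x.
Proof.
rewrite /affine_map (bigD1_ord i)//= mxE unlift_none mulr0 add0r.
by apply: eq_bigr => k _; rewrite mxE liftK.
Qed.

Lemma affine_map_vertex n (c : 'I_n.+1 -> R) i : affine_map c (vertex R n i) = c i.
Proof.
rewrite /affine_map (bigD1 i)//= mxE !eqxx mulr1 big1 ?addr0// => j /negPf ji.
by rewrite mxE ji andbF mulr0.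
Qed.

(** Simplices that factor through R by an affine map. Their faces are of the same kind, so
    boundaries along a curve are computed on the values at the vertices. *)
Definition curve_simplex n X (gamma : continuousType R X) (c : 'I_n.+1 -> R) :
  simplex R n X := gamma \o affine_map c.

Lemma boundary_curve_simplex n X (gamma : continuousType R X) (c : 'I_n.+2 -> R) :
  boundary << curve_simplex gamma c >> =
  \sum_(i < n.+2) << (-1) ^+ i *g curve_simplex gamma (c \o fintype.lift i) >>.
Proof.
rewrite /boundary liftU scale1r; apply: eq_bigr => i _; congr (<< _ *g _ >>).
by apply/continuousEP => x /=; rewrite affine_map_face.
Qed.

HB.instance Definition _ n X := GRing.isZmodMorphism.Build (chain (R := R) n.+1 X)
  (chain (R := R) n X) (@boundary R n X) (lift_is_additive _).

HB.instance Definition _ n X Y (f : continuousType X Y) :=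
  GRing.isZmodMorphism.Build (chain (R := R) n X) (chain (R := R) n Y) (push f)
    (lift_is_additive _).

Lemma chain_additive_ext n X (V : zmodType) (F G : {additive chain (R := R) n X -> V}) :
  (forall s : simplex R n X, F << s >> = G << s >>) -> F =1 G.
Proof.
move=> FG c; rewrite -(freeg_sumE c) !raddf_sum; apply: eq_bigr => s _.
rewrite -[coeff s c]intz -freegU_mulz !raddfMz FG//.
Qed.

Lemma boundaryU n X (s : simplex R n.+1 X) :
  boundary << s >> = \sum_(i < n.+2) << (s \o face i : simplex R n X) >> *~ (-1) ^+ i.
Proof.
rewrite /boundary liftU scale1r; apply: eq_bigr => i _.
by rewrite freegU_mulz intz.
Qed.

Lemma pushU n X Y (f : continuousType X Y) (s : simplex R n X) :
  push f << s >> = << (f \o s : simplex R n Y) >>.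
Proof. by rewrite /push liftU scale1r. Qed.

Lemma push_boundary n X Y (f : continuousType X Y) (c : chain (R := R) n.+1 X) :
  push f (boundary c) = boundary (push f c).
Proof.
have key (s : simplex R n.+1 X) : push f (boundary << s >>) = boundary (push f << s >>).
  rewrite pushU !boundaryU raddf_sum; apply: eq_bigr => i _.
  rewrite raddfMz/= pushU; congr (<< _ >> *~ _).
  by apply/continuousEP.
exact: (chain_additive_ext (F := push f \o @boundary R n X) (G := @boundary R n Y \o push f) key).
Qed.

Section Homologous.
Context {n : nat} {X : topologicalType}.
Implicit Types c d : chain (R := R) n X.

Lemma homologous_refl c : homologous c c.
Proof. by exists 0; rewrite raddf0 subrr. Qed.

Lemma homologous_sym c d : homologous c d -> homologous d c.
Proof. by move=> [e ce]; exists (- e); rewrite [boundary _]raddfN/= -ce opprB. Qed.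

Lemma homologousD c d c' d' : homologous c d -> homologous c' d' ->
  homologous (c + c') (d + d').
Proof.
move=> [e ce] [e' ce']; exists (e + e').
by rewrite [boundary _]raddfD/= -ce -ce' opprD addrACA.
Qed.

Lemma homologousMz c d (k : int) : homologous c d -> homologous (c *~ k) (d *~ k).
Proof. by move=> [e ce]; exists (e *~ k); rewrite [boundary _]raddfMz/= -ce mulrzBl. Qed.

Lemma homologous_sum (I : finType) (F G : I -> chain (R := R) n X) :
  (forall i, homologous (F i) (G i)) -> homologous (\sum_i F i) (\sum_i G i).
Proof.
move=> FG; apply: (big_ind2 (@homologous R n X)) => [|c d c' d'|i _].
- exact: homologous_refl.
- exact: homologousD.
- exact: FG.
Qed.

Lemma homologous_trans c d e : homologous c d -> homologous d e -> homologous c e.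
Proof.
move=> cd de; have := homologousD cd de.
by move=> [u]; rewrite [c + d]addrC opprD addrACA subrr add0r; exists u.
Qed.

End Homologous.

Lemma homologous_push n X Y (f : continuousType X Y) (c d : chain (R := R) n X) :
  homologous c d -> homologous (push f c) (push f d).
Proof. by move=> [e ce]; exists (push f e); rewrite -raddfB/= ce push_boundary. Qed.

Definition curve_segment X (gamma : continuousType R X) (a b : R) : simplex R 1 X :=
  curve_simplex gamma (fun j : 'I_2 => if j == ord0 then a else b).

(** The relation is, up to sign, the boundary of the 2-simplex folded onto the curve by the affine
    map with vertex values a, b, c. *)
Lemma curve_segment_add X (gamma : continuousType R X) (a b c : R) :
  homologous << curve_segment gamma a c >>
    (<< curve_segment gamma a b >> + << curve_segment gamma b c >>).
Proof.
exists (- << curve_simplex gamma (fun j : 'I_3 => nth a [:: a; b; c] j) >>).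
rewrite [boundary _]raddfN/= boundary_curve_simplex !big_ord_recl big_ord0/= addr0.
rewrite expr0 expr1 /bump/= expr2 mulN1r opprK.
have seg i a' b' : (fun j : 'I_3 => nth a [:: a; b; c] j) \o fintype.lift i =
    (fun j : 'I_2 => if j == ord0 then a' else b') ->
    curve_simplex gamma ((fun j : 'I_3 => nth a [:: a; b; c] j) \o fintype.lift i) =
    curve_segment gamma a' b'.
  by rewrite /curve_segment => ->.
rewrite (seg _ b c); last by apply/funext => -[[|[|//]] h].
rewrite (seg _ a c); last by apply/funext => -[[|[|//]] h].
rewrite (seg _ a b); last by apply/funext => -[[|[|//]] h].
rewrite -freegUN.
by rewrite !opprD opprK [RHS]addrCA; congr (_ + _); rewrite addrC.
Qed.

Lemma curve_segment_vertex0 X (gamma : continuousType R X) a b :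
  curve_segment gamma a b (vertex R 1 0) = gamma a.
Proof. by rewrite /curve_segment/curve_simplex/= affine_map_vertex. Qed.

Lemma curve_segment_vertex1 X (gamma : continuousType R X) a b :
  curve_segment gamma a b (vertex R 1 1) = gamma b.
Proof. by rewrite /curve_segment/curve_simplex/= affine_map_vertex. Qed.

Lemma curve_segment_cycle X (gamma : continuousType R X) a b : gamma a = gamma b ->
  is_cycle << curve_segment gamma a b >>.
Proof.
move=> ab; rewrite /is_cycle boundary_curve_simplex !big_ord_recl big_ord0/= addr0.
rewrite expr0 expr1 -freegUN; apply/eqP; rewrite subr_eq0; apply/eqP; congr (<< _ >>).
apply/continuousEP => x; rewrite /curve_simplex/= /affine_map !big_ord1/=.
have -> : (val x : 'rV[R]_1) 0 ord0 = 1.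
  by case: x => x /= /set_mem[_]; rewrite big_ord1.
by rewrite !mulr1 ab.
Qed.

End AffineSimplices.

(** * Smooth paths in a covering *)

Section StationaryPaths.
Context {R : realType}.
Implicit Types X Y : topologicalType.

(* Constancy near both ends makes concatenations of smooth paths smooth. *)
Definition stationary X (x y : X) (gamma : R -> X) : Prop :=
  continuous gamma /\
  exists e : R, [/\ 0 < e, forall t, t <= e -> gamma t = x &
                    forall t, 1 - e <= t -> gamma t = y].

Definition concat X (g1 g2 : R -> X) (t : R) : X :=
  if t <= 2^-1 then g1 (2 * t) else g2 (2 * t - 1).

Lemma stationary0 X (x y : X) gamma : stationary x y gamma -> gamma 0 = x.
Proof. by move=> [_ [e [e0 + _]]]; apply; exact: ltW. Qed.

Lemma stationary1 X (x y : X) gamma : stationary x y gamma -> gamma 1 = y.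
Proof. by move=> [_ [e [e0 _]]]; apply; rewrite gerBl ltW. Qed.

Lemma stationary_cst X (x : X) : stationary x x (fun=> x).
Proof. by split; [exact: cst_continuous|exists 1]. Qed.

Lemma stationary_comp X Y (h : X -> Y) (x y : X) gamma :
  continuous h -> stationary x y gamma -> stationary (h x) (h y) (h \o gamma).
Proof.
move=> ch [cg [e [e0 g0 g1]]]; split.
  by move=> t; apply: continuous_comp; [exact: cg|exact: ch].
by exists e; split=> // t te /=; [rewrite g0|rewrite g1].
Qed.

(** Both curves are constant near the joint, so at each time the concatenation is locally one of
    them after an affine change of time. Continuity and smoothness of concatenations reduce to
    this. *)
Lemma concat_local X (x y z : X) g1 g2 : stationary x y g1 -> stationary y z g2 ->
  forall t : R, exists (g : R -> X) (c : R), (g = g1 \/ g = g2) /\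
    \forall s \near t, g (2 * s + c) = concat g1 g2 s.
Proof.
move=> [_ [e1 [e10 _ g1y]]] [_ [e2 [e20 g2y _]]] t.
have [t2|t2] := leP t 2^-1.
  exists g1, 0; split; first by left.
  pose d := Num.min e1 e2; have d0 : 0 < d by rewrite lt_min e10.
  have [de1 de2] : d <= e1 /\ d <= e2 by rewrite !ge_min !lexx orbT.
  have : t < 2^-1 + d / 2 by rewrite (le_lt_trans t2)// ltrDl divr_gt0.
  move=> /lt_nbhsl; apply: filterS => s sd; rewrite /concat addr0; case: ifPn => //.
  by rewrite -ltNge => s2; rewrite g1y ?g2y//; lra.
exists g2, (- 1); split; first by right.
apply: filterS (lt_nbhsr t2) => s s2.
by rewrite /concat leNgt s2.
Qed.

Lemma affine_continuous (a c : R) : continuous (fun t : R => a * t + c).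
Proof.
by move=> t; apply: cvgD; [apply: cvgMr; exact: cvg_id|exact: cvg_cst].
Qed.

Lemma stationary_concat X (x y z : X) g1 g2 : stationary x y g1 -> stationary y z g2 ->
  stationary x z (concat g1 g2).
Proof.
move=> s1 s2; split.
  move=> t; have [g [c [gE gloc]]] := concat_local s1 s2 t.
  have cg : continuous g by case: gE => ->; [exact: s1.1|exact: s2.1].
  have : {for t, continuous (g \o (fun s => 2 * s + c))}.
    by apply: continuous_comp; [exact: affine_continuous|exact: cg].
  rewrite /continuous_at -(nbhs_singleton gloc)/= => gc.
  exact: cvg_trans (near_eq_cvg gloc) gc.
have [_ [e1 [e10 g1x _]]] := s1; have [_ [e2 [e20 _ g2z]]] := s2.
exists (Num.min 4^-1 (Num.min (e1 / 2) (e2 / 2))); split.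
- by rewrite !lt_min invr_gt0 ltr0n !divr_gt0.
- move=> t; rewrite !le_min => /and3P[t4 te1 te2]; rewrite /concat ifT; last by lra.
  by apply: g1x; lra.
- move=> t; set m := Num.min _ _ => mt.
  have [m4 me] : m <= 4^-1 /\ m <= e2 / 2 by rewrite !ge_min !lexx !orbT.
  by rewrite /concat leNgt ifF; [apply: g2z; lra|apply/negbTE; rewrite negbK; lra].
Qed.

Lemma concat_comp X Y (h : X -> Y) (g1 g2 : R -> X) :
  h \o concat g1 g2 = concat (h \o g1) (h \o g2).
Proof. by apply/funext => t; rewrite /concat/=; case: ifP. Qed.

Section SmoothCurve.
Context {n : nat} {M : topologicalType} (atl : smooth_atlas R n M).

Definition smooth_curve (gamma : R -> M) : Prop :=
  forall t (c : chart_index atl) k, chart_dom c (gamma t) ->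
    near_derivable k (chart c \o gamma) t.

Lemma smooth_curve_cst x : smooth_curve (fun=> x).
Proof. by move=> t c k _; exact: near_derivable_cst. Qed.

Lemma smooth_curve_concat x y z g1 g2 :
  stationary x y g1 -> stationary y z g2 -> smooth_curve g1 -> smooth_curve g2 ->
  smooth_curve (concat g1 g2).
Proof.
move=> st1 st2 sm1 sm2 t c k ct.
have [g [d [gE gloc]]] := concat_local st1 st2 t.
have smg : smooth_curve g by case: gE => ->.
apply: (@near_derivable_eq _ _ _ (fun s => chart c (g (2 * s + d)))).
  by apply: filterS gloc => s /= ->.
apply/near_derivable_mx => i j.
apply: (near_derivable_comp (F := fun s => chart c (g s) i j) (G := fun s => 2 * s + d)).
  move: (smg (2 * t + d) c k); rewrite (nbhs_singleton gloc) => /(_ ct).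
  by move=> /near_derivable_mx/(_ i j).
exact: near_derivable_affine.
Qed.

Lemma chart_continuous c x : chart_dom (s := atl) c x -> {for x, continuous (chart c)}.
Proof.
have [_ [+ _]] := chart_homeo (s := atl) c.
rewrite continuous_open_subspace; last exact: chart_dom_open.
by move=> h cx; apply: h; exact/mem_set.
Qed.

Lemma chart_inv_continuous c z : chart_im (s := atl) c z -> {for z, continuous (chart_inv c)}.
Proof.
have [_ [_ ]] := chart_homeo (s := atl) c.
rewrite continuous_open_subspace; last exact: chart_im_open.
by move=> h cx; apply: h; exact/mem_set.
Qed.

Lemma chartK c x : chart_dom (s := atl) c x -> chart_inv c (chart c x) = x.
Proof. by have [[_ _ h _] _] := chart_homeo (s := atl) c; exact: h. Qed.

Lemma chart_invK c z : chart_im (s := atl) c z -> chart c (chart_inv c z) = z.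
Proof. by have [[_ _ _ h] _] := chart_homeo (s := atl) c; exact: h. Qed.

Lemma chart_in c x : chart_dom (s := atl) c x -> chart_im c (chart c x).
Proof.
have [[h _ _ _] _] := chart_homeo (s := atl) c.
by move=> cx; apply: h; exists x.
Qed.

Lemma chart_inv_in c z : chart_im (s := atl) c z -> chart_dom c (chart_inv c z).
Proof.
have [[_ h _ _] _] := chart_homeo (s := atl) c.
by move=> cz; apply: h; exists z.
Qed.

Lemma overlapE (c c' : chart_index atl) z :
  overlap c c' z <-> chart_im c z /\ chart_dom c' (chart_inv c z).
Proof.
split=> [[x [cx c'x] <-]|[cz c'z]]; first by rewrite chartK//; split=> //; exact: chart_in.
exists (chart_inv c z); last exact: chart_invK.
by split=> //; exact: chart_inv_in.
Qed.

Lemma overlap_open (c c' : chart_index atl) : open (overlap c c').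
Proof.
rewrite openE => z /overlapE[cz c'z]; rewrite /interior.
have h1 : \forall y \near z, chart_im c y.
  by apply: open_nbhs_nbhs; split=> //; exact: chart_im_open.
have h2 : \forall y \near z, chart_dom c' (chart_inv c y).
  apply: (chart_inv_continuous cz); apply: open_nbhs_nbhs; split=> //.
  exact: chart_dom_open.
by apply: filterS2 h1 h2 => y cy c'y; exact/overlapE.
Qed.

End SmoothCurve.
End StationaryPaths.

(** * Smooth moves parallel to a coordinate axis *)

Section AxisMoves.
Context {R : realType}.

Definition step_fun : R -> R := projT1 (cid (@smooth_step R)).

Lemma step_funP : [/\ forall k t, near_derivable k step_fun t,
      forall t, 0 <= step_fun t <= 1,
      forall t, t <= 4^-1 -> step_fun t = 0 &
      forall t, 3 / 4 <= t -> step_fun t = 1].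
Proof. exact: projT2 (cid (@smooth_step R)). Qed.

Lemma step_fun_derivable t : derivable step_fun t 1.
Proof. by have [/(_ 1%N t)[/nbhs_singleton]] := step_funP. Qed.

Lemma step_fun_continuous : continuous step_fun.
Proof. by move=> t; exact/differentiable_continuous/derivable1_diffP/step_fun_derivable. Qed.

Context {n : nat} {M : topologicalType} (atl : smooth_atlas R n M).

Definition axis_line (z : 'rV[R]_n) (i : 'I_n) (s t : R) : 'rV[R]_n :=
  z + (step_fun t * s) *: delta_mx 0 i.

Lemma axis_line_continuous z i s : continuous (axis_line z i s).
Proof.
move=> t; apply: cvgD; first exact: cvg_cst.
by apply: cvgZl; apply: cvgMl; exact: step_fun_continuous.
Qed.

Lemma axis_line_ball z0 (d : R) z i s t :
  ball z0 d z -> ball z0 d (z + s *: delta_mx 0 i) -> ball z0 d (axis_line z i s t).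
Proof.
rewrite -!ball_normE/= => zd zsd; have [_ /(_ t)/andP[t0 t1] _ _] := step_funP.
rewrite /axis_line.
have -> : z0 - (z + (step_fun t * s) *: delta_mx 0 i) =
    (1 - step_fun t) *: (z0 - z) + step_fun t *: (z0 - (z + s *: delta_mx 0 i)).
  by apply/rowP => j; rewrite !mxE; ring.
have d0 : 0 < d by exact: le_lt_trans zd.
rewrite (le_lt_trans (ler_normD _ _))// !normrZ ger0_norm ?subr_ge0// ger0_norm//.
have [->|tn] := eqVneq (step_fun t) 0; first by rewrite subr0 mul1r mul0r addr0.
have : step_fun t * `|z0 - (z + s *: delta_mx 0 i)| < step_fun t * d.
  by rewrite ltr_pM2l// lt_neqAle eq_sym tn.
have : (1 - step_fun t) * `|z0 - z| <= (1 - step_fun t) * d.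
  by rewrite ler_wpM2l ?subr_ge0// ltW.
by lra.
Qed.

Definition axis_curve (c : chart_index atl) (z : 'rV[R]_n) (i : 'I_n) (s t : R) : M :=
  chart_inv c (axis_line z i s t).

Lemma smooth_axis_curve c z i s : (forall t, chart_im c (axis_line z i s t)) ->
  smooth_curve atl (axis_curve c z i s).
Proof.
move=> cim t c' k c't; apply/near_derivable_mx => a j; rewrite ord1.
apply: (near_derivable_comp (F := fun r => chart c' (chart_inv c (z + r *: delta_mx 0 i)) 0 j)
  (G := fun u => step_fun u * s)).
  apply: (@near_derivable_partial R n k (overlap c c')
    (fun x => chart c' (chart_inv c x) 0 j) i z (step_fun t * s)).
  - exact: overlap_open.
  - exact: chart_smooth.
  - by apply/overlapE; split; [exact: cim|exact: c't].
apply: near_derivableM; last exact: near_derivable_cst.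
by have [+ _ _ _] := step_funP; apply.
Qed.

Lemma axis_line_start z i s t : t <= 4^-1 -> axis_line z i s t = z.
Proof. by move=> t4; have [_ _ h _] := step_funP; rewrite /axis_line h// mul0r scale0r addr0. Qed.

Lemma axis_line_end z i s t : 1 - 4^-1 <= t -> axis_line z i s t = z + s *: delta_mx 0 i.
Proof.
move=> t4; have [_ _ _ h] := step_funP; rewrite /axis_line h ?mul1r//.
by move: t4; lra.
Qed.

End AxisMoves.

(** * Joining points of a covering by smooth paths *)

Section CoveringPaths.
Context {R : realType} {n : nat} {M E : topologicalType} (atl : smooth_atlas R n M).
Context (p : E -> M) (p_cov : is_covering p).

Definition smoothly_joined (u u' : E) : Prop :=
  exists gamma : R -> E, stationary u u' gamma /\ smooth_curve atl (p \o gamma).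

Lemma smoothly_joined_refl u : smoothly_joined u u.
Proof.
by exists (fun=> u); split; [exact: stationary_cst|exact: smooth_curve_cst].
Qed.

Lemma smoothly_joined_trans u v w :
  smoothly_joined u v -> smoothly_joined v w -> smoothly_joined u w.
Proof.
move=> [g [sg mg]] [g' [sg' mg']]; exists (concat g g').
split; first exact: stationary_concat sg sg'.
rewrite concat_comp; have [cp _ _] := p_cov.
exact: smooth_curve_concat (stationary_comp cp sg) (stationary_comp cp sg') mg mg'.
Qed.

(** A coordinate box around u in the total space: [sigma] lifts the inverse chart, and [zeta]
    inverts it near u. Balls of the maximum norm are cubes, so changing coordinates one at a time
    between two points does not leave them. *)
Definition box_param (u : E) (c : chart_index atl) (z0 : 'rV[R]_n) (d : R)
    (sigma : 'rV[R]_n -> E) : Prop :=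
  [/\ 0 < d, (forall z, ball z0 d z -> chart_im c z),
      (forall z, ball z0 d z -> {for z, continuous sigma}),
      (forall z, ball z0 d z -> p (sigma z) = chart_inv c z) &
      exists zeta : E -> 'rV[R]_n, [/\ {for u, continuous zeta}, zeta u = z0 &
        \forall v \near u, ball z0 d (zeta v) /\ sigma (zeta v) = v]].

Lemma covering_section (x : M) (u : E) : p u = x -> exists (U : set M) (s : M -> E),
  [/\ open U, U x, forall y, U y -> {for y, continuous s},
      forall y, U y -> p (s y) = y & \forall v \near u, U (p v) /\ s (p v) = v].
Proof.
move=> pu; have [cp _ /(_ x)[U [oU Ux [I [V [oV _ pV Vs]]]]]] := p_cov.
have [i _ Viu] : (\bigcup_i V i) u by rewrite -pV /= pu.
have [s [[_ _ sp ps] [_ cs]]] := Vs i; exists U, s; split=> //.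
- move=> y Uy; move: cs; rewrite continuous_open_subspace// => cs.
  by apply: cs; exact/mem_set.
- have : \forall v \near u, V i v by apply: open_nbhs_nbhs.
  apply: filterS => v Viv; split; last exact: sp.
  have : (\bigcup_i V i) v by exists i.
  by rewrite -pV.
Qed.

Lemma box_paramP (u : E) : exists c z0 d sigma, box_param u c z0 d sigma.
Proof.
have [cp _ _] := p_cov.
have [U [s [oU Ux cs ps nu]]] := covering_section (erefl (p u)).
pose c := chart_at atl (p u); pose z0 := chart c (p u).
have cpu : chart_dom c (p u) by exact: chart_at_dom.
have z0K : chart_inv c z0 = p u by exact: chartK.
have z0im : chart_im c z0 by exact: chart_in.
have : \forall z \near z0, chart_im c z /\ U (chart_inv c z).
  apply: filterI; first by apply: open_nbhs_nbhs; split=> //; exact: chart_im_open.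
  apply: (chart_inv_continuous z0im); apply: open_nbhs_nbhs; split=> //.
  by rewrite z0K.
move=> /nbhs_ballP[d /= d0 dP].
exists c, z0, d, (s \o chart_inv c); split=> //.
- by move=> z /dP[].
- move=> z /dP[zim Uz]; apply: continuous_comp; first exact: chart_inv_continuous.
  exact: cs.
- by move=> z /dP[zim Uz] /=; rewrite ps.
- have cz : {for u, continuous (chart c \o p)}.
    by apply: continuous_comp; [exact: cp|exact: chart_continuous].
  exists (chart c \o p); split=> //.
  have h1 : \forall v \near u, ball z0 d (chart c (p v)).
    by apply: cz; exact: nbhsx_ballx.
  have h2 : \forall v \near u, chart_dom c (p v).
    by apply: cp; apply: open_nbhs_nbhs; split=> //; exact: chart_dom_open.
  apply: filterS2 (filterI h1 h2) nu => v [b1 b2] [b3 b4]; split=> //=.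
  by rewrite chartK.
Qed.

Lemma box_axis_move u c z0 d sigma z i s : box_param u c z0 d sigma ->
  ball z0 d z -> ball z0 d (z + s *: delta_mx 0 i) ->
  stationary (sigma z) (sigma (z + s *: delta_mx 0 i)) (sigma \o axis_line z i s) /\
  p \o (sigma \o axis_line z i s) = axis_curve c z i s.
Proof.
move=> [d0 zim cs ps _] zd zsd; have bl t := axis_line_ball t zd zsd.
split; last by apply/funext => t /=; rewrite ps.
split.
  by move=> t; apply: continuous_comp; [exact: axis_line_continuous|exact: cs].
exists 4^-1; split=> [|t t4|t t4] /=; first by rewrite invr_gt0.
  by rewrite axis_line_start.
by rewrite axis_line_end.
Qed.

Definition mixed_row (z z' : 'rV[R]_n) (k : nat) : 'rV[R]_n :=
  \row_j if (j < k)%N then z' 0 j else z 0 j.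

Lemma mixed_row_step z z' (i : 'I_n) :
  mixed_row z z' i.+1 = mixed_row z z' i + (z' 0 i - z 0 i) *: delta_mx 0 i.
Proof.
apply/rowP => j; rewrite !mxE/= ltnS leq_eqVlt.
have [->|ji] := eqVneq j i; first by rewrite eqxx ltnn/= mulr1 addrC subrK.
by rewrite mulr0 addr0 (negPf (_ : nat_of_ord j != i)).
Qed.

Lemma mixed_row0 z z' : mixed_row z z' 0 = z.
Proof. by apply/rowP => j; rewrite mxE. Qed.

Lemma mixed_row_max z z' : mixed_row z z' n = z'.
Proof. by apply/rowP => j; rewrite mxE ltn_ord. Qed.

Lemma mixed_row_ball z0 d z z' k : ball z0 d z -> ball z0 d z' -> ball z0 d (mixed_row z z' k).
Proof.
rewrite -!ball_normE/= => zd z'd; set m := Num.max `|z0 - z| `|z0 - z'|.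
apply: (@le_lt_trans _ _ m); last by rewrite gt_max zd.
apply: mx_norm_le => [|i j]; first by rewrite le_max normr_ge0.
rewrite !mxE ord1; case: ifP => _; rewrite le_max; apply/orP; [right|left].
  by have := mx_norm_coord (z0 - z') 0 j; rewrite !mxE.
by have := mx_norm_coord (z0 - z) 0 j; rewrite !mxE.
Qed.

Lemma box_joined u c z0 d sigma z z' : box_param u c z0 d sigma ->
  ball z0 d z -> ball z0 d z' -> smoothly_joined (sigma z) (sigma z').
Proof.
move=> bp zd z'd; rewrite -(mixed_row_max z z').
have [] : (n <= n)%N by []; move: {1 3}n => k.
elim: k => [_|k IH kn]; first by rewrite mixed_row0; exact: smoothly_joined_refl.
apply: smoothly_joined_trans (IH (ltnW kn)) _.
pose i := Ordinal kn; rewrite (mixed_row_step z z' i).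
have bk := mixed_row_ball k zd z'd.
have bk1 := mixed_row_ball k.+1 zd z'd; rewrite (mixed_row_step z z' i) in bk1.
have [sg pg] := box_axis_move bp bk bk1.
exists (sigma \o axis_line (mixed_row z z' k) i (z' 0 i - z 0 i)); split=> //.
rewrite pg; apply: smooth_axis_curve => t.
by have [_ + _ _ _] := bp; apply; exact: axis_line_ball.
Qed.

(** Both directions are recorded: the first shows that the points reachable from a given one form an
    open set, the second that they form a closed one. *)
Lemma smoothly_joined_near u : \forall v \near u, smoothly_joined u v /\ smoothly_joined v u.
Proof.
have [c [z0 [d [sigma bp]]]] := box_paramP u.
have [d0 _ _ _ [zeta [_ zu near_u]]] := bp.
have [_ su] := nbhs_singleton near_u; rewrite zu in su.
have z0d : ball z0 d z0 by exact: ballxx.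
apply: filterS near_u => v [vd sv]; rewrite -su -sv.
by split; exact: box_joined bp _ _.
Qed.

(** The points smoothly reachable from u form an open and closed set, which therefore contains the
    connected image of a path from u to v; that path itself is not smoothed. *)
Lemma path_connected_joined : path_connected (R := R) E ->
  forall u v, smoothly_joined u v.
Proof.
move=> pc u v; have [gamma [cg g0 g1]] := pc u v.
have conn : connected (gamma @` `[0, 1]).
  by apply: connected_continuous_connected => //; exact: segment_connected.
pose C := [set w | smoothly_joined u w].
have oC : open C.
  rewrite openE => w uw; apply: filterS (smoothly_joined_near w) => w' [ww' _].
  exact: smoothly_joined_trans uw ww'.
have cC : closed C.
  move=> w /(_ _ (smoothly_joined_near w))[w' [uw' [_ w'w]]].
  exact: smoothly_joined_trans uw' w'w.
have : (gamma @` `[0, 1]) `&` C = gamma @` `[0, 1].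
  apply: conn; [|by exists C|by exists C].
  exists u; split; last exact: smoothly_joined_refl.
  by exists 0 => //=; rewrite in_itv/= lexx ler01.
move=> /seteqP[_ /(_ v)[|//]].
by exists 1 => //=; rewrite in_itv/= lexx ler01.
Qed.

End CoveringPaths.

(** * Classes of paths in the abelian cover *)

Section PathClasses.
Context {R : realType}.
Implicit Types X Y : topologicalType.

Definition path_param (x : std_simplex R 1) : R := (val x : 'rV[R]_2) 0 ord_max.

Lemma path_param_itv (x : std_simplex R 1) : 0 <= path_param x <= 1.
Proof.
rewrite /path_param; case: x => x /= /set_mem[x0]; rewrite !big_ord_recl big_ord0 addr0.
have -> : fintype.lift ord0 ord0 = ord_max :> 'I_2 by apply/val_inj.
by move=> x1; have := x0 ord0; have := x0 ord_max; lra.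
Qed.

Lemma curve_segmentE X (g : continuousType R X) a b x :
  curve_segment g a b x = g (a * (1 - path_param x) + b * path_param x).
Proof.
rewrite /curve_segment/curve_simplex/= /affine_map !big_ord_recl big_ord0 addr0/=.
have E : fintype.lift ord0 ord0 = ord_max :> 'I_2 by apply/val_inj.
rewrite E /path_param; congr (g (a * _ + _)).
case: x => x /= /set_mem[_]; rewrite !big_ord_recl big_ord0 addr0 E => <-.
by rewrite addrK.
Qed.

Definition path_simplex X (g : continuousType R X) : simplex R 1 X := curve_segment g 0 1.

Lemma path_simplexE X (g : continuousType R X) x : path_simplex g x = g (path_param x).
Proof. by rewrite [LHS](curve_segmentE g 0 1 x) mul0r add0r mul1r. Qed.

Lemma path_of_simplex X (g : continuousType R X) t : t \in `[0, 1] ->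
  path_of (path_simplex g) t = g t.
Proof.
rewrite in_itv/= => /andP[t0 t1].
apply: etrans (path_simplexE _ _) _; rewrite /path_param.
rewrite insubdK ?mxE//.
apply/mem_set; split=> [i|]; first by rewrite mxE; case: ifP => _; rewrite ?subr_ge0.
by rewrite !big_ord_recl big_ord0 !mxE/= addr0 subrK.
Qed.

Lemma concat_homologous X (x y z : X) (g1 g2 g : continuousType R X) :
  stationary x y g1 -> stationary y z g2 -> g =1 concat g1 g2 ->
  homologous << path_simplex g >> (<< path_simplex g1 >> + << path_simplex g2 >>).
Proof.
move=> s1 s2 gE; have := curve_segment_add g 0 2^-1 1.
have -> : curve_segment g 0 2^-1 = path_simplex g1.
  apply/continuousEP => v; rewrite path_simplexE curve_segmentE gE mul0r add0r.
  have /andP[t0 t1] := path_param_itv v.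
  rewrite /concat ifT; last by lra.
  by rewrite mulrA divff// mul1r.
have -> // : curve_segment g 2^-1 1 = path_simplex g2.
apply/continuousEP => v; rewrite path_simplexE curve_segmentE gE.
have /andP[t0 t1] := path_param_itv v.
rewrite /concat; case: ifPn => [t2|_].
  have {t1 t2}t0' : path_param v = 0 by lra.
  rewrite t0' subr0 mulr0 addr0 mulr1 divff// (stationary1 s1).
  by rewrite (stationary0 s2).
by congr (g2 _); lra.
Qed.

End PathClasses.

(** * Integrals over chains *)

Section ChainIntegrals.
Context {R : realType} {X : topologicalType} (f : simplex R 1 X -> R).

(** Spelled as the sum in [deRham_pairing], so that the hypothesis on the periods applies directly.
    Additivity follows by summing over a common list of simplices, with coefficient 0 outside the
    domain. *)
Definition chain_sum (c : chain (R := R) 1 X) : R := \sum_(s <- dom c) (coeff s c)%:~R * f s.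

Lemma chain_sum_widen (l : seq (simplex R 1 X)) c : uniq l -> {subset dom c <= l} ->
  chain_sum c = \sum_(s <- l) (coeff s c)%:~R * f s.
Proof.
move=> ul dl; rewrite (bigID (mem (dom c)))/= [X in _ + X]big1 ?addr0.
  rewrite -big_filter; apply: perm_big; apply: uniq_perm.
  - exact: uniq_dom.
  - exact: filter_uniq.
  - move=> s; rewrite mem_filter; apply/idP/andP => [sd|[]//].
    by split=> //; exact: dl.
by move=> s sd; rewrite coeff_outdom// mul0r.
Qed.

Lemma chain_sumB c d : chain_sum (c - d) = chain_sum c - chain_sum d.
Proof.
pose l := undup (dom c ++ dom d).
have lc : {subset dom c <= l} by move=> s sc; rewrite mem_undup mem_cat sc.
have ld : {subset dom d <= l} by move=> s sc; rewrite mem_undup mem_cat sc orbT.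
have lcd : {subset dom (c - d) <= l} by move=> s /domB; rewrite mem_undup.
rewrite !(@chain_sum_widen l) ?undup_uniq// -sumrB; apply: eq_bigr => s _.
by rewrite coeffB intrB mulrBl.
Qed.

HB.instance Definition _ := GRing.isZmodMorphism.Build (chain (R := R) 1 X) R chain_sum chain_sumB.

Lemma chain_sumU s : chain_sum << s >> = f s.
Proof. by rewrite /chain_sum domU1 big_seq1 coeffU eqxx mulr1 mul1r. Qed.

End ChainIntegrals.

Section SupportedChains.
Context {R : realType} {X : topologicalType} (P : simplex R 1 X -> Prop).

Definition supported (c : chain (R := R) 1 X) : Prop := {in dom c, forall s, P s}.

Lemma supportedB c d : supported c -> supported d -> supported (c - d).
Proof. by move=> Pc Pd s /domB; rewrite mem_cat => /orP[/Pc|/Pd]. Qed.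

Lemma supported0 : supported 0.
Proof. by move=> s; rewrite dom0. Qed.

Lemma supportedN c : supported c -> supported (- c).
Proof. by rewrite -sub0r; apply: supportedB; exact: supported0. Qed.

Lemma supportedD c d : supported c -> supported d -> supported (c + d).
Proof. by move=> Pc Pd; rewrite -[d]opprK; apply: supportedB => //; exact: supportedN. Qed.

Lemma supportedMz c (k : int) : supported c -> supported (c *~ k).
Proof.
move=> Pc; have Pn m : supported (c *+ m).
  elim: m => [|m IH]; first by rewrite mulr0n; exact: supported0.
  by rewrite mulrS; exact: supportedD.
case: k => m; first by rewrite -pmulrn.
by rewrite NegzE mulrNz -pmulrn; exact: supportedN.
Qed.

Lemma supportedU s : P s -> supported << s >>.
Proof. by move=> Ps u; rewrite domU1 inE => /eqP ->. Qed.

Lemma supported_sum (I : finType) (F : I -> chain (R := R) 1 X) :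
  (forall i, supported (F i)) -> supported (\sum_i F i).
Proof.
move=> PF; apply: (big_ind supported) => [|c d|i _]; [exact: supported0|exact: supportedD|exact: PF].
Qed.

End SupportedChains.

(** * Displacement of the integration map along paths and fibres *)

Section AbelianCover.
Context {R : realType} {n b : nat} {M : topologicalType} {atl : smooth_atlas R n M}.
Context (Gamma : 'I_b -> chain (R := R) 1 M) (Gamma_basis : homology_basis Gamma).
Context (f : continuousType M M) (A : 'M[int]_b) (f_A : induced_matrix f Gamma A).
Context (Ma : topologicalType) (pi : continuousType Ma M).
Context (delta : 'cV[int]_b -> Ma -> Ma) (delta_deck : deck_action pi Gamma delta).
Context (ft : continuousType Ma Ma) (ft_lift : pi \o ft = f \o pi).
Context (omega : 'I_b -> one_form atl).
Context (omega_dual : forall i j, deRham_pairing (omega i) (Gamma j) (i == j)%:R).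
Context (x0 : Ma) (iotat : Ma -> 'cV[R]_b).
Context (iotat_int : integration_map pi omega x0 iotat).
Context (joined : forall x y : Ma, exists gamma : continuousType R Ma,
  stationary x y gamma /\ smooth_curve atl (pi \o gamma)).
Context (i0 : 'I_b).

Let cl (gamma : continuousType R Ma) : chain (R := R) 1 M :=
  << path_simplex (pi \o gamma : continuousType R M) >>.

Lemma smooth_curve_path (g : continuousType R M) :
  smooth_curve atl g -> smooth_path atl (path_simplex g).
Proof.
move=> sg; exists g, 1; split=> [|t t01|t _]; first exact: ltr01.
  by rewrite path_of_simplex.
split; first exact: cts_fun.
by move=> c k ct; apply: near_derivable_derive1n => l; exact: sg.
Qed.

Lemma concat_cts (x y z : Ma) (g1 g2 : continuousType R Ma) :
  stationary x y g1 -> stationary y z g2 -> exists g : continuousType R Ma,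
  [/\ stationary x z g, g =1 concat g1 g2 & homologous (cl g) (cl g1 + cl g2)].
Proof.
move=> s1 s2; have s12 := stationary_concat s1 s2.
exists (mkcts s12.1); split=> //.
apply: (concat_homologous (stationary_comp (@cts_fun _ _ pi) s1)
  (stationary_comp (@cts_fun _ _ pi) s2)) => t.
by rewrite -concat_comp.
Qed.

Lemma deck_class v (x : Ma) (gamma : continuousType R Ma) :
  stationary x (delta v x) gamma -> homologous (cl gamma) (int_comb Gamma v).
Proof.
move=> sg; have [_ /(_ (path_simplex gamma))] := delta_deck v.
rewrite /path_simplex curve_segment_vertex0 curve_segment_vertex1.
rewrite (stationary0 sg) (stationary1 sg) => /(_ erefl).
suff -> : << (pi \o curve_segment gamma 0 1 : simplex R 1 M) >> = cl gamma by [].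
by congr (<< _ >>); apply/continuousEP.
Qed.

(* Append to both paths the same path from y to a translate of x. *)
Lemma same_ends_homologous (x y : Ma) (g g' : continuousType R Ma) :
  stationary x y g -> stationary x y g' -> homologous (cl g) (cl g').
Proof.
move=> sg sg'; have [h [sh _]] := joined y (delta 0 x).
have [k [sk _ gh]] := concat_cts sg sh; have [k' [sk' _ gh']] := concat_cts sg' sh.
have kk' := homologous_trans (deck_class sk) (homologous_sym (deck_class sk')).
have := homologous_trans (homologous_sym gh) (homologous_trans kk' gh').
move=> /homologousD/(_ (homologous_refl (- cl h))).
by rewrite !addrK.
Qed.

(** The cycles [Gamma j] need not be smooth; the projection of a smooth path from [x0] to its
    translate is a smooth representative. *)
Lemma deck_base j : exists g : continuousType R Ma,
  [/\ stationary x0 (delta (delta_mx j 0) x0) g, smooth_curve atl (pi \o g) &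
      homologous (cl g) (Gamma j)].
Proof.
have [g [sg mg]] := joined x0 (delta (delta_mx j 0) x0); exists g; split=> //.
have := deck_class sg; suff -> : int_comb Gamma (delta_mx j 0) = Gamma j by [].
rewrite /int_comb (bigD1 j)//= mxE !eqxx mulr1z big1 ?addr0// => i /negPf ij.
by rewrite mxE ij mulr0z.
Qed.

Let smooth_chain := supported (smooth_path atl).

Lemma smooth_cl (g : continuousType R Ma) : smooth_curve atl (pi \o g) -> smooth_chain (cl g).
Proof.
move=> sg; apply: supportedU.
exact: (@smooth_curve_path (pi \o g : continuousType R M)).
Qed.

Let integral i := chain_sum (line_integral (omega i)).

Lemma integral_dual i j c : smooth_chain c -> homologous c (Gamma j) ->
  integral i c = (i == j)%:R.
Proof. by move=> sc cG; exact: omega_dual cG. Qed.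

(** [omega_dual] prescribes the integral of every smooth chain homologous to [Gamma i0]. A smooth
    representative and its sum with c are both such chains, so c contributes 0. *)
Lemma integral_null i c : smooth_chain c -> homologous c 0 -> integral i c = 0.
Proof.
move=> sc c0; have [g [sg mg gG]] := deck_base i0.
have := integral_dual i (smooth_cl mg) gG.
have : integral i (c + cl g) = (i == i0)%:R.
  apply: integral_dual; first exact: supportedD sc (smooth_cl mg).
  by have := homologousD c0 gG; rewrite add0r.
by rewrite /integral raddfD/= => + E; rewrite E => /eqP; rewrite -subr_eq0 addrK => /eqP.
Qed.

Lemma integral_homologous i c d : smooth_chain c -> smooth_chain d -> homologous c d ->
  integral i c = integral i d.
Proof.
move=> sc sd cd; apply/eqP; rewrite -subr_eq0 -[_ - _](raddfB (chain_sum _))/=.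
apply/eqP/integral_null; first exact: supportedB.
by have := homologousD cd (homologous_refl (- d)); rewrite subrr.
Qed.

Lemma integral_int_comb i v c : smooth_chain c -> homologous c (int_comb Gamma v) ->
  integral i c = (v i 0)%:~R.
Proof.
move=> sc cv; have /choice[s sP] := deck_base.
have sm j : smooth_chain (cl (s j) *~ v j 0).
  by apply: supportedMz; apply: smooth_cl; have [] := sP j.
rewrite (@integral_homologous i c (\sum_j cl (s j) *~ v j 0)) => //.
- have Is j : chain_sum (line_integral (omega i)) (cl (s j)) = (i == j)%:R.
    by apply: integral_dual; [apply: smooth_cl|]; have [] := sP j.
  rewrite /integral raddf_sum/= (bigD1 i)//= big1 => [|j /negPf ji].
    by rewrite addr0 raddfMz/= Is eqxx.
  by rewrite raddfMz/= Is eq_sym ji mul0rz.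
- exact: supported_sum.
- apply: homologous_trans cv _; apply: homologous_sym; apply: homologous_sum => j.
  by apply: homologousMz; have [] := sP j.
Qed.

(** The definition of [iotat] speaks of paths from [x0], so g is preceded by a path from [x0] to x.
    The integral over the concatenation splits because its chain is homologous to the sum of the
    two. *)
Lemma iotat_path (x y : Ma) (g : continuousType R Ma) :
  stationary x y g -> smooth_curve atl (pi \o g) ->
  iotat y - iotat x = \col_i line_integral (omega i) (path_simplex (pi \o g : continuousType R M)).
Proof.
have iotatE z (h : continuousType R Ma) : stationary x0 z h -> smooth_curve atl (pi \o h) ->
    iotat z = \col_i integral i (cl h).
  move=> sh mh; have E : (pi \o path_simplex h : simplex R 1 M) = path_simplex (pi \o h : continuousType R M).
    by apply/continuousEP.
  rewrite (@iotat_int z (path_simplex h)) ?E.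
  - by apply/colP => i; rewrite !mxE /integral /cl chain_sumU.
  - exact: smooth_curve_path.
  - by rewrite /path_simplex curve_segment_vertex0 (stationary0 sh).
  - by rewrite /path_simplex curve_segment_vertex1 (stationary1 sh).
move=> sg mg; have [h [sh mh]] := joined x0 x.
have [k [sk kE hg]] := concat_cts sh sg.
have mk : smooth_curve atl (pi \o k).
  rewrite (_ : k = concat h g :> (R -> Ma)); last exact/funext.
  rewrite concat_comp.
  exact: (smooth_curve_concat (stationary_comp (@cts_fun _ _ pi) sh)
    (stationary_comp (@cts_fun _ _ pi) sg) mh mg).
rewrite (iotatE _ _ sk mk) (iotatE _ _ sh mh); apply/colP => i; rewrite !mxE.
rewrite (@integral_homologous i (cl k) (cl h + cl g))//; [|exact: smooth_cl|].
  by rewrite /integral raddfD/= addrC addKr chain_sumU.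
by apply: supportedD; exact: smooth_cl.
Qed.

(** The path g may fail to be smooth; a smooth path with the same ends has the same class, and its
    integrals read off v. *)
Lemma iotat_class (x y : Ma) (g : continuousType R Ma) v :
  stationary x y g -> homologous (cl g) (int_comb Gamma v) ->
  iotat y = iotat x + map_mx intr v.
Proof.
move=> sg gv; have [h [sh mh]] := joined x y.
have hv := homologous_trans (same_ends_homologous sh sg) gv.
apply/eqP; rewrite addrC -subr_eq (iotat_path sh mh); apply/eqP/colP => i; rewrite !mxE.
by rewrite -(integral_int_comb i (smooth_cl mh) hv) /integral chain_sumU.
Qed.

Lemma iotat_delta v x : iotat (delta v x) = iotat x + map_mx intr v.
Proof.
have [g [sg _]] := joined x (delta v x); exact: iotat_class sg (deck_class sg).
Qed.

Lemma iotat_fiber (x y : Ma) : pi x = pi y -> exists v : 'cV[int]_b,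
  iotat y = iotat x + map_mx intr v /\
  iotat (ft y) = iotat (ft x) + map_mx intr (A *m v).
Proof.
move=> xy; have [g [sg mg]] := joined x y.
have cyc : is_cycle (cl g).
  by apply: curve_segment_cycle; rewrite /= (stationary0 sg) (stationary1 sg).
have [_ /(_ _ cyc)[v [gv _]]] := Gamma_basis; exists v; split; first exact: iotat_class sg gv.
have sft := stationary_comp (@cts_fun _ _ ft) sg.
apply: (@iotat_class _ _ (ft \o g : continuousType R Ma)) sft _.
(* As [ft] lifts [f], the image of the path projects to the image of the cycle under [f], whose
   class is A v. *)
have -> : cl (ft \o g : continuousType R Ma) = push f (cl g).
  rewrite /cl pushU; congr (<< _ >>); apply/continuousEP => t.
  apply: etrans (path_simplexE _ _) _.
  apply: etrans (congr1 (fun h : Ma -> M => h (g (path_param t))) ft_lift) _.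
  apply: (congr1 (f : M -> M)); apply: esym.
  exact: path_simplexE (pi \o g : continuousType R M) t.
apply: homologous_trans (homologous_push f gv) _.
rewrite /int_comb raddf_sum/=.
apply: homologous_trans (homologous_sum (G := fun j => int_comb Gamma (col j A) *~ v j 0) _) _.
  by move=> j; rewrite raddfMz/=; exact/homologousMz/f_A.
suff -> : \sum_j int_comb Gamma (col j A) *~ v j 0 = int_comb Gamma (A *m v).
  exact: homologous_refl.
under eq_bigr do rewrite mulrz_suml.
rewrite exchange_big/=; apply: eq_bigr => k _; rewrite mxE mulrz_sumr.
by apply: eq_bigr => j _; rewrite mxE -mulrzA.
Qed.
End AbelianCover.

(** * Line integrals and continuity of the integration map *)

Section LineIntegralBound.
Context {R : realType}.
Local Notation mu := (@lebesgue_measure R).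

(** The integrand h is controlled on the open interval only: at 0 and 1 the derivative in
    [line_integral] sees values of [path_of] outside [0, 1]. F is its continuous replacement. *)
Lemma Rintegral_bound (h F : R -> R) (B : R) : continuous F ->
  {in `]0, 1[, h =1 F} -> (forall t, t \in `[0, 1] -> `|F t| <= B) ->
  `|\int[mu]_(t in `[0, 1]) h t| <= B.
Proof.
move=> cF hF FB.
have mF D : measurable D -> measurable_fun D F.
  by move=> mD; apply: subspace_continuous_measurable_fun => //; exact: continuous_subspaceT.
have mh : measurable_fun (`]0, 1[%classic : set R) h.
  by apply: eq_measurable_fun (mF _ (measurable_itv _)) => t /set_mem/hF ->.
have -> : \int[mu]_(t in `[0, 1]) h t = \int[mu]_(t in `[0, 1]) F t.
  rewrite /Rintegral; congr fine; apply: eq_integral_itv_bounded => //.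
  exact: mF.
have cF01 : {within `[0, 1], continuous F} by exact: continuous_subspaceT.
have iF : mu.-integrable `[0, 1] (EFin \o F).
  by apply: continuous_compact_integrable => //; exact: segment_compact.
have iN : mu.-integrable `[0, 1] (EFin \o (fun t => `|F t|)).
  apply: continuous_compact_integrable; first exact: segment_compact.
  apply: continuous_subspaceT => t; apply: continuous_comp; first exact: cF.
  exact: norm_continuous.
have iB : mu.-integrable `[0, 1] (EFin \o (fun=> B)).
  apply: continuous_compact_integrable; first exact: segment_compact.
  by apply: continuous_subspaceT; exact: cst_continuous.
apply: le_trans (le_normr_Rintegral _ iF) _ => //.
apply: le_trans (le_Rintegral _ iN iB _) _ => //.
rewrite Rintegral_cst//= lebesgue_measure_itv/= lte_fin ltr01 oppr0 adde0 mulr1.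
by [].
Qed.

Context {n : nat} {M : topologicalType} {atl : smooth_atlas R n M}.

Lemma transition_differentiable (c c' : chart_index atl) z : overlap c c' z ->
  differentiable (transition c c' : 'rV[R]_n -> 'rV[R]_n) z.
Proof.
move=> zo.
have dj j : differentiable (fun x => transition c c' x 0 j : R^o) z.
  apply: (@Ck1_differentiable R n (overlap c c')) => //; first exact: overlap_open.
  exact: (@chart_smooth _ _ _ atl c c' j 1%N).
rewrite (_ : transition c c' =
    \sum_(j < n) (fun x => (transition c c' x 0 j : R) *: (delta_mx 0 j : 'rV[R]_n))).
  by apply: differentiable_sum => j; exact: differentiableZl.
by apply/funext => x; rewrite fct_sumE [LHS]row_sum_delta.
Qed.

Lemma form_continuous (w : one_form atl) c i z : chart_im c z ->
  {for z, continuous (fun x => w c x i 0)}.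
Proof. by move=> cz; have [+ _] := form_smooth w c i 0%N; apply. Qed.

Lemma is_derive_axis_line (z : 'rV[R]_n) (i : 'I_n) (s t : R) :
  is_derive t 1 (axis_line z i s) ((step_fun^`()%classic t * s) *: delta_mx 0 i).
Proof.
have dj (a : 'I_1) j : is_derive t 1 (fun t => axis_line z i s t a j)
    (step_fun^`()%classic t * s * (delta_mx 0 i : 'rV[R]_n) a j).
  have dst : is_derive t 1 (@step_fun R) (step_fun^`()%classic t).
    by rewrite derive1E; exact/derivableP/step_fun_derivable.
  rewrite (_ : (fun _ => _) = (fun=> z a j) + (fun t => (s * (delta_mx 0 i : 'rV[R]_n) a j) *: step_fun t)); last first.
    by apply/funext => u; rewrite !mxE/= !fctE /GRing.scale/=; ring.
  have dsum := is_deriveD (is_derive_cst (z a j) t (1 : R)) (is_deriveZ (s * (delta_mx 0 i : 'rV[R]_n) a j) dst).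
  apply: is_derive_eq dsum _; rewrite add0r /GRing.scale/=; ring.
have dl : derivable (axis_line z i s) t 1 by apply/derivable_mxP => a j; have [] := dj a j.
split=> //; rewrite derive_mx//; apply/matrixP => a j; rewrite !mxE.
by have [_ ->] := dj a j; rewrite !mxE.
Qed.

(** [line_integral] chooses a chart anew at each point of the path. The transformation law of w and
    the chain rule bring the integrand back to the fixed chart c, where the velocity points along
    the axis i. *)
Lemma axis_curve_pullback (w : one_form atl) (c c' : chart_index atl) z i s t :
  chart_im c (axis_line z i s t) -> chart_dom c' (axis_curve c z i s t) ->
  (derive1 (chart c' \o axis_curve c z i s) t *m w c' (chart c' (axis_curve c z i s t))) 0 0 =
  step_fun^`()%classic t * s * w c (axis_line z i s t) i 0.
Proof.
move=> cim c't; have xo : overlap c c' (axis_line z i s t) by exact/overlapE.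
have dT := transition_differentiable xo.
have [dl dlE] := is_derive_axis_line z i s t.
have -> : derive1 (chart c' \o axis_curve c z i s) t =
    (step_fun^`()%classic t * s) *: (delta_mx 0 i *m 'J (transition c c') (axis_line z i s t)).
  rewrite -[chart c' \o _]/(transition c c' \o axis_line z i s).
  have dl' : differentiable (axis_line z i s) t by exact/derivable1_diffP.
  rewrite derive1E'; last exact: differentiable_comp.
  rewrite diff_comp//= -(derive1E' dl') derive1E dlE linearZ/=; congr (_ *: _).
  by rewrite /jacobian mul_rV_lin1.
rewrite -scalemxAl mxE -mulmxA.
rewrite -[chart c' (axis_curve c z i s t)]/(transition c c' (axis_line z i s t)).
rewrite -(form_transition w xo); congr (_ * _).
by rewrite -rowE mxE.
Qed.

Lemma line_integral_axis (w : one_form atl) (c : chart_index atl) z i s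
    (g : continuousType R M) (B D : R) :
  (forall t, chart_im c (axis_line z i s t)) -> g =1 axis_curve c z i s ->
  (forall t, `|w c (axis_line z i s t) i 0| <= B) ->
  (forall t, t \in `[0, 1] -> `|step_fun^`()%classic t| <= D) ->
  `|line_integral w (path_simplex g)| <= D * `|s| * B.
Proof.
move=> cim gE wB sD.
apply: (Rintegral_bound (F := fun t => step_fun^`()%classic t * s * w c (axis_line z i s t) i 0)).
- move=> t; apply: cvgM; last first.
    apply: (@continuous_comp _ _ _ (axis_line z i s) (fun x => w c x i 0)).
      exact: axis_line_continuous.
    exact: form_continuous.
  apply: cvgMl; have [/(_ 2%N t)[_ [/nbhs_singleton + _]] _ _ _] := @step_funP R.
  by move=> /derivable1_diffP/differentiable_continuous.
- move=> t t01.
  (* The derivative depends on a whole neighbourhood of t, and [path_of] follows the curve on [0, 1]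
     only; t is interior. *)
  have near_path : \forall u \near t, path_of (path_simplex g) u = axis_curve c z i s u.
    have : \forall u \near t, u \in `]0, 1[.
      by apply: near_in_itvoo.
    by apply: filterS => u u01; rewrite path_of_simplex// subset_itv_oo_cc.
  cbv beta zeta; rewrite (nbhs_singleton near_path).
  set c' := chart_at atl _.
  have c't : chart_dom c' (axis_curve c z i s t) by exact: chart_at_dom.
  have dE : derive1 (chart c' \o path_of (path_simplex g)) t =
      derive1 (chart c' \o axis_curve c z i s) t.
    rewrite !derive1E; apply: near_eq_derive.
    by apply: filterS near_path => u /= ->.
  by rewrite dE (axis_curve_pullback w (cim t) c't).
- move=> t t01; rewrite !normrM ler_pM//.
  by rewrite ler_wpM2r// sD.
Qed.

End LineIntegralBound.

Lemma quotient_map_continuous (X Y Z : topologicalType) (q : X -> Y) (h : Y -> Z) :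
  quotient_map q -> continuous (h \o q) -> continuous h.
Proof. by move=> [_ qP] /continuousP hq; apply/continuousP => V /hq; rewrite comp_preimage => /qP. Qed.

(** * Continuity of the integration map *)

Section IntegrationMapContinuity.
Context {R : realType} {n b : nat} {M : topologicalType} {atl : smooth_atlas R n M}.
Context (Ma : topologicalType) (pi : continuousType Ma M).
Context (omega : 'I_b -> one_form atl) (iotat : Ma -> 'cV[R]_b).
Context (iotat_path : forall (x y : Ma) (g : continuousType R Ma),
  stationary x y g -> smooth_curve atl (pi \o g) ->
  iotat y - iotat x =
    \col_i line_integral (omega i) (path_simplex (pi \o g : continuousType R M))).
Context (U : topologicalType) (q : U -> Ma) (q_quot : quotient_map q).
Context (p_cov : is_covering (pi \o q)).

Lemma step_fun_derive_bound : exists2 D : R, 0 <= D &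
  forall t, t \in `[0, 1] -> `|(@step_fun R)^`()%classic t| <= D.
Proof.
have cs : continuous (fun t => `|(@step_fun R)^`()%classic t|).
  move=> t; apply: continuous_comp; last exact: norm_continuous.
  have [/(_ 2%N t)[_ [/nbhs_singleton + _]] _ _ _] := @step_funP R.
  by move=> /derivable1_diffP/differentiable_continuous.
have [c _ cmax] := EVT_max (@ler01 R) (continuous_subspaceT cs).
by exists `|(@step_fun R)^`()%classic c|.
Qed.

Lemma q_continuous : continuous q.
Proof. by apply/continuousP => V oV; apply/q_quot.2. Qed.

(** A Lipschitz estimate at the centre of a box: from z0 to z one coordinate at a time, each axis
    move contributes at most D B |z - z0|, where D bounds the speed of [step_fun] and B the
    coefficients of the forms. *)
Lemma iotat_box (u : U) : exists c z0 d sigma, box_param (atl := atl) (pi \o q) u c z0 d sigma /\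
  exists C : R, 0 <= C /\ forall z, ball z0 d z ->
    `|iotat (q (sigma z)) - iotat (q (sigma z0))| <= C * `|z - z0|.
Proof.
have [c [z0 [d0 [sigma [d00 zim cs ps [zeta [cz zu nu]]]]]]] := box_paramP atl p_cov u.
have z0im : chart_im c z0 by apply: zim; exact: ballxx.
have [B [B0 nB]] : exists B : R, 0 <= B /\
    \forall z \near z0, forall (a : 'I_b) (i : 'I_n), `|omega a c z i 0| <= B.
  (* Exceeds the absolute value of each coefficient at z0 by at least 1, hence bounds all of them
     near z0. *)
  pose B := \sum_a \sum_i (`|omega a c z0 i 0| + 1).
  have B1 a i : `|omega a c z0 i 0| + 1 <= B.
    rewrite /B (bigD1 a)//= (bigD1 i)//= -addrA lerDl addr_ge0//.
      by apply: sumr_ge0 => ? _; rewrite addr_ge0.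
    by apply: sumr_ge0 => ? _; apply: sumr_ge0 => ? _; rewrite addr_ge0.
  exists B; split.
    by apply: sumr_ge0 => ? _; apply: sumr_ge0 => ? _; rewrite addr_ge0.
  apply: (@filter_forall _ _ _ (nbhs z0)) => a; apply: (@filter_forall _ _ _ (nbhs z0)) => i.
  have /cvgrPdist_le/(_ 1 ltr01) := @form_continuous _ _ _ _ (omega a) c i z0 z0im.
  apply: filterS => z; rewrite distrC => h; apply: le_trans (B1 a i).
  by rewrite -lerBlDl (le_trans (lerB_dist _ _)).
move/nbhs_ballP: nB => [d1 /= d10 d1P].
pose d := Num.min d0 d1; have d_gt0 : 0 < d by rewrite lt_min d00.
have dd0 z : ball z0 d z -> ball z0 d0 z.
  by apply: le_ball; rewrite ge_min lexx.
have dd1 z : ball z0 d z -> ball z0 d1 z.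
  by apply: le_ball; rewrite ge_min lexx orbT.
have bp : box_param (atl := atl) (pi \o q) u c z0 d sigma.
  split=> // [z /dd0/zim//|z /dd0/cs//|z /dd0/ps//|].
  exists zeta; split=> //.
  have h1 : \forall v \near u, ball z0 d (zeta v).
    by apply: cz; rewrite zu; exact: nbhsx_ballx.
  by apply: filterS2 h1 nu => v ? [].
exists c, z0, d, sigma; split=> //.
have [D D0 DP] := step_fun_derive_bound.
exists (n%:R * (D * B)); split; first by rewrite !mulr_ge0.
move=> z zd; have z0d : ball z0 d z0 by exact: ballxx.
suff tele k : (k <= n)%N ->
    `|iotat (q (sigma (mixed_row z0 z k))) - iotat (q (sigma z0))| <= k%:R * (D * B) * `|z - z0|.
  by have := tele n (leqnn n); rewrite mixed_row_max.
elim: k => [_|k IH kn]; first by rewrite mixed_row0 subrr normr0 !mul0r.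
pose i := Ordinal kn; pose s := z 0 i - z0 0 i.
have bk := mixed_row_ball k z0d zd.
have bk1 := mixed_row_ball k.+1 z0d zd; rewrite (mixed_row_step z0 z i) in bk1.
have [sg pg] := box_axis_move bp bk bk1.
have sqg := stationary_comp q_continuous sg.
pose g : continuousType R Ma := mkcts sqg.1.
have bl t : ball z0 d (axis_line (mixed_row z0 z k) i s t) by exact: axis_line_ball.
have limb t : chart_im c (axis_line (mixed_row z0 z k) i s t) by exact/zim/dd0.
have gE : (pi \o g) = axis_curve c (mixed_row z0 z k) i s by [].
have mg : smooth_curve atl (pi \o g).
  by rewrite gE; exact: smooth_axis_curve.
have inc := iotat_path (g := g) sqg mg.
rewrite (mixed_row_step z0 z i) -/s.
rewrite -(subrKA (iotat (q (sigma (mixed_row z0 z k))))).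
rewrite (le_trans (ler_normD _ _))// -[k.+1%:R]natr1 !mulrDl [leRHS]addrC mul1r.
apply: lerD; last exact: IH (ltnW kn).
rewrite inc; apply: mx_norm_le => [|a j]; first by rewrite !mulr_ge0.
rewrite mxE; apply: (@le_trans _ _ (D * `|s| * B)).
  apply: (line_integral_axis (c := c) (z := mixed_row z0 z k) (i := i)) => //.
    by move=> t; rewrite -gE.
  by move=> t; apply: d1P; exact: dd1.
rewrite mulrAC; apply: ler_wpM2l; first by rewrite mulr_ge0.
by have := mx_norm_coord (z - z0) 0 i; rewrite !mxE.
Qed.

(** Tested on U, as [q] is a quotient map: there the boxes of the covering [pi \o q] give a
    Lipschitz estimate at each point. *)
Lemma iotat_continuous : continuous iotat.
Proof.
apply: (quotient_map_continuous q_quot) => u.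
have [c [z0 [d [sigma [[d0 _ _ _ [zeta [cz zu nu]]] [C [C0 CP]]]]]]] := iotat_box u.
apply/cvgrPdist_lt => e e0.
have C1 : 0 < C + 1 by rewrite ltr_wpDl.
have near_z : \forall v \near u, `|zeta v - z0| < e / (C + 1).
  have /cvgrPdist_lt/(_ (e / (C + 1)) (divr_gt0 e0 C1)) := cz.
  by apply: filterS => v; rewrite zu distrC.
have [_ su] := nbhs_singleton nu.
apply: filterS2 nu near_z => v [bv sv] vz /=.
rewrite distrC -su -sv zu; apply: le_lt_trans (CP _ bv) _.
apply: (@le_lt_trans _ _ ((C + 1) * `|zeta v - z0|)).
  by apply: ler_wpM2r => //; rewrite lerDl.
by rewrite mulrC -ltr_pdivlMr.
Qed.

End IntegrationMapContinuity.

(** * Shadowing *)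

Section Shadowing.
Context {R : realType}.

Lemma geometric_small (rho c : R) : 0 < rho -> rho < 1 -> 0 <= c ->
  forall e, 0 < e -> exists N : nat, c * rho ^+ N < e.
Proof.
move=> r0 r1 c0 e e0.
have h : (fun N => c * rho ^+ N) @ \oo --> (c * 0 : R).
  by apply: cvgMr; apply: cvg_expr; rewrite ger0_norm// ltW.
move: h; rewrite mulr0 => /cvgrPdist_lt/(_ e e0)[N _ /(_ N)/= /(_ (leqnn N))].
by rewrite sub0r normrN => h; exists N; exact: le_lt_trans (ler_norm _) h.
Qed.

Lemma geometric_eq0 (V : normedModType R) (rho c : R) (v : V) :
  0 < rho -> rho < 1 -> 0 <= c -> (forall N, `|v| <= c * rho ^+ N) -> v = 0.
Proof.
move=> r0 r1 c0 vN; apply/eqP; rewrite -normr_eq0 eq_le normr_ge0 andbT leNgt.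
apply/negP => v0; have [N] := geometric_small r0 r1 c0 v0.
by rewrite ltNge vN.
Qed.

(* The intervals [u_N - d_N, u_N + d_N], d_N = c rho^N / (1 - rho), are nested. *)
Lemma geometric_limit (rho c : R) (u : nat -> R) :
  0 < rho -> rho < 1 -> 0 <= c -> (forall N, `|u N.+1 - u N| <= c * rho ^+ N) ->
  exists l, forall N, `|l - u N| <= c / (1 - rho) * rho ^+ N.
Proof.
move=> r0 r1 c0 uN; set d := fun N => c / (1 - rho) * rho ^+ N.
have r1' : 1 - rho != 0 by rewrite subr_eq0 gt_eqF.
have dS N : d N = d N.+1 + c * rho ^+ N by rewrite /d exprS; field.
have d0 N : 0 <= d N by rewrite /d mulr_ge0 ?exprn_ge0 ?divr_ge0 ?subr_ge0// ltW.
have step N : u N - d N <= u N.+1 - d N.+1 /\ u N.+1 + d N.+1 <= u N + d N.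
  by have := uN N; rewrite dS ler_norml => /andP[h1 h2]; split; lra.
have lo N k : u N - d N <= u (N + k)%N - d (N + k)%N.
  elim: k => [|k IH]; first by rewrite addn0.
  by rewrite addnS (le_trans IH)//; exact: (step _).1.
have hi N k : u (N + k)%N + d (N + k)%N <= u N + d N.
  elim: k => [|k IH]; first by rewrite addn0.
  by rewrite addnS (le_trans _ IH)//; exact: (step _).2.
have lohi N m : u N - d N <= u m + d m.
  have := lo N m; have := hi m N; rewrite addnC; have := d0 (N + m)%N; lra.
pose S := range (fun N => u N - d N).
have S0 : S !=set0 by exists (u 0%N - d 0%N), 0%N.
exists (sup S) => N; rewrite ler_norml; apply/andP; split.
  have : u N - d N <= sup S.
    apply: ub_le_sup; last by exists N.
    by exists (u 0%N + d 0%N) => _ [m _ <-].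
  by rewrite /d; lra.
have : sup S <= u N + d N by apply: ge_sup => // _ [m _ <-].
by rewrite /d; lra.
Qed.

Context {b : nat} (A : 'M[int]_b) (B : 'M[R]_b) (C rho : R).
Hypotheses (AB : real_mx R A *m B = 1%:M) (BA : B *m real_mx R A = 1%:M).
Hypotheses (C0 : 0 <= C) (rho0 : 0 < rho) (rho1 : rho < 1).
Hypothesis B_decay : forall k (v : 'cV[R]_b), `|iter k (mulmx B) v| <= C * rho ^+ k * `|v|.

Context (Ma : topologicalType) (ft : Ma -> Ma) (iotat : Ma -> 'cV[R]_b).
Hypotheses (ft_cont : continuous ft) (iotat_cont : continuous iotat).
Context (K : R) (iotat_ft : forall x, `|iotat (ft x) - real_mx R A *m iotat x| <= K).

Let AR := real_mx R A.
Let approx N x := iter N (mulmx B) (iotat (iter N ft x)).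

Lemma iter_mulmxB k (v w : 'cV[R]_b) (M : 'M[R]_b) :
  iter k (mulmx M) (v - w) = iter k (mulmx M) v - iter k (mulmx M) w.
Proof. by elim: k => //= k ->; rewrite mulmxBr. Qed.

Lemma iter_BA k (v : 'cV[R]_b) : iter k (mulmx B) (iter k (mulmx AR) v) = v.
Proof. by elim: k v => //= k IH v; rewrite -iterS iterSr mulmxA BA mul1mx IH. Qed.

Lemma shadowing_map : exists alphat : Ma -> 'cV[R]_b,
  [/\ continuous alphat, forall x, alphat (ft x) = AR *m alphat x &
      forall x, unique (shadows ft iotat A x) (alphat x)].
Proof.
have [D [D0 appr]] : exists D, 0 <= D /\
    forall x N, `|approx N.+1 x - approx N x| <= D * rho ^+ N.
  (* K is known to be nonnegative only once [Ma] has a point, hence the absolute value. *)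
  exists (C * rho * `|K|); split; first by rewrite !mulr_ge0// ltW.
  move=> x N; rewrite /approx; set z := iter N ft x.
  (* Replacing [iotat z] by B A [iotat z] makes the difference of consecutive terms B^(N+1) applied
     to the bounded defect [iotat (ft z)] - A [iotat z]. *)
  have -> : iter N (mulmx B) (iotat z) = iter N.+1 (mulmx B) (AR *m iotat z).
    by rewrite iterSr mulmxA BA mul1mx.
  rewrite -iter_mulmxB (le_trans (B_decay _ _))// exprS mulrA mulrAC.
  apply: ler_wpM2r; first by rewrite exprn_ge0 ?ltW.
  apply: ler_wpM2l; first by rewrite mulr_ge0// ltW.
  by rewrite (le_trans (iotat_ft z))// ler_norm.
pose c := D / (1 - rho).
have c0 : 0 <= c by rewrite divr_ge0// subr_ge0 ltW.
have lim_coord x (i : 'I_b) : exists l, forall N, `|l - approx N x i 0| <= c * rho ^+ N.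
  apply: geometric_limit => // N; apply: le_trans (appr x N).
  by have := mx_norm_coord (approx N.+1 x - approx N x) i 0; rewrite !mxE.
have /choice[al alP] : forall xi : Ma * 'I_b,
    exists l, forall N, `|l - approx N xi.1 xi.2 0| <= c * rho ^+ N.
  by case=> x i; exact: lim_coord.
pose alphat x : 'cV[R]_b := \col_i al (x, i).
have close x N : `|alphat x - approx N x| <= c * rho ^+ N.
  apply: mx_norm_le => [|i j]; first by rewrite mulr_ge0// exprn_ge0// ltW.
  by rewrite ord1 !mxE; exact: (alP (x, i)).
have cft N : continuous (iter N ft).
  elim: N => [|N IH] x; first exact: cvg_id.
  by apply: (@continuous_comp _ _ _ (iter N ft) ft); [exact: IH|exact: ft_cont].
have capprox N : continuous (approx N).
  have cB : continuous (iter N (mulmx B) : 'cV[R]_b -> 'cV[R]_b).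
    elim: N => [|N IH] x; first exact: cvg_id.
    by apply: (@continuous_comp _ _ _ (iter N (mulmx B)) (mulmx B)); [exact: IH|exact: mulmx_continuous].
  move=> x; apply: (@continuous_comp _ _ _ (fun x => iotat (iter N ft x))); last exact: cB.
  by apply: (@continuous_comp _ _ _ (iter N ft)); [exact: cft|exact: iotat_cont].
have al_ft x : alphat (ft x) = AR *m alphat x.
  apply/eqP; rewrite -subr_eq0; apply/eqP.
  have [a [a0 aP]] : exists a, 0 <= a /\ forall i j, `|AR i j| <= a.
    by exists `|AR|; split=> // i j; exact: mx_norm_coord.
  apply: (@geometric_eq0 _ rho (c + b%:R * a * (c * rho))) => //.
    apply: addr_ge0 => //; apply: mulr_ge0; first exact: mulr_ge0.
    by apply: mulr_ge0 => //; exact: ltW.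
  (* The approximations satisfy the wanted identity up to a shift of N, so both sides differ only by
     the errors at N and N + 1, which decay. *)
  move=> N; have E : approx N (ft x) = AR *m approx N.+1 x.
    by rewrite /approx iterS mulmxA AB mul1mx iterSr.
  have -> : alphat (ft x) - AR *m alphat x =
      (alphat (ft x) - approx N (ft x)) - AR *m (alphat x - approx N.+1 x).
    by rewrite mulmxBr -E opprB addrA subrK.
  rewrite (le_trans (ler_normB _ _))// mulrDl lerD//.
  apply: le_trans (mulmx_norm_le _ a0 aP) _.
  rewrite -[leRHS]mulrA; apply: ler_wpM2l; first by rewrite mulr_ge0.
  by rewrite -mulrA -exprS.
have al_iter x N : alphat (iter N ft x) = iter N (mulmx AR) (alphat x).
  by elim: N => //= N IH; rewrite al_ft IH.
exists alphat; split=> //.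
- move=> x; apply/cvgrPdist_lt => e e0.
  have e3 : 0 < e / 3 by exact: divr_gt0.
  have [N Ne] := geometric_small rho0 rho1 c0 e3.
  have /cvgrPdist_lt/(_ _ e3) := capprox N x; apply: filterS => y xy.
  have -> : alphat x - alphat y = (alphat x - approx N x) + (approx N x - approx N y) + (approx N y - alphat y).
    by rewrite !subrKA.
  have h1 := close x N; have := close y N; rewrite distrC => h2.
  rewrite (le_lt_trans (ler_normD _ _))// (le_lt_trans (lerD (ler_normD _ _) (lexx _)))//.
  by lra.
- move=> x; split.
    (* [close] at N = 0, used at each point of the orbit: one constant c serves all x. *)
    exists c => N; rewrite -al_iter distrC; apply: le_trans (close _ 0%N) _.
    by rewrite mulr1.
  (* A^N (alphat x - y) is bounded by c + K1 for all N; applying B^N to it brings in the decay. *)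
  move=> y [K1 K1P]; apply/eqP; rewrite -subr_eq0; apply/eqP.
  have cK1 : 0 <= c + K1.
    by rewrite addr_ge0// (le_trans _ (K1P 0%N)).
  apply: (@geometric_eq0 _ rho (C * (c + K1))) => //; first exact: mulr_ge0.
  move=> N; rewrite -(iter_BA N (alphat x - y)) (le_trans (B_decay _ _))//.
  rewrite mulrAC; apply: ler_wpM2r; first by rewrite exprn_ge0// ltW.
  apply: ler_wpM2l => //; rewrite iter_mulmxB -al_iter.
  rewrite -(subrKA (iotat (iter N ft x))) (le_trans (ler_normD _ _))// lerD//.
  by apply: le_trans (close _ 0%N) _; rewrite mulr1.
Qed.

End Shadowing.

(** * Descent to the manifold *)

Section Descent.
Context (E B : topologicalType) (p : E -> B) (p_cov : is_covering p).

(** Continuity of G is local on B, where F composed with a section of p computes it. The factor X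
    carries the time of a homotopy. *)
Lemma covering_descent (X Y : topologicalType) (F : X * E -> Y) (G : X * B -> Y) :
  continuous F -> (forall x u, G (x, p u) = F (x, u)) -> continuous G.
Proof.
move=> cF GF [x m]; have [_ p_onto _] := p_cov; have [u _ um] := p_onto m I.
have [U [s [oU Um cs ps _]]] := covering_section p_cov um.
have FG : \forall w \near (x, m), F (w.1, s w.2) = G w.
  exists (setT, U); first by split; [exact: filterT|exact: open_nbhs_nbhs].
  by move=> [x' m'] [/= _ Um']; rewrite -GF ps.
have Gxm : G (x, m) = F (x, s m) by rewrite -(nbhs_singleton FG).
have FF := nbhs_filter (x, m).
rewrite /continuous_at Gxm; apply: cvg_trans (near_eq_cvg FG) _.
apply: (@cvg_comp _ _ _ (fun w : X * B => (w.1, s w.2)) F _ (nbhs (x, s m))); last exact: cF.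
apply: cvg_pair; first exact: cvg_fst.
by apply: (@cvg_comp _ _ _ snd s _ (nbhs m)); [exact: cvg_snd|exact: cs].
Qed.

Lemma covering_descent1 (Y : topologicalType) (F : E -> Y) (G : B -> Y) :
  continuous F -> (forall u, G (p u) = F u) -> continuous G.
Proof.
move=> cF GF m.
have cG : continuous (fun w : B * B => G w.2).
  apply: (@covering_descent B Y (fun w => F w.2)) => // w.
  by apply: (@continuous_comp _ _ _ snd F); [exact: cvg_snd|exact: cF].
apply: (@continuous_comp _ _ _ (fun y => (m, y)) (fun w : B * B => G w.2)); last exact: cG.
by apply: cvg_pair; [exact: cvg_cst|exact: cvg_id].
Qed.

End Descent.

Lemma torus_endo_proj (R : realType) b (A : 'M[int]_b) (y : 'cV[R]_b) :
  torus_endo A (torus_proj y) = torus_proj (real_mx R A *m y).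
Proof.
have [v vE] := torus_proj_eqP (torus_proj_repr (torus_proj y)).
by rewrite /torus_endo vE mulmxDr -map_mxM torus_proj_shift.
Qed.

Lemma map_intr_inj (R : realType) b : injective (map_mx intr : 'cV[int]_b -> 'cV[R]_b).
Proof.
by move=> u v /matrixP uv; apply/colP => i; have := uv i 0; rewrite !mxE => /intr_inj.
Qed.

(** * The lifted semiconjugacy on the abelian cover *)

Section SemiconjugacyOnCover.
Context {R : realType} {b : nat} (M U Ma : topologicalType).
Context (pi : continuousType Ma M) (q : U -> Ma) (q_quot : quotient_map q).
Context (p_cov : is_covering (pi \o q)) (M_compact : compact [set: M]).
Context (A : 'M[int]_b) (A_exp : H1_expanding R A) (b_gt0 : (0 < b)%N).
Context (f : M -> M) (ft : Ma -> Ma) (ft_cont : continuous ft).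
Context (ft_lift : forall x, pi (ft x) = f (pi x)).
Context (iotat : Ma -> 'cV[R]_b) (iotat_cont : continuous iotat).
Context (iotat_fiber : forall x y, pi x = pi y -> exists v : 'cV[int]_b,
  iotat y = iotat x + map_mx intr v /\
  iotat (ft y) = iotat (ft x) + map_mx intr (A *m v)).

Lemma abelian_cover_onto m : exists x, pi x = m.
Proof. by have [_ /(_ m I)[u _ um] _] := p_cov; exists (q u). Qed.

Lemma ft_iotat_bounded : exists K, forall x, `|iotat (ft x) - real_mx R A *m iotat x| <= K.
Proof.
pose G x := iotat (ft x) - real_mx R A *m iotat x.
have GP x y : pi x = pi y -> G x = G y.
  move=> /iotat_fiber[v [vE vE']]; rewrite /G vE vE' mulmxDr map_mxM.
  by rewrite opprD addrACA subrr addr0.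
have [r rP] := choice abelian_cover_onto.
have cG : continuous G.
  move=> x; apply: cvgB.
    by apply: (@continuous_comp _ _ _ ft iotat); [exact: ft_cont|exact: iotat_cont].
  by apply: (@continuous_comp _ _ _ iotat (mulmx (real_mx R A)));
    [exact: iotat_cont|exact: mulmx_continuous].
have cGr : continuous (G \o r).
  apply: (@covering_descent1 _ _ _ p_cov _ (G \o q)) => [u|u].
    by apply: (@continuous_comp _ _ _ q G); [exact: q_continuous|exact: cG].
  by apply: GP; rewrite rP.
have /compact_bounded[K [_ KP]] := continuous_compact (continuous_subspaceT cGr) M_compact.
exists (K + 1) => x; apply: KP; first by rewrite ltrDl.
by exists (pi x) => //=; apply: GP; rewrite rP.
Qed.

(** [iotat_fiber] yields some integral vector w; as Z^b embeds in R^b, the displacement of [iotat]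
    identifies it with v, and the induction continues with A v. *)
Lemma iotat_iter_fiber N x y (v : 'cV[int]_b) : pi x = pi y ->
  iotat y = iotat x + map_mx intr v ->
  iotat (iter N ft y) = iotat (iter N ft x) + iter N (mulmx (real_mx R A)) (map_mx intr v).
Proof.
elim: N x y v => // N IH x y v xy xyv; have [w [yw ftw]] := iotat_fiber xy.
have wv : w = v by apply: (@map_intr_inj R); apply: (addrI (iotat x)); rewrite -yw.
rewrite !iterSr -map_mxM -wv; apply: IH => //.
by rewrite !ft_lift xy.
Qed.

Lemma semiconjugacy_lift : exists alphat : Ma -> 'cV[R]_b,
  [/\ continuous alphat, forall x, alphat (ft x) = real_mx R A *m alphat x,
      forall x, unique (shadows ft iotat A x) (alphat x) &
      forall x y, pi x = pi y -> exists v : 'cV[int]_b,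
        iotat y = iotat x + map_mx intr v /\ alphat y = alphat x + map_mx intr v].
Proof.
have [B [C [rho [AB BA [C0 r0 r1] decay]]]] := H1_expanding_inverse b_gt0 A_exp.
have [K KP] := ft_iotat_bounded.
have [alphat [cal al_ft al_uniq]] := shadowing_map AB BA C0 r0 r1 decay ft_cont iotat_cont KP.
exists alphat; split=> // x y xy; have [v [vE _]] := iotat_fiber xy.
(* By uniqueness it suffices that alphat x + v shadows y: the iterates of [iotat] and those of A
   both move by A^N v, so the constant of x still works. *)
exists v; split=> //; apply: (al_uniq y).2.
have [[K1 K1P] _] := al_uniq x; exists K1 => N.
have iterD k (u w : 'cV[R]_b) : iter k (mulmx (real_mx R A)) (u + w) =
    iter k (mulmx (real_mx R A)) u + iter k (mulmx (real_mx R A)) w.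
  by elim: k => //= k ->; rewrite mulmxDr.
by rewrite (iotat_iter_fiber N xy vE) iterD opprD addrACA subrr addr0.
Qed.

End SemiconjugacyOnCover.

(** * Homotopy to [iota], surjectivity on the torus, and the descent to M *)

(** Within a fibre of p both lifts move by the same integral vector w, hence so does each point (1 -
    t) u + t v of the segment between them; the straight homotopy is therefore well defined on B. *)
Lemma covering_straight_homotopy (R : realType) b (E B : topologicalType) (p : E -> B)
    (u v : E -> 'cV[R]_b) (g h : B -> torus R b) :
  is_covering p -> continuous u -> continuous v ->
  (forall x, g (p x) = torus_proj (u x)) -> (forall x, h (p x) = torus_proj (v x)) ->
  (forall x y, p x = p y -> exists w : 'cV[int]_b,
    v y = v x + map_mx intr w /\ u y = u x + map_mx intr w) ->
  homotopic (R := R) g h.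
Proof.
move=> p_cov cu cv gu hv uv; have [_ p_onto _] := p_cov.
have /choice[r rP] : forall m, exists x, p x = m by move=> m; have [x _ xm] := p_onto m I; exists x.
pose F (w : R * E) := torus_proj ((1 - w.1) *: u w.2 + w.1 *: v w.2).
pose H (w : R * B) := F (w.1, r w.2).
have cF : continuous F.
  move=> w; apply: (@continuous_comp _ _ _ (fun w : R * E => (1 - w.1) *: u w.2 + w.1 *: v w.2));
    last exact: torus_proj_continuous.
  have FF := nbhs_filter w.
  apply: cvgD; apply: cvgZ.
  - by apply: cvgB; [exact: cvg_cst|exact: cvg_fst].
  - by apply: (@continuous_comp _ _ _ snd u); [exact: cvg_snd|exact: cu].
  - exact: cvg_fst.
  - by apply: (@continuous_comp _ _ _ snd v); [exact: cvg_snd|exact: cv].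
exists H; split=> [|m|m].
- apply: continuous_subspaceT; apply: (covering_descent p_cov cF) => t x.
  have [w [/= vw uw]] := uv _ _ (esym (rP (p x))).
  rewrite /H /F/= uw vw !scalerDr addrACA -scalerDl subrK scale1r.
  by rewrite torus_proj_shift.
- by rewrite /H /F/= subr0 scale1r scale0r addr0 -gu rP.
- by rewrite /H /F/= subrr scale1r scale0r add0r -hv rP.
Qed.

(** The map on the torus is [alpha \o k]. A path g from [x0] to its translate by the j-th basis
    vector projects to a loop, and the image of this loop lifts to [alphat \o g], whose increment is
    that vector: these are the loops that [torus_self_map_onto] asks for. *)
Lemma homeomorphic_torus_onto (R : realType) b (M Ma : topologicalType)
    (pi : continuousType Ma M) (alphat : Ma -> 'cV[R]_b) (alpha : M -> torus R b)
    (delta : 'cV[int]_b -> Ma -> Ma) (x0 : Ma) :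
  (forall x y : Ma, exists gamma : R -> Ma, stationary x y gamma) ->
  continuous alphat -> continuous alpha ->
  (forall x, alpha (pi x) = torus_proj (alphat x)) ->
  (forall v x, pi (delta v x) = pi x) ->
  (forall v x, alphat (delta v x) = alphat x + map_mx intr v) ->
  homeomorphic M (torus R b) -> set_surj [set: M] [set: torus R b] alpha.
Proof.
move=> joined alphat_cont alpha_cont alphaE pi_delta al_delta [h [k [[_ _ kh _] [ch ck]]]] t _.
have {}ch : continuous h by apply/continuous_subspace_setT.
have {}ck : continuous k by apply/continuous_subspace_setT.
have [|j|s <-] := @torus_self_map_onto R b (alpha \o k) _ _ t; last by exists (k s).
- by move=> s; apply: (@continuous_comp _ _ _ k alpha); [exact: ck|exact: alpha_cont].
have [g sg] := joined x0 (delta (delta_mx j 0) x0).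
have cg : continuous g by have [] := sg.
exists (h \o pi \o g), (alphat \o g); split.
- move=> s; apply: (@continuous_comp _ _ _ g (h \o pi)); first exact: cg.
  by apply: (@continuous_comp _ _ _ pi h); [exact: cts_fun|exact: ch].
- by move=> s; apply: (@continuous_comp _ _ _ g alphat); [exact: cg|exact: alphat_cont].
- by rewrite /= (stationary0 sg) (stationary1 sg) pi_delta.
- by move=> s; rewrite /= kh// alphaE.
- by rewrite /= (stationary0 sg) (stationary1 sg) al_delta map_delta_mx.
Qed.

Theorem theorem7p5 (R : realType) (n b : nat)
  (M : topologicalType) (atl : smooth_atlas R n M) (g : riemannian_metric atl)
  (M_hausdorff : hausdorff_space M)
  (M_compact : compact [set: M]) (M_connected : connected [set: M])
  (M_orientable : orientable atl)
  (b_gt0 : (0 < b)%N)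
  (Gamma : 'I_b -> chain (R := R) 1 M) (Gamma_basis : homology_basis Gamma)
  (f : continuousType M M) (f_onto : set_surj [set: M] [set: M] f)
  (f_orient : orientation_preserving (R := R) n f)
  (A : 'M[int]_b) (f_A : induced_matrix f Gamma A)
  (f_expanding : H1_expanding R A)
  (Ma : topologicalType) (pi : continuousType Ma M)
  (pi_cover : universal_abelian_cover R pi)
  (delta : 'cV[int]_b -> Ma -> Ma) (delta_deck : deck_action pi Gamma delta)
  (ft : continuousType Ma Ma) (ft_lift : pi \o ft = f \o pi)
  (omega : 'I_b -> one_form atl)
  (omega_harmonic : forall i, harmonic_form g (omega i))
  (omega_basis : deRham_basis omega)
  (omega_dual : forall i j, deRham_pairing (omega i) (Gamma j) (i == j)%:R)
  (x0 : Ma) (iotat : Ma -> 'cV[R]_b)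
  (iotat_int : integration_map pi omega x0 iotat)
  (iota : M -> torus R b)
  (iota_iotat : forall x, iota (pi x) = torus_proj (iotat x)) :
  exists alphat : Ma -> 'cV[R]_b,
    (forall x, unique (shadows ft iotat A x) (alphat x)) /\
    continuous alphat /\
    (forall v x, alphat (delta v x) = alphat x + map_mx intr v) /\
    (forall x, alphat (ft x) = real_mx R A *m alphat x) /\
    exists alpha : M -> torus R b,
      (forall x, alpha (pi x) = torus_proj (alphat x)) /\
      continuous alpha /\
      (forall x, alpha (f x) = torus_endo A (alpha x)) /\
      compact (range alpha) /\
      torus_endo A @` range alpha = range alpha /\
      homotopic (R := R) alpha iota /\
      (homeomorphic M (torus R b) -> set_surj [set: M] [set: torus R b] alpha).
Proof.
have [U [p [q [p_cov [U_path _] q_quot pq _]]]] := pi_cover.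
rewrite -pq in p_cov; have q_cont := q_continuous q_quot.
have joined (x y : Ma) : exists gamma : continuousType R Ma,
    stationary x y gamma /\ smooth_curve atl (pi \o gamma).
  have [q_onto _] := q_quot.
  have [u _ <-] := q_onto x I; have [v _ <-] := q_onto y I.
  have [gamma [sg mg]] := path_connected_joined atl p_cov U_path u v.
  have sqg := stationary_comp q_cont sg.
  by exists (mkcts sqg.1).
pose i0 := Ordinal b_gt0.
have iotat_cont : continuous iotat.
  apply: (iotat_continuous _ q_quot p_cov) => x y gamma.
  exact: (iotat_path delta_deck omega_dual iotat_int joined i0).
have fiber x y := iotat_fiber Gamma_basis f_A delta_deck ft_lift omega_dual iotat_int joined i0
  (x := x) (y := y).
have pi_ft x : pi (ft x) = f (pi x) := congr1 (@^~ x) ft_lift.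
have pi_delta v x : pi (delta v x) = pi x.
  by have [[_ _ h] _] := delta_deck v; exact: (congr1 (fun k : Ma -> M => k x) h).
have ft_cont : continuous ft by exact: cts_fun.
have [alphat [al_cont al_ft al_uniq al_fiber]] :=
  semiconjugacy_lift q_quot p_cov M_compact f_expanding b_gt0 ft_cont pi_ft iotat_cont fiber.
have al_delta v x : alphat (delta v x) = alphat x + map_mx intr v.
  (* w displaces both [iotat] and [alphat]; the known displacement of [iotat] under a deck
     transformation identifies it with v. *)
  have [w [iw ->]] := al_fiber _ _ (esym (pi_delta v x)).
  congr (_ + map_mx intr _); apply: (@map_intr_inj R); apply: (addrI (iotat x)).
  by rewrite -iw (iotat_delta delta_deck omega_dual iotat_int joined i0).
exists alphat; split; [exact: al_uniq|split; [exact: al_cont|split; [exact: al_delta|split; [exact: al_ft|]]]].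
have [r rP] := choice (abelian_cover_onto p_cov).
(* [r] is a mere choice of a point in each fibre; another choice changes [alphat] by an integral
   vector. *)
pose alpha m := torus_proj (alphat (r m)).
have alphaE x : alpha (pi x) = torus_proj (alphat x).
  have [v [_ alE]] := al_fiber _ _ (esym (rP (pi x))).
  by rewrite /alpha alE torus_proj_shift.
have alq_cont : continuous (alphat \o q).
  by move=> u; apply: (@continuous_comp _ _ _ q alphat); [exact: q_cont|exact: al_cont].
have iq_cont : continuous (iotat \o q).
  by move=> u; apply: (@continuous_comp _ _ _ q iotat); [exact: q_cont|exact: iotat_cont].
have alpha_cont : continuous alpha.
  apply: (covering_descent1 p_cov (F := @torus_proj R b \o (alphat \o q))) => u.
    by apply: (@continuous_comp _ _ _ (alphat \o q)); [exact: alq_cont|exact: torus_proj_continuous].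
  exact: alphaE.
have alpha_f m : alpha (f m) = torus_endo A (alpha m).
  by rewrite -(rP m) -pi_ft !alphaE torus_endo_proj al_ft.
exists alpha; split; [exact: alphaE|split; [exact: alpha_cont|split; [exact: alpha_f|split]]].
  exact: continuous_compact (continuous_subspaceT alpha_cont) M_compact.
split.
  rewrite eqEsubset; split=> [_ [_ [m _ <-] <-]|_ [m _ <-]].
    by exists (f m) => //; rewrite alpha_f.
  (* Surjectivity of [f] places alpha(M) inside its image under the torus endomorphism. *)
  by have [m' _ <-] := f_onto m I; exists (alpha m'); rewrite ?alpha_f//; exists m'.
split.
  apply: (covering_straight_homotopy p_cov alq_cont iq_cont) => [u|u|u v uv].
  - exact: alphaE.
  - exact: iota_iotat.
  - exact: al_fiber.
apply: (homeomorphic_torus_onto x0 _ al_cont alpha_cont alphaE pi_delta al_delta) => x y.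
by have [gamma [sg _]] := joined x y; exists gamma.
Qed.
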